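(* Fix $h\ge0$, $D\in\mathbb R$. There exists $\beta'>0$ such that for every $\beta\in(0,\beta')$: for any integer $n$ and nonnegative integers $h(k,l)$ ($1\le k<l\le n$), $h(k),h'(k)$ ($k\in[n]$), $h,h'$, with $H$ their total sum, $$\nu\Big(\prod_{k<l}T_{k,l}^{h(k,l)}\prod_kT_k^{h(k)}T^h\prod_kS_k^{h'(k)}S^{h'}\Big)=\prod_{k<l}a(h(k,l))\,(A_2^2)^{h(k,l)/2}\;\nu\Big(\prod_kT_k^{h(k)}T^h\prod_kS_k^{h'(k)}S^{h'}\Big)+O(N^{-(H+1)/2}),$$ where $a(x)=\mathbb E[g^x]$ for $g\sim N(0,1)$ and the implied constant is independent of $N$.
   Context: Fix an integer $\mathcal S\ge1$ and $N\ge2$; $\Sigma_N=\{0,\pm1,\dots,\pm\mathcal S\}^N$. For $\beta>0$, $h\ge0$, $D\in\mathbb R$ and i.i.d. standard Gaussians $(g_{i,j})_{i<j}$, $H_N(\sigma)=\frac{\beta}{\sqrt N}\sum_{i<j}g_{i,j}\sigma_i\sigma_j+D\sum_i\sigma_i^2+h\sum_i\sigma_i$, Gibbs measure $G(\sigma)\propto e^{H_N(\sigma)}$ on $\Sigma_N$. Replicas are i.i.d. samples from $G$ given the disorder; $\langle\cdot\rangle$ is the product Gibbs average, $\nu(f)=\mathbb E\langle f\rangle$. $p,q$: for $\eta\sim N(0,1)$, $\langle\phi\rangle_\eta=\sum_s\phi(s)w_\eta(s)/\sum_sw_\eta(s)$, $w_\eta(s)=\exp(\beta\sqrt q\eta s+hs+(D+\frac{\beta^2}{2}(p-q))s^2)$,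 $s\in\{0,\pm1,\dots,\pm\mathcal S\}$; $(p,q)$ solves $q=\mathbb E\langle s\rangle_\eta^2$, $p=\mathbb E\langle s^2\rangle_\eta$ (unique at high temperature). Basis: $b_i=\langle\sigma_i\rangle$, $\tilde b_i=\langle\sigma_i^2\rangle$; $T_{k,l}=\frac1N\sum_i(\sigma_i^k-b_i)(\sigma_i^l-b_i)$ ($k\ne l$), $T_k=\frac1N\sum_i(\sigma^k_i-b_i)b_i$, $T=\frac1N\sum_ib_i^2-q$, $S_k=\frac1N\sum_i((\sigma_i^k)^2-\tilde b_i)$, $S=\frac1N\sum_i\tilde b_i-p$. Constant: with $m_j=\langle s^j\rangle_\eta$, $A=\mathbb E[(m_2-m_1^2)^2]$ and $A_2^2=\frac{A}{N(1-\beta^2A)}$. *)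

(* Defs.v *)
From HB Require Import structures.
From mathcomp Require Import all_boot all_order all_algebra.
From mathcomp Require Import all_classical all_reals all_analysis.
Set Implicit Arguments.
Unset Strict Implicit.
Unset Printing Implicit Defensive.
Import Order.TTheory GRing.Theory Num.Theory.
Import numFieldNormedType.Exports.
Local Open Scope ring_scope.

Section Model.
Variable R : realType.

Definition gexp (F : R -> R) : R := \int[normal_prob (0:R) 1]_x F x.

Definition gmoment (x : nat) : R := gexp (fun g => g ^+ x).

(** Spin values {-S,...,S}, encoded by 'I_(2S+1): i |-> i - S. *)
Definition spin (S : nat) (s : 'I_(S.*2.+1)) : R := s%:R - S%:R.

Definition config (N S : nat) := {ffun 'I_N -> 'I_(S.*2.+1)}.

(** Disorder: g i j (only i < j is used). *)
Definition disorder := nat -> nat -> R.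

Definition hamil (N S : nat) (beta D hf : R) (g : disorder) (s : config N S) : R :=
  beta / Num.sqrt (N%:R) *
    (\sum_(i < N) \sum_(j < N | (i < j)%N) g i j * spin (s i) * spin (s j))
  + D * (\sum_(i < N) spin (s i) ^+ 2) + hf * (\sum_(i < N) spin (s i)).

Definition partition (N S : nat) beta D hf g : R :=
  \sum_(s : config N S) expR (hamil beta D hf g s).

Definition gibbs_avg (N S n : nat) beta D hf g
    (f : {ffun 'I_n -> config N S} -> R) : R :=
  (\sum_(rho : {ffun 'I_n -> config N S})
     f rho * \prod_(k < n) expR (hamil beta D hf g (rho k)))
  / partition N S beta D hf g ^+ n.

Definition bmag (N S : nat) beta D hf g (i : 'I_N) : R :=
  gibbs_avg (n:=1) beta D hf g
    (fun rho : {ffun 'I_1 -> config N S} => spin (rho ord0 i)).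
Definition bmag2 (N S : nat) beta D hf g (i : 'I_N) : R :=
  gibbs_avg (n:=1) beta D hf g
    (fun rho : {ffun 'I_1 -> config N S} => spin (rho ord0 i) ^+ 2).

Definition upd (g : disorder) (i j : nat) (x : R) : disorder :=
  fun a b => if (a == i) && (b == j) then x else g a b.

Fixpoint Eiter (l : seq (nat * nat)) (F : disorder -> R) (g0 : disorder) : R :=
  match l with
  | [::] => F g0
  | (i, j) :: l' => gexp (fun x => Eiter l' F (upd g0 i j x))
  end.

Definition pairs (N : nat) : seq (nat * nat) :=
  [seq ij <- [seq (i, j) | i <- iota 0 N, j <- iota 0 N] | (ij.1 < ij.2)%N].

Definition Edis (N : nat) (F : disorder -> R) : R :=
  Eiter (pairs N) F (fun _ _ => 0).

Definition nu (N S n : nat) beta D hf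
    (f : disorder -> {ffun 'I_n -> config N S} -> R) : R :=
  Edis N (fun g => gibbs_avg beta D hf g (f g)).

Definition wgt (S : nat) beta D hf p q (eta : R) (s : 'I_(S.*2.+1)) : R :=
  expR (beta * Num.sqrt q * eta * spin s + hf * spin s
        + (D + beta ^+ 2 / 2 * (p - q)) * spin s ^+ 2).

Definition avg_eta (S : nat) beta D hf p q eta (phi : R -> R) : R :=
  (\sum_(s : 'I_(S.*2.+1)) phi (spin s) * wgt beta D hf p q eta s)
  / (\sum_(s : 'I_(S.*2.+1)) wgt beta D hf p q eta s).

Definition fixed_point (S : nat) beta D hf p q : Prop :=
  q = gexp (fun eta => avg_eta S beta D hf p q eta id ^+ 2) /\
  p = gexp (fun eta => avg_eta S beta D hf p q eta (fun s => s ^+ 2)).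

Definition Aconst (S : nat) beta D hf p q : R :=
  gexp (fun eta => (avg_eta S beta D hf p q eta (fun s => s ^+ 2)
                    - avg_eta S beta D hf p q eta id ^+ 2) ^+ 2).

Definition A2sq (N S : nat) beta D hf p q : R :=
  Aconst S beta D hf p q / (N%:R * (1 - beta ^+ 2 * Aconst S beta D hf p q)).

Section Basis.
Variables (N S n : nat) (b bt : 'I_N -> R) (rho : {ffun 'I_n -> config N S}).
Definition Tkl (k l : 'I_n) : R :=
  N%:R^-1 * \sum_(i < N) (spin (rho k i) - b i) * (spin (rho l i) - b i).
Definition Tk (k : 'I_n) : R :=
  N%:R^-1 * \sum_(i < N) (spin (rho k i) - b i) * b i.
Definition Tq (q : R) : R := N%:R^-1 * (\sum_(i < N) b i ^+ 2) - q.
Definition Sk (k : 'I_n) : R :=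
  N%:R^-1 * \sum_(i < N) (spin (rho k i) ^+ 2 - bt i).
Definition Sp (p : R) : R := N%:R^-1 * (\sum_(i < N) bt i) - p.
End Basis.

End Model.

(* Main.v *)
(* The cavity method. Every centring by [b_i] is replaced by a fresh replica, so that each factor
   becomes a linear form in the overlaps of independent replicas, centred at [q] (at [p] on the
   diagonal). One site is singled out and interpolated, through its Gaussian couplings, to a spin
   in an independent Gaussian field, whose law at the end of the path is the one-site measure
   [w_eta]. Gaussian integration by parts along the path and Gronwall's inequality give, for small
   [beta], moments of order [N^-k] for the centred overlaps to the power [2 k]. A second-order
   expansion of [nu (T_{k,l} * P)], with [P] a product of the other factors, then yields
     (1 - beta^2 A) nu (T_{k,l} P) = (A / N) \sum_(factors T_{k,l} of P) nu (P without it) + error,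
   because at a single site [(s_k - s_r) (s_l - s_r')] correlates only with the pair [s_k s_l].
   Dividing by [1 - beta^2 A], this is the recursion [a (h + 2) = (h + 1) a h] of the Gaussian
   moments with variance [A_2^2]. *)
Require Import Defs.
From HB Require Import structures.
From mathcomp Require Import all_boot all_order all_algebra.
From mathcomp Require Import all_classical all_reals all_analysis.
From mathcomp Require Import perm measurable_realfun ring lra.
Import Order.TTheory GRing.Theory Num.Theory.
Import numFieldNormedType.Exports.
Set Implicit Arguments.
Unset Strict Implicit.
Unset Printing Implicit Defensive.
Local Open Scope ring_scope.

(** * Gaussian expectations of functions of exponential growth *)

Section Exponential.
Variable R : realType.
Implicit Types u x y : R.

(** The threshold for [beta] has to be fixed before [n] and the exponents, whereas the Gronwall
    factor and the number of kernel terms grow with the number of replicas. The moment bound is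
    therefore made to fix the threshold with four replicas only: two for the observable and two
    fresh ones, for the Gibbs derivative and for the integration by parts. A single overlap sees at
    most two replicas, so the bound passes to every replica set, and the later expansions lose only
    constants. The threshold must also be uniform in the order of the moment; this is why removing a
    site from an overlap is paid with the coefficient [expR 1], and not with a power of 2. Each
    factor has order [N ^ (- 1 / 2)]. The claimed error is one order beyond the size of a product of
    [H] factors; once a factor is reduced to a bounded one-site function, this is two orders beyond
    the remaining [H - 1], whence an expansion to second order. In it, the one-site function is
    centred exactly because [p] and [q] solve the fixed-point equations. *)

Lemma expR_taylor1 u : `|expR u - 1 - u| <= u ^+ 2 * expR `|u|.
Proof.
have e0 := expR_gt0 u.
have h1 : 1 + u <= expR u := expR_ge1Dx u.
have h2 : 1 - u <= expR (- u) := expR_ge1Dx (- u).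
have h3 : expR u * expR (- u) = 1 by rewrite -expRD subrr expR0.
have h4 : expR u - 1 <= u * expR u by nra.
rewrite ger0_norm; last by lra.
case: (lerP 0 u) => u0.
  by rewrite ger0_norm //; nra.
rewrite ltr0_norm //.
have h5 : 1 <= expR (- u) by lra.
have h6 : expR u <= 1 by nra.
nra.
Qed.

Lemma expR_lip x y : `|expR x - expR y| <= expR (Num.max x y) * `|x - y|.
Proof.
wlog xy : x y / y <= x.
  move=> W; case/orP: (le_total y x) => xy; first exact: W.
  by rewrite distrC maxC (distrC x y); exact: W.
rewrite (max_idPl _) // !ger0_norm ?subr_ge0 ?ler_expR //.
have := ler_wpM2r (expR_ge0 x) (expR_ge1Dx (y - x)).
by rewrite -expRD subrK => h; lra.
Qed.

(** Takes the place of a limit: a difference quotient bounded linearly in every small increment must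
    vanish. *)
Lemma le_small_eq0 (a c : R) : (forall h, 0 < h -> h <= 1 -> `|a| <= c * h) -> a = 0.
Proof.
move=> H; apply/eqP; rewrite -normr_le0; apply/ler_addgt0Pr => e e0; rewrite add0r.
pose h := Num.min 1 (e / (1 + `|c|)).
have c1 : 0 < 1 + `|c| by rewrite ltr_wpDr.
have h0 : 0 < h by rewrite /h lt_min ltr01 divr_gt0.
have h1 : h <= 1 by rewrite /h ge_min lexx.
apply: (le_trans (H h h0 h1)).
have h2 : h <= e / (1 + `|c|) by rewrite /h ge_min lexx orbT.
apply: (@le_trans _ _ ((1 + `|c|) * h)).
  by rewrite ler_wpM2r ?(ltW h0) //; apply: (le_trans (ler_norm c)); rewrite lerDr.
by rewrite mulrC -ler_pdivlMr.
Qed.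

End Exponential.

(* Local Lipschitz continuity with exponential growth is stable under
   products and under Gaussian integration of one variable, so that no measurability
   argument beyond one dimension is ever needed. *)
Record gauge (R : realType) (T : Type) := Gauge {
  gsize : T -> R;
  gdist : T -> T -> R;
  gbase : T;
  gsize_ge0 : forall x, 0 <= gsize x;
  gdist_ge0 : forall x y, 0 <= gdist x y;
  gdist_base : forall x, gdist x gbase <= gsize x;
  gsize_base : gsize gbase = 0;
  gsize_lip : forall x y, `|gsize x - gsize y| <= gdist x y;
  gdist_size : forall x y, gdist x y <= gsize x + gsize y }.

Section LipExp.
Variables (R : realType) (T : Type) (G : gauge R T).
Local Notation n := (gsize G).
Local Notation d := (gdist G).

Definition lipexp (F : T -> R) := exists C k : R, [/\ 0 <= C, 0 <= k &
  forall x y, `|F x - F y| <= C * expR (k * (n x + n y)) * d x y].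

Lemma expR_gsize (k : R) x : 0 <= k -> 1 <= expR (k * n x).
Proof. by move=> k0; rewrite -expR0 ler_expR mulr_ge0 // gsize_ge0. Qed.

Lemma gsize_le_expR x : n x <= expR (n x).
Proof. by apply: le_trans (expR_ge1Dx _); rewrite lerDr. Qed.

Lemma lipexp_bound F : lipexp F -> exists C k : R,
  [/\ 0 <= C, 0 <= k & forall x, `|F x| <= C * expR (k * n x)].
Proof.
case=> C [k [C0 k0 H]]; exists (`|F (gbase G)| + C), (k + 1); split.
- by rewrite addr_ge0.
- by rewrite addr_ge0.
move=> x; have := H x (gbase G); rewrite gsize_base addr0 => h.
have h1 : `|F x| <= `|F (gbase G)| + `|F x - F (gbase G)|.
  by rewrite -{1}(subrKC (F (gbase G)) (F x)) ler_normD.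
apply: (le_trans h1); rewrite mulrDl; apply: lerD.
  by rewrite ler_peMr // expR_gsize // addr_ge0.
apply: (le_trans h); rewrite mulrDl mul1r expRD mulrA.
apply: ler_wpM2l; first by rewrite mulr_ge0 // expR_ge0.
exact: le_trans (gdist_base _ _) (gsize_le_expR _).
Qed.

Lemma lipexp_cst c : lipexp (fun=> c).
Proof.
exists 0, 0; split => // x y; rewrite subrr normr0 mul0r mul0r //.
Qed.

Lemma lipexpD F1 F2 : lipexp F1 -> lipexp F2 -> lipexp (fun x => F1 x + F2 x).
Proof.
move=> [C1 [k1 [C10 k10 H1]]] [C2 [k2 [C20 k20 H2]]].
exists (C1 + C2), (k1 + k2); split; rewrite ?addr_ge0 // => x y.
have -> : F1 x + F2 x - (F1 y + F2 y) = (F1 x - F1 y) + (F2 x - F2 y) by ring.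
apply: (le_trans (ler_normD _ _)).
have s0 : 0 <= n x + n y by rewrite addr_ge0 // gsize_ge0.
rewrite 2!mulrDl; apply: lerD.
  apply: (le_trans (H1 x y)); apply: ler_wpM2r; first exact: gdist_ge0.
  by apply: ler_wpM2l => //; rewrite ler_expR ler_wpM2r // lerDl.
apply: (le_trans (H2 x y)); apply: ler_wpM2r; first exact: gdist_ge0.
by apply: ler_wpM2l => //; rewrite ler_expR ler_wpM2r // lerDr.
Qed.

Lemma lipexpM F1 F2 : lipexp F1 -> lipexp F2 -> lipexp (fun x => F1 x * F2 x).
Proof.
move=> L1 L2.
have [D1 [l1 [D10 l10 B1]]] := lipexp_bound L1.
have [D2 [l2 [D20 l20 B2]]] := lipexp_bound L2.
case: L1 L2 => [C1 [k1 [C10 k10 H1]]] [C2 [k2 [C20 k20 H2]]].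
exists (D1 * C2 + C1 * D2), (l1 + k2 + (k1 + l2)); split.
- by rewrite addr_ge0 // mulr_ge0.
- by rewrite !addr_ge0.
move=> x y.
have nx := gsize_ge0 G x; have ny := gsize_ge0 G y; have dxy := gdist_ge0 G x y.
have -> : F1 x * F2 x - F1 y * F2 y = F1 x * (F2 x - F2 y) + (F1 x - F1 y) * F2 y by ring.
apply: (le_trans (ler_normD _ _)); rewrite !normrM 2!mulrDl; apply: lerD.
- apply: (le_trans (ler_pM (normr_ge0 _) (normr_ge0 _) (B1 x) (H2 x y))).
  rewrite !mulrA; apply: ler_wpM2r => //.
  rewrite -!mulrA; apply: ler_wpM2l => //.
  rewrite mulrCA; apply: ler_wpM2l => //.
  rewrite -expRD ler_expR; nra.
- apply: (le_trans (ler_pM (normr_ge0 _) (normr_ge0 _) (H1 x y) (B2 y))).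
  rewrite mulrAC; apply: ler_wpM2r => //.
  rewrite -!mulrA; apply: ler_wpM2l => //.
  rewrite mulrCA; apply: ler_wpM2l => //.
  rewrite -expRD ler_expR; nra.
Qed.

Lemma lipexpZ c F : lipexp F -> lipexp (fun x => c * F x).
Proof. by move=> h; apply: lipexpM => //; exact: lipexp_cst. Qed.

Lemma lipexpB F1 F2 : lipexp F1 -> lipexp F2 -> lipexp (fun x => F1 x - F2 x).
Proof.
move=> h1 h2; have := lipexpD h1 (lipexpZ (-1) h2).
by congr lipexp; apply/funext => x; rewrite mulN1r.
Qed.

Lemma lipexp_sum (I : Type) (r : seq I) (P : pred I) (F : I -> T -> R) :
  (forall i, P i -> lipexp (F i)) -> lipexp (fun x => \sum_(i <- r | P i) F i x).
Proof.
move=> h; elim: r => [|i r IH].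
  have := lipexp_cst 0; congr lipexp; apply/funext => x; by rewrite big_nil.
case Pi : (P i); last first.
  by move: IH; congr lipexp; apply/funext => x; rewrite big_cons Pi.
have := lipexpD (h i Pi) IH.
by congr lipexp; apply/funext => x; rewrite big_cons Pi.
Qed.

Lemma lipexp_lip F c : 0 <= c -> (forall x y, `|F x - F y| <= c * d x y) -> lipexp F.
Proof.
move=> c0 H; exists c, 0; split => // x y; rewrite mul0r expR0 mulr1; exact: H.
Qed.

Lemma lipexp_expR k : 0 <= k -> lipexp (fun x => expR (k * n x)).
Proof.
move=> k0; exists k, k; split => // x y.
have nx := gsize_ge0 G x; have ny := gsize_ge0 G y.
apply: (le_trans (expR_lip _ _)); rewrite -mulrBr normrM (ger0_norm k0) mulrA.
rewrite (mulrC (expR _)); apply: ler_pM => //.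
- by rewrite mulr_ge0 // expR_ge0.
- apply: ler_wpM2l => //; rewrite ler_expR ge_max; apply/andP; split; nra.
- exact: gsize_lip.
Qed.

Lemma lipexp_comp (F : T -> R) (f : T -> T) c : 0 <= c ->
  (forall x, n (f x) <= n x + c) -> (forall x y, d (f x) (f y) <= d x y) ->
  lipexp F -> lipexp (F \o f).
Proof.
move=> c0 Hn Hd [C [k [C0 k0 H]]]; exists (C * expR (k * (2 * c))), k; split => //.
  by rewrite mulr_ge0 // expR_ge0.
move=> x y /=; apply: (le_trans (H _ _)).
apply: ler_pM => //; first by rewrite mulr_ge0 // expR_ge0.
  exact: gdist_ge0.
rewrite -mulrA; apply: ler_wpM2l => //; rewrite -expRD ler_expR -mulrDr.
by apply: ler_wpM2l => //; have := Hn x; have := Hn y; lra.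
Qed.

End LipExp.

(** * One Gaussian variable: density, translation, integration by parts *)

Section OneDim.
Variable R : realType.

Definition gaugeR : gauge R R.
Proof.
refine (@Gauge R R (fun x => `|x|) (fun x y => `|x - y|) 0 _ _ _ _ _ _).
- by move=> x; exact: normr_ge0.
- by move=> x y; exact: normr_ge0.
- by move=> x; rewrite subr0.
- by rewrite normr0.
- by move=> x y; exact: ler_dist_dist.
- by move=> x y; exact: ler_normB.
Defined.

Local Notation mu := (normal_prob (0 : R) 1).
Local Notation leb := (@lebesgue_measure R).
Local Notation pdf := (normal_pdf (0 : R) 1).
Implicit Types F : R -> R.

Lemma lipexp_continuous F : lipexp gaugeR F -> continuous F.
Proof.
case=> C [k [C0 k0 /= H]] x; apply/cvgrPdist_le => e e0.
pose M := C * expR (k * (`|x| + (`|x| + 1))).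
have M0 : 0 <= M by rewrite mulr_ge0 // expR_ge0.
have dl : 0 < Num.min 1 (e / (M + 1)) by rewrite lt_min ltr01 divr_gt0 // ltr_wpDl.
near=> y.
have hy : `|x - y| < Num.min 1 (e / (M + 1)).
  by near: y; exact: cvgr_dist_lt.
have hy1 : `|x - y| < 1 by apply: (lt_le_trans hy); rewrite ge_min lexx.
have hy2 : `|x - y| <= e / (M + 1).
  by apply: (le_trans (ltW hy)); rewrite ge_min lexx orbT.
have yx : `|y| <= `|x| + 1.
  have : `|y| <= `|x| + `|x - y|.
    by rewrite -{1}(subKr x y); apply: ler_normB.
  lra.
apply: (le_trans (H x y)).
apply: (@le_trans _ _ (M * `|x - y|)).
  apply: ler_wpM2r => //; apply: ler_wpM2l => //; rewrite ler_expR /=.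
  by apply: ler_wpM2l => //; rewrite lerD2l.
apply: (@le_trans _ _ ((M + 1) * `|x - y|)).
  by apply: ler_wpM2r => //; rewrite lerDl.
by rewrite mulrC -ler_pdivlMr // ltr_wpDl.
Unshelve. all: by end_near. Qed.

(** The Radon-Nikodym derivative of the law and the explicit density have the same integral over
    every measurable set, hence agree almost everywhere. *)
Lemma ge0_integral_normal_prob (f : R -> R) : measurable_fun setT f ->
  (forall x, 0 <= f x) ->
  (\int[mu]_x (f x)%:E = \int[leb]_x ((f x)%:E * (pdf x)%:E))%E.
Proof.
move=> mf f0.
have mEf : measurable_fun setT (EFin \o f) by exact/measurable_EFinP.
rewrite -(Radon_Nikodym_SigmaFinite.change_of_variables (normal_prob_dominates 0 1)) //.
apply: ae_eq_integral => //.
- apply: emeasurable_funM => //.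
  exact: measurable_int (Radon_Nikodym_SigmaFinite.f_integrable (normal_prob_dominates 0 1)).
- apply: emeasurable_funM => //; apply/measurable_EFinP; exact: measurable_normal_pdf.
- apply: ae_eqe_mul2l.
  apply: integral_ae_eq => //.
  + exact: Radon_Nikodym_SigmaFinite.f_integrable (normal_prob_dominates 0 1).
  + by apply/measurable_EFinP; exact: measurable_normal_pdf.
  + move=> E _ mE.
    by rewrite -(Radon_Nikodym_SigmaFinite.f_integral (normal_prob_dominates 0 1)).
Qed.

(** The Cameron-Martin factor; it yields both the exponential moments and the translation
    formula. *)
Lemma normal_pdf_shift h x : normal_pdf h 1 x = pdf x * expR (h * x - h ^+ 2 / 2).
Proof.
rewrite !normal_pdfE ?oner_eq0 // /normal_fun -mulrA; congr (_ * _).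
rewrite -expRD; congr expR; rewrite expr1n; by field.
Qed.

Lemma integrable_expRZ k : mu.-integrable setT (EFin \o (fun x => expR (k * x))).
Proof.
have mE : measurable_fun setT (fun x : R => expR (k * x)).
  by apply: measurableT_comp => //; exact: measurable_funM.
apply/integrableP; split; first exact/measurable_EFinP.
under eq_integral do rewrite /= ger0_norm ?expR_ge0 //.
rewrite ge0_integral_normal_prob //.
have -> : (\int[leb]_x ((expR (k * x))%:E * (pdf x)%:E) =
    \int[leb]_x ((expR (k ^+ 2 / 2))%:E * (normal_pdf k 1 x)%:E))%E.
  apply: eq_integral => x _; rewrite -!EFinM (normal_pdf_shift k); congr EFin.
  rewrite [RHS]mulrCA -expRD [LHS]mulrC; congr (_ * expR _); ring.
rewrite integralZl //; last exact: integrable_normal_pdf.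
by rewrite integral_normal_pdf mule1 ltry.
Qed.

Lemma lipexp_integrable F : lipexp gaugeR F -> mu.-integrable setT (EFin \o F).
Proof.
move=> LF; have [C [k [C0 k0 /= H]]] := lipexp_bound LF.
apply: (@le_integrable _ _ _ mu _ measurableT (EFin \o F)
  (EFin \o (fun x => C * (expR (k * x) + expR (- k * x))))).
- apply/measurable_EFinP; apply: continuous_measurable_fun.
  exact: lipexp_continuous.
- move=> x _ /=; rewrite lee_fin (le_trans (H x)) //.
  have e1 := expR_ge0 (k * x); have e2 := expR_ge0 (- k * x).
  apply: le_trans (ler_norm _); apply: ler_wpM2l => //.
  have [x0|x0] := leP 0 (x : R).
    by rewrite (ger0_norm x0) lerDl.
  by rewrite (ltr0_norm x0) mulrN -mulNr lerDr.
- have h := integrableD measurableT (integrable_expRZ k) (integrable_expRZ (- k)).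
  exact: (integrableZl measurableT C h).
Qed.

Lemma gexpD F1 F2 : lipexp gaugeR F1 -> lipexp gaugeR F2 ->
  gexp (fun x => F1 x + F2 x) = gexp F1 + gexp F2.
Proof. by move=> h1 h2; rewrite /gexp RintegralD //; exact: lipexp_integrable. Qed.

Lemma gexpZ c F : lipexp gaugeR F -> gexp (fun x => c * F x) = c * gexp F.
Proof. by move=> h; rewrite /gexp RintegralZl //; exact: lipexp_integrable. Qed.

Lemma gexpB F1 F2 : lipexp gaugeR F1 -> lipexp gaugeR F2 ->
  gexp (fun x => F1 x - F2 x) = gexp F1 - gexp F2.
Proof. by move=> h1 h2; rewrite /gexp RintegralB //; exact: lipexp_integrable. Qed.

Lemma gexp_cst c : gexp (fun=> c) = c :> R.
Proof.
rewrite /gexp Rintegral_cst // [X in _ * fine X](_ : _ = 1%E) ?mulr1 //.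
exact: probability_setT.
Qed.

Lemma ler_gexp F1 F2 : lipexp gaugeR F1 -> lipexp gaugeR F2 ->
  (forall x, F1 x <= F2 x) -> gexp F1 <= gexp F2.
Proof. by move=> h1 h2 h; apply: le_Rintegral => //; exact: lipexp_integrable. Qed.

Lemma ler_norm_gexp F1 F2 : lipexp gaugeR F1 -> lipexp gaugeR F2 ->
  (forall x, `|F1 x| <= F2 x) -> `|gexp F1| <= gexp F2.
Proof.
move=> h1 h2 h; rewrite ler_norml -mulN1r -gexpZ //; apply/andP; split.
  apply: ler_gexp => //; first exact: lipexpZ.
  by move=> x; rewrite mulN1r; have := h x; rewrite ler_norml => /andP[].
by apply: ler_gexp => // x; exact: le_trans (ler_norm _) (h x).
Qed.

Lemma ge0_integral_translate (G : R -> R) h : continuous G -> (forall x, 0 <= G x) ->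
  (\int[leb]_x (G x)%:E = \int[leb]_x (G (x + h)%R)%:E)%E.
Proof.
move=> cG G0.
have dF : derive1 (fun x : R => x + h) = cst (1 : R).
  by apply/funext => x; rewrite derive1E deriveD // derive_id derive_cst addr0.
rewrite (@increasing_ge0_integration_by_substitutionT _ (fun x => x + h)) //.
- by apply: eq_integral => x _; rewrite dF /= mulr1.
- by move=> x y xy; rewrite ltrD2r.
- by rewrite dF => x; exact: cvg_cst.
- by rewrite dF; exact: is_cvg_cst.
- by rewrite dF; exact: is_cvg_cst.
- exact: cvg_addrr_Ny.
- exact: cvg_addrr.
Qed.

Lemma lipexp_expR_affine a b : lipexp gaugeR (fun x => expR (a * x + b)).
Proof.
exists (`|a| * expR `|b|), `|a|; split => //.
move=> x y /=; apply: (le_trans (expR_lip _ _)).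
have -> : a * x + b - (a * y + b) = a * (x - y) by ring.
rewrite normrM mulrA; apply: ler_wpM2r => //.
rewrite (mulrC (expR _)) -mulrA; apply: ler_wpM2l => //; rewrite -expRD ler_expR.
have hx : a * x <= `|a| * `|x| by rewrite -normrM ler_norm.
have hy : a * y <= `|a| * `|y| by rewrite -normrM ler_norm.
have px : 0 <= `|a| * `|x| by rewrite mulr_ge0.
have py : 0 <= `|a| * `|y| by rewrite mulr_ge0.
have hb := ler_norm b.
by rewrite mulrDr ge_max; apply/andP; split; lra.
Qed.

Lemma lipexp_shift F h : lipexp gaugeR F -> lipexp gaugeR (fun x => F (x + h)).
Proof.
move=> LF; have := @lipexp_comp _ _ gaugeR F (fun x => x + h) `|h| (normr_ge0 h).
apply => //= [x|x y]; first exact: ler_normD.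
by rewrite opprD addrACA subrr addr0.
Qed.

Lemma gexp_shift_ge0 F h : lipexp gaugeR F -> (forall x, 0 <= F x) ->
  gexp (fun x => F (x + h)) = gexp (fun x => F x * expR (h * x - h ^+ 2 / 2)).
Proof.
move=> LF F0; rewrite /gexp /Rintegral.
have cS := lipexp_continuous (lipexp_shift h LF).
have cM := lipexp_continuous (lipexpM LF (lipexp_expR_affine h (- (h ^+ 2 / 2)))).
have mS := continuous_measurable_fun cS; have mM := continuous_measurable_fun cM.
have p0 x : 0 <= F x * expR (h * x - h ^+ 2 / 2) by rewrite mulr_ge0 // expR_ge0.
rewrite (ge0_integral_normal_prob mM p0) (ge0_integral_normal_prob mS) //.
congr fine.
pose G x := F (x + h) * pdf x.
transitivity (\int[leb]_x (G x)%:E)%E.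
  by apply: eq_integral => x _; rewrite /G EFinM.
rewrite (ge0_integral_translate (- h)) => [|x|x]; first last.
- by rewrite mulr_ge0 // normal_pdf_ge0.
- rewrite /G; apply: (@continuousM _ _ (fun x => F (x + h)) pdf); first exact: cS.
  by apply: continuous_normal_pdf; rewrite oner_eq0.
apply: eq_integral => x _; rewrite -EFinM; congr EFin.
rewrite /G subrK -mulrA; congr (_ * _).
rewrite mulrC -normal_pdf_shift !normal_pdfE ?oner_eq0 //.
by rewrite /normal_fun subr0.
Qed.

(** [K] dominates [F] in absolute value, so [F + K] and [K] are nonnegative. The nonnegative case
    applies to both, and the identity for [K] is subtracted. *)
Lemma gexp_shift F h : lipexp gaugeR F ->
  gexp (fun x => F (x + h)) = gexp (fun x => F x * expR (h * x - h ^+ 2 / 2)).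
Proof.
move=> LF; have [C [k [C0 k0 /= H]]] := lipexp_bound LF.
pose K (x : R) := C * expR (k * `|x|).
have LK : lipexp gaugeR K by apply: lipexpZ; exact: (lipexp_expR gaugeR).
have LE := lipexp_expR_affine h (- (h ^+ 2 / 2)).
have L1 := lipexpD LF LK.
have K0 x : 0 <= K x by rewrite mulr_ge0 // expR_ge0.
have P1 x : 0 <= F x + K x.
  have := H x; rewrite ler_norml -/(K x) => /andP[+ _]; lra.
have e1 := gexp_shift_ge0 h L1 P1.
have e2 := gexp_shift_ge0 h LK K0.
rewrite gexpD in e1; try exact: lipexp_shift.
have E : (fun x => (F x + K x) * expR (h * x - h ^+ 2 / 2)) =
  (fun x => F x * expR (h * x - h ^+ 2 / 2) + K x * expR (h * x - h ^+ 2 / 2)).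
  by apply/funext => x; rewrite mulrDl.
rewrite E gexpD in e1; try exact: lipexpM.
by rewrite e2 in e1; exact: addIr e1.
Qed.

(* Differentiating at [h = 0] the change of variables [x -> x + h] avoids integration by parts
   on an unbounded interval. *)
Lemma gexp_ibp F F' (C k : R) : 0 <= C -> 0 <= k ->
  lipexp gaugeR F -> lipexp gaugeR F' ->
  (forall x h, `|h| <= 1 -> `|F (x + h) - F x - h * F' x| <= C * h ^+ 2 * expR (k * `|x|)) ->
  gexp (fun x => x * F x) = gexp F'.
Proof.
move=> C0 k0 LF LF' T; apply/subr0_eq.
have [B [l [B0 l0 /= HB]]] := lipexp_bound LF.
have Lx : lipexp gaugeR id by apply: (@lipexp_lip _ _ _ _ 1) => // x y; rewrite mul1r.
have Le q : 0 <= q -> lipexp gaugeR (fun x => expR (q * `|x|)).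
  by move=> ?; exact: (lipexp_expR gaugeR).
(* [expR 1] comes from the Taylor remainder of the density factor and 1 from [h ^+ 2 / 2]. The
   exponent [l + 3] is the growth [l] of [F] plus three powers of the exponential of |x|: two from
   [u ^+ 2], one from the exponential of |u|. *)
pose K : R := expR 1 + 1.
pose M1 := gexp (fun x => expR (k * `|x|)).
pose M2 := gexp (fun x => expR ((l + 3) * `|x|)).
apply: (@le_small_eq0 _ _ (C * M1 + B * K * M2)) => h h0 h1.
have e3 : 0 <= l + 3 :> R by lra.
have hn : `|h| <= 1 by rewrite gtr0_norm.
have LxF := lipexpM Lx LF.
(* The translated expectation is differentiated at [h = 0] twice: here through the Taylor hypothesis
   on [F], in [A2] through the density factor. Equality of the two derivatives is the claim. *)
have A1 : `|gexp (fun x => F (x + h)) - gexp F - h * gexp F'| <= C * h ^+ 2 * M1.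
  rewrite -gexpZ // -!gexpB //; try by [exact: lipexp_shift|exact: lipexpZ|
    apply: lipexpB => //; exact: lipexp_shift].
  rewrite -gexpZ; last exact: Le.
  apply: ler_norm_gexp => [||x]; last exact: T.
    apply: lipexpB; last exact: lipexpZ.
    by apply: lipexpB => //; exact: lipexp_shift.
  by apply: lipexpZ; exact: Le.
have A2 : `|gexp (fun x => F (x + h)) - gexp F - h * gexp (fun x => x * F x)|
    <= (B * K) * h ^+ 2 * M2.
  have LE := lipexpM LF (lipexp_expR_affine h (- (h ^+ 2 / 2))).
  rewrite gexp_shift // -gexpZ // -!gexpB //;
    try by [exact: lipexpB|exact: lipexpZ].
  rewrite -gexpZ; last exact: Le.
  apply: ler_norm_gexp => [||x].
  - by apply: lipexpB; [exact: lipexpB|exact: lipexpZ].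
  - by apply: lipexpZ; exact: Le.
  have -> : F x * expR (h * x - h ^+ 2 / 2) - F x - h * (x * F x)
    = F x * (expR (h * x - h ^+ 2 / 2) - 1 - h * x) by ring.
  rewrite normrM (_ : expR ((l + 3) * `|x|) = expR (l * `|x|) * expR (3 * `|x|)); last first.
    by rewrite -expRD mulrDl.
  have -> : B * K * h ^+ 2 * (expR (l * `|x|) * expR (3 * `|x|))
    = (B * expR (l * `|x|)) * (K * h ^+ 2 * expR (3 * `|x|)) by ring.
  apply: ler_pM => //.
  set u := h * x - h ^+ 2 / 2.
  have -> : expR u - 1 - h * x = (expR u - 1 - u) - h ^+ 2 / 2 by rewrite /u; ring.
  apply: (le_trans (ler_normB _ _)).
  have hx : `|u| <= h * (`|x| + 1).
    apply: (le_trans (ler_normB _ _)); rewrite normrM (gtr0_norm h0).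
    rewrite (ger0_norm (_ : 0 <= h ^+ 2 / 2)); last by rewrite divr_ge0 // sqr_ge0.
    nra.
  have x0 := normr_ge0 x.
  have hx1 : `|u| <= `|x| + 1 by apply: (le_trans hx); nra.
  have ex : 1 + `|x| <= expR `|x| := expR_ge1Dx _.
  have eu : u ^+ 2 <= h ^+ 2 * expR `|x| ^+ 2.
    rewrite -exprMn -(real_normK (num_real u)) ler_sqr ?nnegrE //; last first.
      by rewrite mulr_ge0 ?expR_ge0 // ltW.
    by apply: (le_trans hx); rewrite ler_pM2l // addrC.
  have e1 : expR `|u| <= expR 1 * expR `|x| by rewrite -expRD ler_expR addrC.
  have t1 : u ^+ 2 * expR `|u| <= h ^+ 2 * expR `|x| ^+ 2 * (expR 1 * expR `|x|).
    by apply: ler_pM => //; exact: sqr_ge0.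
  have -> : expR (3 * `|x|) = expR `|x| ^+ 3 by rewrite -expRM_natl.
  have t2 : 1 <= expR `|x| ^+ 3 by apply: exprn_ege1; rewrite (le_trans _ ex) // lerDl.
  have t3 := expR_taylor1 u.
  have t4 : `|h ^+ 2 / 2| <= h ^+ 2 * expR `|x| ^+ 3.
    rewrite ger0_norm ?divr_ge0 ?sqr_ge0 //; have := sqr_ge0 h; nra.
  apply: (le_trans (lerD (le_trans t3 t1) t4)); rewrite /K le_eqVlt; apply/orP; left.
  by apply/eqP; ring.
have h2 : `|h * (gexp (fun x => x * F x) - gexp F')| <= h * ((C * M1 + B * K * M2) * h).
  move: A1 A2; set a := gexp (fun x => F (x + h)) - gexp F => A1 A2.
  have -> : h * (gexp (fun x => x * F x) - gexp F') =
    (a - h * gexp F') - (a - h * gexp (fun x => x * F x)) by ring.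
  apply: (le_trans (ler_normB _ _)); apply: (le_trans (lerD A1 A2)).
  by rewrite le_eqVlt; apply/orP; left; apply/eqP; ring.
by move: h2; rewrite normrM (gtr0_norm h0) ler_pM2l.
Qed.

End OneDim.

(** * Iterated Gaussian integration over the disorder *)

Section Iterated.
Variable R : realType.
Implicit Types (g : disorder R) (a b : nat * nat) (L l : seq (nat * nat)).

Definition crd g a : R := g a.1 a.2.
Definition updc g a (x : R) : disorder R := upd g a.1 a.2 x.

Lemma crd_upd g a x b : crd (updc g a x) b = if b == a then x else crd g b.
Proof. by case: a b => [i j] [i' j']; rewrite /crd /updc /upd /= -xpair_eqE. Qed.

Lemma disorder_ext g g' : (forall a, crd g a = crd g' a) -> g = g'.
Proof. by move=> H; apply/funext => i; apply/funext => j; exact: (H (i, j)). Qed.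

Lemma updc_idem g a x y : updc (updc g a x) a y = updc g a y.
Proof. by apply: disorder_ext => b; rewrite !crd_upd; case: eqP. Qed.

Lemma updcC g a b x y : a != b -> updc (updc g a x) b y = updc (updc g b y) a x.
Proof.
move=> ab; apply: disorder_ext => c; rewrite !crd_upd; case: eqP => [->|//].
by case: eqP => // e; rewrite e eqxx in ab.
Qed.

(** An l1 seminorm on the coordinates listed in [L]. Disorders that agree on [L] are at distance
    zero, so [lipexp] for this gauge also encodes that a function reads no other coordinate. *)
Definition gaugeD L : gauge R (disorder R).
Proof.
refine (@Gauge R (disorder R) (fun g => \sum_(a <- L) `|crd g a|)
  (fun g g' => \sum_(a <- L) `|crd g a - crd g' a|) (fun _ _ => 0) _ _ _ _ _ _).
- by move=> g; apply: sumr_ge0 => a _.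
- by move=> g g'; apply: sumr_ge0 => a _.
- by move=> g; apply: ler_sum => a _; rewrite /crd /= subr0.
- by rewrite big1 // => a _; rewrite /crd normr0.
- move=> g g'; rewrite -sumrB; apply: (le_trans (ler_norm_sum _ _ _)).
  by apply: ler_sum => a _; exact: ler_dist_dist.
- move=> g g'; rewrite -big_split; apply: ler_sum => a _; exact: ler_normB.
Defined.

Variable L : seq (nat * nat).
Hypothesis uL : uniq L.
Local Notation lipD := (lipexp (gaugeD L)).
Local Notation sz := (gsize (gaugeD L)).
Local Notation ds := (gdist (gaugeD L)).
Implicit Types F : disorder R -> R.

Lemma crd_le_size g a : a \in L -> `|crd g a| <= sz g.
Proof. by move=> aL; rewrite /= (big_rem a) //= lerDl sumr_ge0. Qed.

Lemma lipD_crd a : a \in L -> lipD (fun g => crd g a).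
Proof.
move=> aL; apply: (@lipexp_lip _ _ _ _ 1) => // g g'; rewrite mul1r /=.
by rewrite (big_rem a) //= lerDl sumr_ge0.
Qed.

Lemma size_updc g a x : sz (updc g a x) <= sz g + `|x|.
Proof.
rewrite /=; case: (boolP (a \in L)) => aL.
  rewrite (big_rem a) // [X in _ <= X + _](big_rem a) //= crd_upd eqxx.
  rewrite (eq_big_seq (fun b => `|crd g b|)); last first.
    move=> b; rewrite mem_rem_uniq // => /andP[/= /negPf ba _].
    by rewrite crd_upd ba.
  by rewrite [leLHS]addrC lerD2r lerDr.
rewrite (eq_big_seq (fun b => `|crd g b|)) ?lerDl // => b bL; rewrite crd_upd.
by case: eqP => // e; rewrite -e bL in aL.
Qed.

Lemma dist_updc g g' a x : ds (updc g a x) (updc g' a x) <= ds g g'.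
Proof.
by apply: ler_sum => b _; rewrite !crd_upd; case: eqP => // _; rewrite subrr normr0.
Qed.

Lemma dist_updc1 g a x y : ds (updc g a x) (updc g a y) <= `|x - y|.
Proof.
rewrite /=; case: (boolP (a \in L)) => aL.
  rewrite (big_rem a) //= !crd_upd eqxx (eq_big_seq (fun=> 0)) ?big1 ?addr0 //.
  move=> b; rewrite mem_rem_uniq // => /andP[/= /negPf ba _].
  by rewrite !crd_upd ba subrr normr0.
rewrite (eq_big_seq (fun=> 0)) ?big1 // => b bL; rewrite !crd_upd.
by case: eqP => [e|_]; [rewrite -e bL in aL|rewrite subrr normr0].
Qed.

Lemma lipD_slice F g a : lipD F -> lipexp (gaugeR R) (fun x => F (updc g a x)).
Proof.
case=> C [k [C0 k0 H]].
exists (C * expR (k * (sz g + sz g))), k; split => //.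
  by rewrite mulr_ge0 // expR_ge0.
move=> x y; apply: (le_trans (H _ _)).
apply: ler_pM; last exact: dist_updc1.
- by rewrite mulr_ge0 // expR_ge0.
- exact: gdist_ge0.
rewrite -mulrA; apply: ler_wpM2l => //; rewrite -expRD ler_expR -mulrDr.
apply: ler_wpM2l => //; rewrite addrACA; apply: lerD; exact: size_updc.
Qed.

(** Both updated disorders carry the same new coordinate, hence the exponential moment at rate
    [2 * k] in the constant; the growth rate [k] is unchanged. *)
Lemma lipD_gexp F a : lipD F -> lipD (fun g => gexp (fun x => F (updc g a x))).
Proof.
move=> LF; have [C [k [C0 k0 H]]] := LF.
pose M := gexp (fun x : R => expR ((2 * k) * `|x|)).
have k20 : 0 <= 2 * k by rewrite mulr_ge0.
have LE : lipexp (gaugeR R) (fun x => expR ((2 * k) * `|x|)) by exact: (lipexp_expR (gaugeR R)).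
have M0 : 0 <= M.
  rewrite -(gexp_cst (0:R)); apply: ler_gexp => //; exact: lipexp_cst.
exists (C * M), k; split => //; first by rewrite mulr_ge0.
move=> g g'; rewrite -gexpB; try exact: lipD_slice.
have -> : C * M * expR (k * (sz g + sz g')) * ds g g' =
  gexp (fun x : R => C * expR (k * (sz g + sz g')) * ds g g' * expR ((2 * k) * `|x|)).
  by rewrite gexpZ //; rewrite /M; ring.
apply: ler_norm_gexp => [||x].
- by apply: lipexpB; exact: lipD_slice.
- exact: lipexpZ.
apply: (le_trans (H _ _)); rewrite -!mulrA; apply: ler_wpM2l => //.
rewrite [leRHS](_ : _ = expR (k * (sz g + sz g') + 2 * k * `|x|) * ds g g'); last first.
  by rewrite expRD -(mulrA 2 k); ring.
apply: ler_pM.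
- exact: expR_ge0.
- exact: gdist_ge0.
- rewrite ler_expR (mulrC 2) -mulrA -mulrDr; apply: ler_wpM2l => //.
  by have := size_updc g a x; have := size_updc g' a x; lra.
- exact: dist_updc.
Qed.

Lemma lipD_Eiter l F : lipD F -> lipD (Eiter l F).
Proof.
elim: l => [|[i j] l IH] LF //=; exact: (@lipD_gexp _ (i, j) (IH LF)).
Qed.

Lemma eq_Eiter l F1 F2 g0 : (forall g, F1 g = F2 g) -> Eiter l F1 g0 = Eiter l F2 g0.
Proof. by move=> H; congr Eiter; apply/funext. Qed.

Lemma EiterZ l c F g0 : lipD F -> Eiter l (fun g => c * F g) g0 = c * Eiter l F g0.
Proof.
move=> LF; elim: l g0 => [|[i j] l IH] g0 //=.
rewrite -gexpZ; last exact: (@lipD_slice _ g0 (i, j) (lipD_Eiter l LF)).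
by congr gexp; apply/funext => x.
Qed.

Lemma EiterD l F1 F2 g0 : lipD F1 -> lipD F2 ->
  Eiter l (fun g => F1 g + F2 g) g0 = Eiter l F1 g0 + Eiter l F2 g0.
Proof.
move=> L1 L2; elim: l g0 => [|[i j] l IH] g0 //=.
rewrite -gexpD; first by congr gexp; apply/funext => x.
  exact: (@lipD_slice _ g0 (i, j) (lipD_Eiter l L1)).
exact: (@lipD_slice _ g0 (i, j) (lipD_Eiter l L2)).
Qed.

Lemma EiterB l F1 F2 g0 : lipD F1 -> lipD F2 ->
  Eiter l (fun g => F1 g - F2 g) g0 = Eiter l F1 g0 - Eiter l F2 g0.
Proof.
move=> L1 L2; rewrite -[in RHS]mulN1r -EiterZ // -EiterD //; last exact: lipexpZ.
by apply: eq_Eiter => g; rewrite mulN1r.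
Qed.

Lemma Eiter_cst l c g0 : Eiter l (fun=> c) g0 = c :> R.
Proof.
elim: l g0 => [|[i j] l IH] g0 //=.
rewrite -[RHS]gexp_cst; congr gexp; apply/funext => x; exact: IH.
Qed.

Lemma Eiter_sum (I : Type) (r : seq I) (P : pred I) l (F : I -> disorder R -> R) g0 :
  (forall i, P i -> lipD (F i)) ->
  Eiter l (fun g => \sum_(i <- r | P i) F i g) g0 = \sum_(i <- r | P i) Eiter l (F i) g0.
Proof.
move=> LF; elim: r => [|i r IH].
  by rewrite big_nil -[RHS](Eiter_cst l 0 g0); apply: eq_Eiter => g; rewrite big_nil.
rewrite big_cons; case: ifP => Pi.
  rewrite -IH -EiterD; [|exact: LF|exact: lipexp_sum].
  by apply: eq_Eiter => g; rewrite big_cons Pi.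
by rewrite -IH; apply: eq_Eiter => g; rewrite big_cons Pi.
Qed.

Lemma ler_Eiter l F1 F2 g0 : lipD F1 -> lipD F2 -> (forall g, F1 g <= F2 g) ->
  Eiter l F1 g0 <= Eiter l F2 g0.
Proof.
move=> L1 L2 H; elim: l g0 => [|[i j] l IH] g0 //=.
apply: ler_gexp => [||x]; last exact: IH.
- exact: (@lipD_slice _ g0 (i, j) (lipD_Eiter l L1)).
- exact: (@lipD_slice _ g0 (i, j) (lipD_Eiter l L2)).
Qed.

Lemma ler_norm_Eiter l F1 F2 g0 : lipD F1 -> lipD F2 -> (forall g, `|F1 g| <= F2 g) ->
  `|Eiter l F1 g0| <= Eiter l F2 g0.
Proof.
move=> L1 L2 H; rewrite ler_norml -mulN1r -EiterZ //; apply/andP; split.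
  apply: ler_Eiter => //; first exact: lipexpZ.
  by move=> g; rewrite mulN1r; have := H g; rewrite ler_norml => /andP[].
by apply: ler_Eiter => // g; exact: le_trans (ler_norm _) (H g).
Qed.

Lemma Eiter_mull l (c : disorder R -> R) F g0 : lipD F ->
  (forall g a x, a \in l -> c (updc g a x) = c g) ->
  Eiter l (fun g => c g * F g) g0 = c g0 * Eiter l F g0.
Proof.
move=> LF; elim: l g0 => [|[i j] l IH] g0 H //=.
rewrite -gexpZ; last exact: (@lipD_slice _ g0 (i, j) (lipD_Eiter l LF)).
congr gexp; apply/funext => x.
rewrite IH; last by move=> g a y al; apply: H; rewrite inE al orbT.
by congr (_ * _); exact: (H g0 (i, j) x (mem_head _ _)).
Qed.

Lemma Eiter_upd l F g0 a x : (forall g y, F (updc g a y) = F g) ->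
  Eiter l F (updc g0 a x) = Eiter l F g0.
Proof.
move=> H; elim: l g0 => [|[i j] l IH] g0 //=.
congr gexp; apply/funext => y.
rewrite -!/(updc _ (i, j) _).
case: (eqVneq a (i, j)) => [->|ne]; first by rewrite updc_idem.
by rewrite updcC // IH.
Qed.

Lemma Eiter_shift l F g0 a h : a \notin l ->
  Eiter l F (updc g0 a (crd g0 a + h)) = Eiter l (fun g => F (updc g a (crd g a + h))) g0.
Proof.
elim: l g0 => [|[i j] l IH] g0 //=; rewrite inE negb_or => /andP[ne al].
congr gexp; apply/funext => y; rewrite -!/(updc _ (i, j) _).
by rewrite updcC // -IH // crd_upd (negPf ne).
Qed.

Lemma lipD_shift F a h : lipD F -> lipD (fun g => F (updc g a (crd g a + h))).
Proof.
move=> LF; apply: (@lipexp_comp _ _ _ F (fun g => updc g a (crd g a + h)) `|h|) => //.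
- move=> g /=; case: (boolP (a \in L)) => aL.
    rewrite (big_rem a) // [X in _ <= X + _](big_rem a) //= crd_upd eqxx.
    rewrite (eq_big_seq (fun b => `|crd g b|)); last first.
      move=> b; rewrite mem_rem_uniq // => /andP[/= /negPf ba _].
      by rewrite crd_upd ba.
    by rewrite [leRHS]addrAC lerD2r ler_normD.
  rewrite (eq_big_seq (fun b => `|crd g b|)) ?lerDl // => b bL; rewrite crd_upd.
  by case: eqP => // e; rewrite -e bL in aL.
- move=> g g'; apply: ler_sum => b _; rewrite !crd_upd; case: eqP => // ->.
  by rewrite opprD addrACA subrr addr0.
Qed.

(** When the coordinate [a] comes up, the inner coordinates are integrated first and the
    one-dimensional formula is applied to the slice. Its Taylor remainder is the inner expectation
    of the exponential weight, which has exponential growth in [a] again. *)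
Lemma Eiter_ibp l a F F' (C k : R) g0 : a \in l -> uniq l -> {subset l <= L} ->
  0 <= C -> 0 <= k -> lipD F -> lipD F' ->
  (forall g h, `|h| <= 1 ->
     `|F (updc g a (crd g a + h)) - F g - h * F' g| <= C * h ^+ 2 * expR (k * sz g)) ->
  Eiter l (fun g => crd g a * F g) g0 = Eiter l F' g0.
Proof.
move=> + + + C0 k0 LF LF' T; elim: l g0 => [|b l IH] g0 //=.
rewrite inE => /orP[/eqP <-|al] /andP[bl ul] sub; last first.
  case: b bl sub => i j bl sub.
  congr gexp; apply/funext => x; apply: IH => // c cl; apply: sub.
  by rewrite inE cl orbT.
case: a bl sub T {IH} => i j bl sub T.
set a := (i, j) in bl sub T *; rewrite -/(Iterated.updc _ a _).
pose P F x := Eiter l F (updc g0 a x).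
have LP Q : lipD Q -> lipexp (gaugeR R) (P Q).
  by move=> LQ; exact: (@lipD_slice _ g0 a (lipD_Eiter l LQ)).
transitivity (gexp (fun x => x * P F x)).
  congr gexp; apply/funext => x; rewrite /P.
  rewrite -/(updc g0 a x) Eiter_mull //; last first.
    move=> g c y bl'; rewrite crd_upd; case: eqP => // e.
    by rewrite e bl' in bl.
  by rewrite crd_upd eqxx.
pose W g := expR (k * sz g).
have LW : lipD W by exact: lipexp_expR.
have [B [q [B0 q0 /= HB]]] := lipexp_bound (LP _ LW).
apply: (@gexp_ibp _ _ _ (C * B) q) => //; [exact: mulr_ge0|exact: LP|exact: LP|].
move=> x h h1.
have -> : P F (x + h) = Eiter l (fun g => F (updc g a (crd g a + h))) (updc g0 a x).
  by rewrite -Eiter_shift // crd_upd eqxx updc_idem.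
rewrite /P -EiterZ // -!EiterB //; try by [exact: lipD_shift|exact: lipexpZ|
  apply: lipexpB => //; exact: lipD_shift].
apply: (@le_trans _ _ (C * h ^+ 2 * P W x)).
  rewrite /P -EiterZ //; apply: ler_norm_Eiter; last by move=> g; exact: T.
  - by apply: lipexpB; [apply: lipexpB => //; exact: lipD_shift|exact: lipexpZ].
  - exact: lipexpZ.
have := HB x; have := ler_norm (P W x) => h2 h3.
have -> : C * B * h ^+ 2 * expR (q * `|x|) = C * h ^+ 2 * (B * expR (q * `|x|)) by ring.
apply: ler_wpM2l; first by rewrite mulr_ge0 // sqr_ge0.
exact: le_trans h2 h3.
Qed.

End Iterated.

(** * Gibbs averages and replicas *)

Section Gibbs.
Variable R : realType.

Definition gav (O : finType) (U f : O -> R) : R :=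
  (\sum_(s : O) f s * expR (U s)) / (\sum_(s : O) expR (U s)).

Section Single.
Variables (O : finType) (o : O).
Implicit Types U V f : O -> R.

Lemma gibbs_mass_gt0 U : 0 < \sum_(s : O) expR (U s).
Proof.
rewrite (bigD1 o) //= ltr_pwDl ?expR_gt0 // sumr_ge0 // => s _; exact: expR_ge0.
Qed.

Lemma eq_gav U f1 f2 : f1 =1 f2 -> gav U f1 = gav U f2.
Proof. by move=> H; rewrite /gav; congr (_ / _); apply: eq_bigr => s _; rewrite H. Qed.

Lemma gavD U f1 f2 : gav U (fun s => f1 s + f2 s) = gav U f1 + gav U f2.
Proof.
by rewrite /gav -mulrDl -big_split; congr (_ / _); apply: eq_bigr => s _; rewrite mulrDl.
Qed.

Lemma gavZ U c f : gav U (fun s => c * f s) = c * gav U f.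
Proof.
by rewrite /gav mulrA mulr_sumr; congr (_ / _); apply: eq_bigr => s _; rewrite mulrA.
Qed.

Lemma gavB U f1 f2 : gav U (fun s => f1 s - f2 s) = gav U f1 - gav U f2.
Proof.
by rewrite -[in RHS]mulN1r -gavZ -gavD; apply: eq_gav => s; rewrite mulN1r.
Qed.

Lemma gav_cst U c : gav U (fun=> c) = c.
Proof. by rewrite /gav -mulr_sumr mulfK // gt_eqF // gibbs_mass_gt0. Qed.

Lemma gav_sum (I : Type) (r : seq I) (P : pred I) U (F : I -> O -> R) :
  gav U (fun s => \sum_(i <- r | P i) F i s) = \sum_(i <- r | P i) gav U (F i).
Proof.
rewrite /gav -mulr_suml; congr (_ / _); rewrite exchange_big; apply: eq_bigr => s _.
by rewrite mulr_suml.
Qed.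

Lemma ler_gav U f1 f2 : (forall s, f1 s <= f2 s) -> gav U f1 <= gav U f2.
Proof.
move=> H; rewrite /gav ler_pM2r ?invr_gt0 ?gibbs_mass_gt0 //.
by apply: ler_sum => s _; rewrite ler_wpM2r // expR_ge0.
Qed.

Lemma ler_norm_gav U f1 f2 : (forall s, `|f1 s| <= f2 s) -> `|gav U f1| <= gav U f2.
Proof.
move=> H; rewrite ler_norml -mulN1r -gavZ; apply/andP; split; apply: ler_gav => s;
  have := H s; rewrite ler_norml => /andP[h1 h2]; last exact: h2.
by rewrite mulN1r.
Qed.

Lemma gav_bound U f M : (forall s, `|f s| <= M) -> `|gav U f| <= M.
Proof. by move=> H; rewrite -(gav_cst U M); exact: ler_norm_gav. Qed.

Lemma gav_tilt U V f : gav (fun s => U s + V s) f =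
  gav U (fun s => f s * expR (V s)) / gav U (fun s => expR (V s)).
Proof.
rewrite /gav invf_div mulrA divfK ?gt_eqF ?gibbs_mass_gt0 //.
by congr (_ / _); apply: eq_bigr => s _; rewrite expRD; ring.
Qed.

Definition gcov U f V := gav U (fun s => f s * V s) - gav U f * gav U V.

(** The first two summands are the errors for increments of size below 1: replacing [V] by
    [expR V - 1], and removing the denominator. The summand 4 covers the trivial bound for larger
    increments. *)
Definition taylor_cst : R := 2 * expR 1 + 2 * (1 + expR 1) ^+ 2 * expR 1 + 4.

Lemma gcov_bound U f V M v : (forall s, `|f s| <= M) -> (forall s, `|V s| <= v) ->
  `|gcov U f V| <= 2 * M * v.
Proof.
move=> Hf HV; have M0 : 0 <= M := le_trans (normr_ge0 _) (Hf o).
apply: (le_trans (ler_normB _ _)).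
have -> : 2 * M * v = M * v + M * v by ring.
apply: lerD.
  by apply: gav_bound => s; rewrite normrM; apply: ler_pM.
by rewrite normrM; apply: ler_pM => //; exact: gav_bound.
Qed.

Lemma gcovB U f V1 V2 : gcov U f (fun s => V1 s - V2 s) = gcov U f V1 - gcov U f V2.
Proof.
rewrite /gcov gavB (eq_gav _ (f2 := fun s => f s * V1 s - f s * V2 s)).
  by rewrite gavB; ring.
by move=> s; rewrite mulrBr.
Qed.

(** The covariance is the derivative of a Gibbs average in the direction of its energy. The bound
    does not involve [U], so it can be integrated over the disorder. *)
Lemma gav_taylor U V f M v : (forall s, `|f s| <= M) -> (forall s, `|V s| <= v) ->
  `|gav (fun s => U s + V s) f - gav U f - gcov U f V| <= taylor_cst * M * v ^+ 2.
Proof.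
move=> Hf HV; have M0 : 0 <= M := le_trans (normr_ge0 _) (Hf o).
have v0 : 0 <= v := le_trans (normr_ge0 _) (HV o).
have E1 : 1 <= expR 1 :> R by rewrite -[leLHS]expR0 ler_expR.
have K1 : 4 <= taylor_cst.
  by rewrite /taylor_cst lerDr addr_ge0 // !mulr_ge0 // ?sqr_ge0 // expR_ge0.
case: (lerP 1 v) => v1.
  apply: (le_trans (ler_normB _ _)).
  apply: (@le_trans _ _ ((M + M) + 2 * M * v)).
    apply: lerD; last exact: gcov_bound.
    by apply: (le_trans (ler_normB _ _)); apply: lerD; exact: gav_bound.
  have h1 : 1 <= v ^+ 2 by rewrite exprn_ege1.
  have h2 : v <= v ^+ 2 by rewrite expr2 ler_peMr.
  have : 4 * (M * v ^+ 2) <= taylor_cst * (M * v ^+ 2).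
    by rewrite ler_wpM2r // mulr_ge0 // sqr_ge0.
  have := ler_wpM2l M0 h1; have := ler_wpM2l M0 h2; lra.
pose e s := expR (V s) - 1.
set c := expR 1 in E1 *; have c0 : 0 < c := lt_le_trans ltr01 E1.
have He s : `|e s - V s| <= c * v ^+ 2.
  apply: (le_trans (expR_taylor1 _)); rewrite mulrC; apply: ler_pM; rewrite ?expR_ge0 ?sqr_ge0 //.
    by rewrite ler_expR (le_trans (HV s)) // ltW.
  by rewrite -(real_normK (num_real (V s))) ler_sqr ?nnegrE.
have He1 s : `|e s| <= (1 + c) * v.
  rewrite -(subrK (V s) (e s)); apply: (le_trans (ler_normD _ _)).
  have := He s; have := HV s; have : v ^+ 2 <= v by rewrite expr2 ler_piMr // ltW.
  by move=> h3 h4 h5; have := ler_wpM2l (ltW c0) h3; lra.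
set b := gav U e.
have bE : gav U (fun s => expR (V s)) = 1 + b.
  rewrite -[X in X + _](gav_cst U 1) -gavD; apply: eq_gav => s; rewrite /e; ring.
have b1 : c^-1 <= 1 + b.
  rewrite -bE -(gav_cst U c^-1); apply: ler_gav => s.
  rewrite -expRN ler_expR; have := HV s; rewrite ler_norml => /andP[+ _]; lra.
have b0 : 0 < 1 + b by apply: lt_le_trans b1; rewrite invr_gt0.
set X := gcov U f e.
have XE : gav (fun s => U s + V s) f - gav U f = X / (1 + b).
  rewrite gav_tilt bE /X /gcov -/b.
  have -> : gav U (fun s => f s * expR (V s)) = gav U f + gav U (fun s => f s * e s).
    rewrite -gavD; apply: eq_gav => s; rewrite /e; ring.
  by field; rewrite gt_eqF.
rewrite XE.
have h1 : `|X - gcov U f V| <= 2 * M * (c * v ^+ 2).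
  by rewrite -gcovB; exact: gcov_bound.
have h2 : `|X| <= 2 * M * ((1 + c) * v) := gcov_bound U Hf He1.
have h3 : `|b| <= (1 + c) * v := gav_bound U He1.
have h4 : `|X / (1 + b) - X| <= 2 * M * ((1 + c) * v) * ((1 + c) * v) * c.
  have -> : X / (1 + b) - X = - (X * b * (1 + b)^-1) by field; rewrite gt_eqF.
  rewrite normrN (normrM (X * b)) (normrM X b).
  apply: ler_pM; [by rewrite mulr_ge0|exact: normr_ge0|by apply: ler_pM|].
  by rewrite gtr0_norm ?invr_gt0 // invf_ple // posrE.
have -> : X / (1 + b) - gcov U f V = (X / (1 + b) - X) + (X - gcov U f V) by ring.
apply: (le_trans (ler_normD _ _)); apply: (le_trans (lerD h4 h1)).
rewrite /taylor_cst -/c.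
have : 0 <= M * v ^+ 2 by rewrite mulr_ge0 // sqr_ge0.
by move=> h5; rewrite -subr_ge0 [X in 0 <= X](_ : _ = 4 * (M * v ^+ 2)); [lra|ring].
Qed.

Lemma gav_lip U V f M v : (forall s, `|f s| <= M) -> (forall s, `|V s| <= v) ->
  `|gav (fun s => U s + V s) f - gav U f| <= (taylor_cst + 2) * M * v.
Proof.
move=> Hf HV; have M0 : 0 <= M := le_trans (normr_ge0 _) (Hf o).
have v0 : 0 <= v := le_trans (normr_ge0 _) (HV o).
have K0 : 0 <= taylor_cst.
  by rewrite /taylor_cst addr_ge0 // addr_ge0 // !mulr_ge0 // ?sqr_ge0 // expR_ge0.
have KM : 0 <= taylor_cst * M by rewrite mulr_ge0.
case: (lerP 1 v) => v1.
  apply: (@le_trans _ _ (M + M)).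
    by apply: (le_trans (ler_normB _ _)); apply: lerD; exact: gav_bound.
  have := ler_wpM2l M0 v1; have := mulr_ge0 KM v0; lra.
have h1 := gav_taylor U Hf HV; have h2 := gcov_bound U Hf HV.
have h3 := ler_normD (gav (fun s => U s + V s) f - gav U f - gcov U f V) (gcov U f V).
rewrite subrK in h3; apply: (le_trans h3); apply: (le_trans (lerD h1 h2)).
have h4 : v ^+ 2 <= v by rewrite expr2 ler_piMr // ltW.
have := ler_wpM2l KM h4; lra.
Qed.

End Single.

(* Heat-bath identity: redrawing a component [c w] of [w] from its own Gibbs
   measure [V] does not change the average. *)
Lemma gav_resample (O X : finType) (o : O) (x0 : X) (U : O -> R) (V : X -> R)
    (phi : O -> X -> O) (c : O -> X) (F : O -> R) :
  (forall w x, phi (phi w x) (c w) = w) -> (forall w x, c (phi w x) = x) ->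
  (forall w x, U (phi w x) + V (c w) = U w + V x) ->
  gav U F = gav U (fun w => gav V (fun x => F (phi w x))).
Proof.
move=> H1 H2 H3; rewrite /gav; congr (_ / _).
pose z := \sum_x expR (V x).
have z0 : z != 0 by rewrite gt_eqF // (gibbs_mass_gt0 x0).
apply: (mulIf z0); rewrite [RHS]mulr_suml mulr_suml.
transitivity (\sum_(wx : O * X) F wx.1 * (expR (U wx.1) * expR (V wx.2))).
  rewrite -(pair_bigA _ (fun w x => F w * (expR (U w) * expR (V x)))) /=.
  by apply: eq_bigr => w _; rewrite mulr_sumr; apply: eq_bigr => x _; rewrite mulrA.
(* Exchanging the component of [w] with an independent copy drawn from [V] is an involution that
   preserves the joint weight. *)
pose h (wx : O * X) := (phi wx.1 wx.2, c wx.1).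
have hK : involutive h by case=> w x; rewrite /h /= H1 H2.
rewrite (reindex_inj (inv_inj hK)) /=.
rewrite -(pair_bigA _ (fun w x => F (phi w x) * (expR (U (phi w x)) * expR (V (c w))))) /=.
apply: eq_bigr => w _; rewrite mulrAC divfK // mulr_suml.
by apply: eq_bigr => x _; rewrite -!expRD H3 expRD; ring.
Qed.

Section Replicas.
Variables (O I : finType) (o : O).
Implicit Types (U V : O -> R) (rho : {ffun I -> O}) (f : {ffun I -> O} -> R) (J : {set I}).

Definition ren U rho : R := \sum_(k : I) U (rho k).
Definition rav U f : R := gav (ren U) f.
Definition updr rho (r : I) (x : O) : {ffun I -> O} :=
  [ffun k => if k == r then x else rho k].
Definition dep J f := forall k, k \notin J -> forall rho x, f (updr rho k x) = f rho.

Let ro : {ffun I -> O} := [ffun=> o].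

Lemma updr_same rho r x : updr rho r x r = x.
Proof. by rewrite ffunE eqxx. Qed.

Lemma updr_other rho r x k : k != r -> updr rho r x k = rho k.
Proof. by move=> /negPf h; rewrite ffunE h. Qed.

Lemma rav_resample U f r :
  rav U f = rav U (fun rho => gav U (fun x => f (updr rho r x))).
Proof.
apply: (gav_resample ro o (c := fun rho => rho r)).
- move=> w x; apply/ffunP => k; rewrite !ffunE; by case: eqP => // ->.
- by move=> w x; rewrite updr_same.
- move=> w x; rewrite /ren (bigD1 r) //= [in RHS](bigD1 r) //= updr_same.
  rewrite (eq_bigr (fun k => U (w k))); last by move=> k kr; rewrite updr_other.
  ring.
Qed.

Lemma rav_mulr U f r V : (forall rho x, f (updr rho r x) = f rho) ->
  rav U (fun rho => f rho * V (rho r)) = rav U f * gav U V.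
Proof.
move=> H; rewrite (rav_resample _ _ r).
rewrite mulrC -gavZ; apply: eq_gav => rho; rewrite mulrC -gavZ; apply: eq_gav => x.
by rewrite H updr_same.
Qed.

Lemma rav_one U r V : rav U (fun rho => V (rho r)) = gav U V.
Proof.
rewrite (rav_resample _ _ r) -[RHS](gav_cst ro (ren U)); apply: eq_gav => rho.
by apply: eq_gav => x; rewrite updr_same.
Qed.

(* [J] supports the observable; the fresh replica [r] produces the subtracted product of averages
   in a covariance with [J]. *)
Definition wgtJ J (r k : I) : R := if k \in J then 1 else if k == r then - #|J|%:R else 0.

Lemma sum_wgtJ J r (F : I -> R) : r \notin J ->
  \sum_k wgtJ J r k * F k = \sum_(k in J) F k - #|J|%:R * F r.
Proof.
move=> rJ; rewrite (bigID (mem J)) /=; congr (_ + _).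
  by apply: eq_bigr => k kJ; rewrite /wgtJ kJ mul1r.
rewrite (bigD1 r) //= big1 ?addr0 => [|k /andP[/negPf kJ /negPf kr]].
  by rewrite /wgtJ (negPf rJ) eqxx mulNr.
by rewrite /wgtJ kJ kr mul0r.
Qed.

(** Each replica outside [J] contributes the product of averages to the first term, and all replicas
    do so to the second. The difference is [- #|J|] times that product, which one fresh replica [r]
    realises. *)
Lemma rcov U f V J r : dep J f -> r \notin J ->
  gcov (ren U) f (ren V) = rav U (fun rho => f rho * \sum_k wgtJ J r k * V (rho k)).
Proof.
move=> fJ rJ; rewrite /gcov.
have -> : gav (ren U) (ren V) = #|I|%:R * gav U V.
  rewrite /ren gav_sum (eq_bigr (fun=> gav U V)); last by move=> k _; exact: rav_one.
  by rewrite sumr_const mulr_natl.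
have -> : gav (ren U) (fun s => f s * ren V s) = \sum_k rav U (fun rho => f rho * V (rho k)).
  by rewrite -gav_sum; apply: eq_gav => rho; rewrite /ren mulr_sumr.
rewrite (bigID (mem J)) /= [X in _ + X - _](_ : _ = (#|I|%:R - #|J|%:R) * (rav U f * gav U V)); last first.
  rewrite (eq_bigr (fun=> rav U f * gav U V)); last first.
    by move=> k kJ; rewrite rav_mulr // => rho x; exact: fJ.
  by rewrite sumr_const -[LHS]mulr_natl -natrB ?max_card //; congr (_%:R * _); rewrite -(cardC (mem J)) addKn.
transitivity (\sum_(k in J) rav U (fun rho => f rho * V (rho k)) - #|J|%:R * rav U (fun rho => f rho * V (rho r))).
  by rewrite (@rav_mulr U f r V) ?/rav; [ring | move=> rho x; exact: fJ].
rewrite -gavZ -gav_sum -gavB; apply: eq_gav => rho.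
by rewrite sum_wgtJ // mulrBr mulr_sumr; congr (_ - _); rewrite mulrCA.
Qed.

Lemma rav_perm U f (h : I -> I) : involutive h ->
  rav U (fun rho => f [ffun k => rho (h k)]) = rav U f.
Proof.
move=> hK; rewrite /rav /gav; congr (_ / _).
pose H rho : {ffun I -> O} := [ffun k => rho (h k)].
have HK : involutive H by move=> rho; apply/ffunP => k; rewrite /H !ffunE hK.
rewrite [RHS](reindex_inj (inv_inj HK)); apply: eq_bigr => rho _; congr (_ * expR _).
rewrite /ren (reindex_inj (inv_inj hK)); apply: eq_bigr => k _; by rewrite ffunE.
Qed.

End Replicas.

Lemma rav_restrict (O I1 I2 : finType) (o : O) (U : O -> R) (f : {ffun I1 -> O} -> R) :
  rav U (fun rho : {ffun I1 + I2 -> O} => f [ffun k => rho (inl k)]) = rav U f.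
Proof.
pose phi (rho : {ffun I1 + I2 -> O}) (x : {ffun I1 -> O}) : {ffun I1 + I2 -> O} :=
  [ffun k => match k with inl i => x i | inr j => rho (inr j) end].
pose c (rho : {ffun I1 + I2 -> O}) : {ffun I1 -> O} := [ffun k => rho (inl k)].
rewrite /rav (@gav_resample _ _ [ffun=> o] [ffun=> o] _ (ren U) phi c).
- rewrite -[RHS](gav_cst [ffun=> o] (ren U : {ffun I1 + I2 -> O} -> R)).
  apply: eq_gav => rho; apply: eq_gav => x; congr f.
  by apply/ffunP => k; rewrite !ffunE.
- by move=> rho x; apply/ffunP => -[i|j]; rewrite !ffunE.
- by move=> rho x; apply/ffunP => i; rewrite !ffunE.
- move=> rho x; rewrite /ren !big_sumType /=.
  under eq_bigr do rewrite ffunE.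
  under [X in _ + X + _]eq_bigr do rewrite ffunE.
  under [X in _ + _ + X]eq_bigr do rewrite ffunE.
  ring.
Qed.

Lemma gibbs_avgE (N S n : nat) beta D hf g (f : {ffun 'I_n -> config N S} -> R) :
  gibbs_avg beta D hf g f = rav (hamil beta D hf g) f.
Proof.
rewrite /gibbs_avg /rav /gav; congr (_ / _).
  by apply: eq_bigr => rho _; rewrite /ren expR_sum.
rewrite /partition -[in LHS](card_ord n) -prodr_const.
rewrite bigA_distr_bigA /=; apply: eq_bigr => rho _.
by rewrite /ren expR_sum.
Qed.

End Gibbs.

(** * Interpolation along the square-root path *)

Section Unit.
Local Open Scope classical_set_scope.
Local Open Scope ring_scope.
Variable R : realType.
Implicit Types (phi G : R -> R) (s t : R).

(** The second-order error natural to the coefficients [sqrt t] and [sqrt (1 - t)]: quadratic in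
    [s - t] at interior points, but only linear uniformly up to the ends. *)
Definition gap2 s t : R := (Num.sqrt s - Num.sqrt t) ^+ 2
  + (Num.sqrt (1 - s) - Num.sqrt (1 - t)) ^+ 2 + (s - t) ^+ 2.

(* Differentiability on the open unit interval with derivative [G], in the quantitative form
   given by square-root interpolation; at the endpoints it only yields continuity. *)
Definition deriv01 phi G := exists K, 0 <= K /\ forall s t, 0 <= s <= 1 -> 0 <= t <= 1 ->
  `|phi s - phi t - (s - t) * G t| <= K * gap2 s t.

Lemma sqrtB2_le s t : 0 <= s -> 0 < t -> (Num.sqrt s - Num.sqrt t) ^+ 2 <= (s - t) ^+ 2 / t.
Proof.
move=> s0 t0; rewrite ler_pdivlMr //.
have hs := sqr_sqrtr s0; have ht := sqr_sqrtr (ltW t0).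
have ps := sqrtr_ge0 s; have pt := sqrtr_ge0 t.
set a := Num.sqrt s in hs ps *; set b := Num.sqrt t in ht pt *.
rewrite -hs -ht; have -> : (a ^+ 2 - b ^+ 2) ^+ 2 = (a - b) ^+ 2 * (a + b) ^+ 2 by ring.
by apply: ler_wpM2l; [exact: sqr_ge0|nra].
Qed.

Lemma sqrtB2_le1 s t : 0 <= s -> 0 <= t -> (Num.sqrt s - Num.sqrt t) ^+ 2 <= `|s - t|.
Proof.
move=> s0 t0; have hs := sqr_sqrtr s0; have ht := sqr_sqrtr t0.
have ps := sqrtr_ge0 s; have pt := sqrtr_ge0 t.
set a := Num.sqrt s in hs ps *; set b := Num.sqrt t in ht pt *.
rewrite -hs -ht subr_sqr normrM (ger0_norm (addr_ge0 ps pt)).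
rewrite -(real_normK (num_real (a - b))) expr2; apply: ler_wpM2l => //.
by rewrite ler_norml; apply/andP; split; lra.
Qed.

Lemma gap2_le s t : 0 <= s <= 1 -> 0 <= t <= 1 -> gap2 s t <= 3 * `|s - t|.
Proof.
move=> /andP[s0 s1] /andP[t0 t1].
have h1 := sqrtB2_le1 s0 t0.
have h2 : (Num.sqrt (1 - s) - Num.sqrt (1 - t)) ^+ 2 <= `|s - t|.
  have -> : `|s - t| = `|(1 - s) - (1 - t)| by rewrite distrC; congr `|_|; ring.
  by apply: sqrtB2_le1; rewrite subr_ge0.
have h3 : (s - t) ^+ 2 <= `|s - t|.
  rewrite -(real_normK (num_real (s - t))) expr2 ler_piMr //.
  by rewrite ler_norml; apply/andP; split; lra.
by rewrite /gap2; lra.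
Qed.

Lemma gap2_le_sqr s t : 0 <= s <= 1 -> 0 < t < 1 ->
  gap2 s t <= (t^-1 + (1 - t)^-1 + 1) * (s - t) ^+ 2.
Proof.
move=> /andP[s0 s1] /andP[t0 t1]; rewrite /gap2 !mulrDl mul1r.
apply: lerD => //; apply: lerD; first by rewrite mulrC; exact: sqrtB2_le.
have -> : (s - t) ^+ 2 = ((1 - s) - (1 - t)) ^+ 2 by ring.
by rewrite mulrC; apply: sqrtB2_le; rewrite ?subr_ge0 ?subr_gt0.
Qed.

Lemma deriv01_is_derive phi G t : deriv01 phi G -> 0 < t < 1 -> is_derive t 1 phi (G t).
Proof.
move=> [K [K0 H]] /[dup] t01 /andP[t0 t1].
suff C : (fun h => h^-1 *: (phi (h *: (1 : R) + t) - phi t)) @ 0^' --> G t.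
  by split; [apply/cvg_ex; exists (G t)|apply: cvg_lim].
pose c := K * (t^-1 + (1 - t)^-1 + 1).
have c0 : 0 <= c.
  by rewrite mulr_ge0 // !addr_ge0 // invr_ge0 ?subr_ge0 ltW.
have key (e h : R) : 0 < e -> h != 0 -> `|h| <= Num.min (Num.min t (1 - t)) (e / (c + 1)) ->
    `|G t - h^-1 * (phi (h + t) - phi t)| <= e.
  move=> e0 h0.
  rewrite !le_min => /andP[/andP[]].
  rewrite ler_norml => /andP[a1 a2]; rewrite ler_norml => /andP[a3 a4] a5.
  have s01 : 0 <= h + t <= 1 by apply/andP; split; lra.
  have t01' : 0 <= t <= 1 by rewrite !ltW.
  have := H _ _ s01 t01'; rewrite addrK => E.
  have {}E : `|phi (h + t) - phi t - h * G t| <= c * h ^+ 2.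
    apply: (le_trans E); rewrite /c -mulrA; apply: ler_wpM2l => //.
    by have := gap2_le_sqr s01 t01; rewrite addrK.
  have -> : G t - h^-1 * (phi (h + t) - phi t) = - (h^-1 * (phi (h + t) - phi t - h * G t)).
    by field.
  rewrite normrN normrM normfV ler_pdivrMl ?normr_gt0 //.
  apply: (le_trans E); rewrite -(real_normK (num_real h)) expr2 mulrCA.
  apply: ler_wpM2l => //.
  apply: (@le_trans _ _ ((c + 1) * `|h|)); first by rewrite ler_wpM2r // lerDl.
  by rewrite mulrC -ler_pdivlMr // ltr_wpDl.
apply/cvgrPdist_le => e e0.
near=> h.
rewrite /= /GRing.scale /= mulr1; apply: key => //.
  by near: h; exact: nbhs_dnbhs_neq.
near: h; apply: dnbhs0_le; rewrite !lt_min t0 subr_gt0 t1 /=.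
by rewrite divr_gt0 // ltr_wpDl.
Unshelve. all: by end_near. Qed.

Lemma deriv01_lip phi G : deriv01 phi G -> (exists M, forall t, 0 <= t <= 1 -> `|G t| <= M) ->
  exists C, 0 <= C /\ forall s t, 0 <= s <= 1 -> 0 <= t <= 1 -> `|phi s - phi t| <= C * `|s - t|.
Proof.
move=> [K [K0 H]] [M HM].
have M0 : 0 <= M by apply: le_trans (HM 0 _) => //; rewrite lexx ler01.
exists (K * 3 + M); split; first by rewrite addr_ge0 // mulr_ge0.
move=> s t hs ht.
have -> : phi s - phi t = (phi s - phi t - (s - t) * G t) + (s - t) * G t by ring.
apply: (le_trans (ler_normD _ _)); rewrite [leRHS]mulrDl; apply: lerD.
  by apply: (le_trans (H s t hs ht)); rewrite -mulrA; apply: ler_wpM2l => //; exact: gap2_le.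
by rewrite normrM mulrC; apply: ler_wpM2r => //; exact: HM.
Qed.

Lemma lip01_continuous phi C : 0 <= C ->
  (forall s t, 0 <= s <= 1 -> 0 <= t <= 1 -> `|phi s - phi t| <= C * `|s - t|) ->
  forall a, 0 <= a -> a < 1 -> {within `[a, 1], continuous phi}.
Proof.
move=> C0 H a a0 a1.
have key x : 0 <= x <= 1 -> forall e, 0 < e -> forall y, 0 <= y <= 1 ->
    `|x - y| < e / (C + 1) -> `|phi x - phi y| <= e.
  move=> hx e e0 y hy hxy; apply: (le_trans (H x y hx hy)).
  apply: (@le_trans _ _ ((C + 1) * `|x - y|)); first by rewrite ler_wpM2r // lerDl.
  by rewrite mulrC -ler_pdivlMr ?ltW // ltr_wpDl.
have C1 e : 0 < e -> 0 < e / (C + 1) by move=> e0; rewrite divr_gt0 // ltr_wpDl.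
apply/continuous_within_itvP => //; split.
- move=> x xa; have := xa; rewrite in_itv /= => /andP[ax x1]; apply/cvgrPdist_le => e e0.
  near=> y; have : y \in `]a, 1[ by near: y; exact: near_in_itvoo.
  rewrite in_itv /= => /andP[ay y1].
  apply: key => //; [by apply/andP; split; lra|by apply/andP; split; lra|].
  near: y; apply: cvgr_dist_lt; last exact: C1.
  exact: cvg_id.
- apply/cvgrPdist_le => e e0; near=> y.
  apply: key => //; first by apply/andP; split; lra.
    apply/andP; split; last by near: y; exact: nbhs_right_ltW.
    by apply: (le_trans a0); near: y; exact: nbhs_right_ge.
  near: y; apply: cvgr_dist_lt; last exact: C1.
  by apply: cvg_at_right_filter; exact: cvg_id.
- apply/cvgrPdist_le => e e0; near=> y.
  apply: key => //; first by apply/andP; split; lra.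
    apply/andP; split; last by near: y; exact: nbhs_left_le.
    by apply: (le_trans a0); near: y; exact: nbhs_left_ge.
  near: y; apply: cvgr_dist_lt; last exact: C1.
  by apply: cvg_at_left_filter; exact: cvg_id.
Unshelve. all: by end_near. Qed.

Lemma deriv01_mvt_at phi G M t : deriv01 phi G -> (forall t, 0 <= t <= 1 -> `|G t| <= M) ->
  0 <= t <= 1 -> `|phi 1 - phi t| <= M.
Proof.
move=> D HM /andP[t0]; have [C [C0 HC]] := deriv01_lip D (ex_intro _ M HM).
have M0 : 0 <= M by apply: le_trans (HM 0 _) => //; rewrite lexx ler01.
rewrite le_eqVlt => /orP[/eqP ->|t1]; first by rewrite subrr normr0.
have dphi x : x \in `]t, 1[ -> is_derive x 1 phi (G x).
  rewrite in_itv /= => /andP[tx x1]; apply: deriv01_is_derive => //.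
  by rewrite x1 (le_lt_trans t0 tx).
have [c + ->] := MVT t1 dphi (lip01_continuous C0 HC t0 t1).
rewrite in_itv => /andP[c0 c1].
have ht : 0 <= 1 - t by rewrite subr_ge0 ltW.
rewrite normrM (ger0_norm ht).
have hG : `|G c| <= M by apply: HM; rewrite (ltW c1) ltW // (le_lt_trans t0 c0).
apply: (le_trans (ler_wpM2r ht hG)).
by rewrite ler_piMr // lerBlDr lerDl.
Qed.

Lemma deriv01_mvt phi G M : deriv01 phi G -> (forall t, 0 <= t <= 1 -> `|G t| <= M) ->
  `|phi 1 - phi 0| <= M.
Proof. by move=> D HM; apply: (deriv01_mvt_at D HM); rewrite lexx ler01. Qed.

(** The mean value bound applied to [phi t - t * G 0]. *)
Lemma deriv01_taylor phi G M : deriv01 phi G ->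
  (forall t, 0 <= t <= 1 -> `|G t - G 0| <= M) -> `|phi 1 - phi 0 - G 0| <= M.
Proof.
move=> [K [K0 H]] HM.
have := @deriv01_mvt (fun t => phi t - t * G 0) (fun t => G t - G 0) M.
rewrite mul0r mul1r subr0 -addrA (addrC (- G 0)) addrA; apply => //.
exists K; split => // s t hs ht; apply: le_trans (H s t hs ht).
by rewrite le_eqVlt; apply/orP; left; apply/eqP; congr `|_|; ring.
Qed.

(** Gronwall backwards in time: [expR (M * t) * phi t] does not decrease, so the whole path is
    controlled by its end [t = 1], where the original system sits. *)
Lemma deriv01_gronwall phi G M t : 0 <= M -> deriv01 phi G ->
  (exists B, forall t, 0 <= t <= 1 -> `|G t| <= B) ->
  (forall t, 0 <= t <= 1 -> `|G t| <= M * phi t) -> (forall t, 0 <= phi t) -> 0 <= t <= 1 ->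
  phi t <= expR M * phi 1.
Proof.
move=> M0 D HB HM p1 /andP[t0]; rewrite le_eqVlt => /orP[/eqP ->|t1].
  by rewrite ler_peMl // -expR0 ler_expR.
have [C [C0 HC]] := deriv01_lip D HB.
have cphi := lip01_continuous C0 HC t0 t1.
pose psi x := expR (M * x) * phi x.
pose dpsi x := expR (M * x) * (M * phi x + G x).
have dp x : x \in `]t, 1[ -> is_derive x 1 psi (dpsi x).
  rewrite in_itv /= => /andP[tx x1].
  have x01 : 0 < x < 1 by rewrite x1 (le_lt_trans t0 tx).
  have d1 := deriv01_is_derive D x01.
  have -> : psi = (fun x => expR (M * x)) * phi by apply/funext.
  apply: is_derive_eq.
  by rewrite /dpsi /GRing.scale /= mulr1; ring.
have cpsi : {within `[t, 1], continuous psi}.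
  move=> x; apply: cvgM; last exact: cphi.
  apply: continuous_subspaceT => y; apply: (continuous_comp (f := fun y => M * y)).
    exact: mulrl_continuous.
  exact: continuous_expR.
have [c + E] := MVT t1 dp cpsi.
rewrite in_itv /= => /andP[tc c1].
have c01 : 0 <= c <= 1 by rewrite (ltW c1) ltW // (le_lt_trans t0 tc).
have dc : 0 <= dpsi c.
  rewrite mulr_ge0 ?expR_ge0 //; have := HM c c01; rewrite ler_norml => /andP[+ _]; lra.
have : psi t <= psi 1.
  by rewrite -subr_ge0 E mulr_ge0 // subr_ge0 ltW.
rewrite /psi mulr1 => h; apply: le_trans h.
by rewrite ler_peMl // -expR0 ler_expR mulr_ge0.
Qed.

End Unit.

Section Interpolation.
Variables (R : realType) (O I : finType) (o : O).
Variables (L : seq (nat * nat)) (uL : uniq L).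
Variables (A : nat * nat -> O -> R) (B0 B1 : O -> R).
Implicit Types (c : nat * nat -> R) (f : {ffun I -> O} -> R) (g : disorder R).
Local Notation lipD := (lipexp (gaugeD R L)).
Local Notation sz := (gsize (gaugeD R L)).
Let ro : {ffun I -> O} := [ffun=> o].

Definition genergy c tau g (s : O) : R :=
  \sum_(a <- L) c a * crd g a * A a s + (B0 s + tau * B1 s).
Definition gPhi c tau f : R := Eiter L (fun g => rav (genergy c tau g) f) (fun _ _ => 0).

Let fnorm f : R := \sum_rho `|f rho|.
Let fnormP f rho : `|f rho| <= fnorm f.
Proof. by rewrite /fnorm (bigD1 rho) //= lerDl sumr_ge0. Qed.
Let fnorm0 f : 0 <= fnorm f. Proof. by rewrite sumr_ge0. Qed.

Let KA : R := \sum_(a <- L) \sum_s `|A a s| + \sum_s `|B1 s|.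
Let KAP a s : a \in L -> `|A a s| <= KA.
Proof.
move=> aL; rewrite /KA (big_rem a) //= (bigD1 s) //= -!addrA lerDl !addr_ge0 // ?sumr_ge0 //.
by move=> b _; rewrite sumr_ge0.
Qed.
Let KBP s : `|B1 s| <= KA.
Proof.
rewrite /KA [X in _ + X](bigD1 s) //= addrCA lerDl !addr_ge0 ?sumr_ge0 //.
by move=> b _; rewrite sumr_ge0.
Qed.
Let KA0 : 0 <= KA.
Proof. exact: le_trans (normr_ge0 _) (KBP o). Qed.

Lemma genergy_diff c c' tau tau' g g' s :
  `|genergy c' tau' g' s - genergy c tau g s| <=
  KA * (\sum_(a <- L) `|c' a * crd g' a - c a * crd g a| + `|tau' - tau|).
Proof.
have -> : genergy c' tau' g' s - genergy c tau g s =
  \sum_(a <- L) (c' a * crd g' a - c a * crd g a) * A a s + (tau' - tau) * B1 s.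
  rewrite /genergy opprD addrACA -sumrB; congr (_ + _); last by ring.
  by apply: eq_bigr => a _; ring.
apply: (le_trans (ler_normD _ _)); rewrite mulrDr; apply: lerD.
  apply: (le_trans (ler_norm_sum _ _ _)); rewrite mulr_sumr big_seq [leRHS]big_seq.
  by apply: ler_sum => a aL; rewrite normrM mulrC ler_wpM2r // KAP.
by rewrite normrM mulrC ler_wpM2r.
Qed.

Lemma ren_diff c c' tau tau' g g' (rho : {ffun I -> O}) :
  `|ren (genergy c' tau' g') rho - ren (genergy c tau g) rho| <=
  #|I|%:R * (KA * (\sum_(a <- L) `|c' a * crd g' a - c a * crd g a| + `|tau' - tau|)).
Proof.
rewrite /ren -sumrB; apply: (le_trans (ler_norm_sum _ _ _)).
rewrite [leRHS]mulr_natl -sumr_const; apply: ler_sum => k _.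
exact: genergy_diff.
Qed.

Lemma rav_genergyE c c' tau tau' g g' f : rav (genergy c' tau' g') f =
  gav (fun rho => ren (genergy c tau g) rho +
    (ren (genergy c' tau' g') rho - ren (genergy c tau g) rho)) f.
Proof. by rewrite /rav; congr gav; apply/funext => rho; rewrite subrKC. Qed.

Lemma lipD_rav c tau f : lipD (fun g => rav (genergy c tau g) f).
Proof.
pose m := \sum_(a <- L) `|c a|.
have m0 : 0 <= m by rewrite sumr_ge0.
pose C := (taylor_cst R + 2) * fnorm f * (#|I|%:R * (KA * m)).
apply: (@lipexp_lip _ _ _ _ C).
  rewrite !mulr_ge0 // addr_ge0 // /taylor_cst.
  by rewrite addr_ge0 // addr_ge0 // !mulr_ge0 // ?sqr_ge0 // expR_ge0.
move=> g' g; rewrite (rav_genergyE c c tau tau g g').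
have -> : C * gdist (gaugeD R L) g' g = (taylor_cst R + 2) * fnorm f *
  ((#|I|%:R * (KA * m)) * gdist (gaugeD R L) g' g) by rewrite /C; ring.
apply: (gav_lip ro) => // rho; apply: (le_trans (ren_diff _ _ _ _ _ _ _)).
rewrite subrr normr0 addr0 -!mulrA; apply: ler_wpM2l => //; apply: ler_wpM2l => //.
rewrite mulr_sumr big_seq [leRHS]big_seq; apply: ler_sum => a aL.
rewrite -mulrBr normrM ler_wpM2r // /m (big_rem a) //= lerDl sumr_ge0 //.
Qed.

Section Twice.
Variables (J : {set I}) (r1 r2 : I) (f : {ffun I -> O} -> R).
Hypotheses (r1J : r1 \notin J) (r2J : r2 \notin r1 |: J) (fJ : dep J f).

(** Two covariances are taken in a row. The first enlarges the support from [J] to [r1 |: J], so the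
    second carries the weights of the larger set and a further fresh replica [r2]. *)
Definition lin1 (V : O -> R) (rho : {ffun I -> O}) : R := \sum_k wgtJ R J r1 k * V (rho k).
Definition lin2 (V : O -> R) (rho : {ffun I -> O}) : R :=
  \sum_k wgtJ R (r1 |: J) r2 k * V (rho k).

Lemma dep_lin1 V : dep (r1 |: J) (fun rho => f rho * lin1 V rho).
Proof.
move=> k; rewrite !inE negb_or => /andP[kr kJ] rho x; rewrite fJ //; congr (_ * _).
apply: eq_bigr => l _; case: (eqVneq l k) => [->|lk]; last by rewrite updr_other.
by rewrite /wgtJ (negPf kJ) (negPf kr) !mul0r.
Qed.

Lemma gPhi_ibp c tau a (V : O -> R) : a \in L ->
  Eiter L (fun g => crd g a * rav (genergy c tau g) (fun rho => f rho * lin1 V rho)) (fun _ _ => 0) =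
  c a * gPhi c tau (fun rho => f rho * lin1 V rho * lin2 (A a) rho).
Proof.
move=> aL; set h := (fun rho => f rho * lin1 V rho).
rewrite /gPhi -(EiterZ uL) //; last exact: lipD_rav.
pose C := taylor_cst R * fnorm h * (`|c a| * (#|I|%:R * KA)) ^+ 2.
apply: (@Eiter_ibp _ L uL L a _ _ C 0) => //.
- rewrite !mulr_ge0 ?sqr_ge0 // /taylor_cst.
  by rewrite addr_ge0 // addr_ge0 // !mulr_ge0 // ?sqr_ge0 // expR_ge0.
- exact: lipD_rav.
- by apply: lipexpZ; exact: lipD_rav.
move=> g x _; rewrite mul0r expR0 mulr1.
pose V' (rho : {ffun I -> O}) : R := x * c a * ren (A a) rho.
have -> : rav (genergy c tau (updc g a (crd g a + x))) h =
  gav (fun rho => ren (genergy c tau g) rho + V' rho) h.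
  rewrite /rav; congr gav; apply/funext => rho; rewrite /V' /ren mulr_sumr -big_split.
  apply: eq_bigr => k _ /=; rewrite /genergy addrAC; congr (_ + _).
  rewrite (big_rem a) // [X in _ = X + _](big_rem a) //= crd_upd eqxx -addrA.
  rewrite [X in _ + X = _](eq_big_seq (fun b => c b * crd g b * A b (rho k))); first by ring.
  by move=> b; rewrite mem_rem_uniq // => /andP[/= /negPf ba _]; rewrite crd_upd ba.
have V'b rho : `|V' rho| <= `|x| * (`|c a| * (#|I|%:R * KA)).
  rewrite /V' !normrM -mulrA; apply: ler_wpM2l => //; apply: ler_wpM2l => //.
  rewrite /ren; apply: (le_trans (ler_norm_sum _ _ _)).
  rewrite [leRHS]mulr_natl -sumr_const; apply: ler_sum => k _.
  exact: KAP.
have := gav_taylor ro (ren (genergy c tau g)) (fnormP h) V'b.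
have -> : taylor_cst R * fnorm h * (`|x| * (`|c a| * (#|I|%:R * KA))) ^+ 2 = C * x ^+ 2.
  by rewrite exprMn real_normK ?num_real // /C; ring.
have -> : gcov (ren (genergy c tau g)) h V' =
    x * (c a * rav (genergy c tau g) (fun rho => f rho * lin1 V rho * lin2 (A a) rho)).
  rewrite -(rcov o _ _ (dep_lin1 V) r2J) mulrA /gcov /V' gavZ.
  rewrite (eq_gav _ (f2 := fun s => x * c a * (h s * ren (A a) s))); last by move=> s; ring.
  by rewrite gavZ /h; ring.
by [].
Qed.

(** Coefficients and [tau] vary freely and one [K] serves them all, so the path, singular at its
    ends, can be inserted afterwards. Integration by parts trades each [crd g a] in the covariance
    for the factor [lin2]. *)
Lemma interpolation_step : exists K, 0 <= K /\ forall c c' tau tau',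
  `|gPhi c' tau' f - gPhi c tau f
    - \sum_(a <- L) (c' a - c a) * (c a * gPhi c tau (fun rho => f rho * lin1 (A a) rho * lin2 (A a) rho))
    - (tau' - tau) * gPhi c tau (fun rho => f rho * lin1 B1 rho)|
  <= K * (\sum_(a <- L) `|c' a - c a| + `|tau' - tau|) ^+ 2.
Proof.
(* The Taylor bound is quadratic in an energy increment that grows like [w * expR (sz g)], hence the
   exponent 2. *)
pose E0 := Eiter L (fun g => expR (2 * sz g)) (fun _ _ => 0).
have LE : lipD (fun g => expR (2 * sz g)) by exact: lipexp_expR.
have E00 : 0 <= E0.
  rewrite -(Eiter_cst L (0 : R) (fun _ _ => 0)); apply: (ler_Eiter uL) => //; exact: lipexp_cst.
have T0 : 0 <= taylor_cst R.
  by rewrite /taylor_cst addr_ge0 // addr_ge0 // !mulr_ge0 // ?sqr_ge0 // expR_ge0.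
exists (taylor_cst R * fnorm f * (#|I|%:R * KA) ^+ 2 * E0); split.
  by rewrite !mulr_ge0 // sqr_ge0.
move=> c c' tau tau'.
set w := \sum_(a <- L) _ + _.
have w0 : 0 <= w by rewrite addr_ge0 // sumr_ge0.
rewrite (eq_big_seq (fun a => (c' a - c a) * Eiter L (fun g => crd g a *
  rav (genergy c tau g) (fun rho => f rho * lin1 (A a) rho)) (fun _ _ => 0))); last first.
  by move=> a aL; rewrite gPhi_ibp.
have LA a V : a \in L -> lipD (fun g => crd g a * rav (genergy c tau g) (fun rho => f rho * lin1 V rho)).
  by move=> aL; apply: lipexpM; [exact: lipD_crd|exact: lipD_rav].
rewrite big_seq (eq_bigr (fun a => Eiter L (fun g => (c' a - c a) * (crd g a *
  rav (genergy c tau g) (fun rho => f rho * lin1 (A a) rho))) (fun _ _ => 0))); last first.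
  by move=> a aL; rewrite (EiterZ uL) //; exact: LA.
have LS : lipD (fun g => \sum_(a <- L | a \in L) (c' a - c a) * (crd g a *
  rav (genergy c tau g) (fun rho => f rho * lin1 (A a) rho))).
  by apply: lipexp_sum => a aL; apply: lipexpZ; exact: LA.
rewrite -(Eiter_sum uL) //; last by move=> a aL; apply: lipexpZ; exact: LA.
rewrite -mulrA; set D := #|I|%:R * KA.
have LB : lipD (fun g => (tau' - tau) * rav (genergy c tau g) (fun rho => f rho * lin1 B1 rho)).
  by apply: lipexpZ; exact: lipD_rav.
have Lf c1 t1 : lipD (fun g => rav (genergy c1 t1 g) f) by exact: lipD_rav.
rewrite /gPhi -(EiterZ uL) //; last exact: lipD_rav.
rewrite -!(EiterB uL) //; try by [exact: lipexpB|apply: lipexpB => //; exact: lipexpB].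
have -> : taylor_cst R * fnorm f * (D ^+ 2 * E0) * w ^+ 2 =
  Eiter L (fun g => taylor_cst R * fnorm f * D ^+ 2 * w ^+ 2 * expR (2 * sz g)) (fun _ _ => 0).
  by rewrite (EiterZ uL) // /E0; ring.
apply: (ler_norm_Eiter uL) => //.
- by apply: lipexpB => //; apply: lipexpB => //; exact: lipexpB.
- exact: lipexpZ.
move=> g.
pose V s := \sum_(a <- L) (c' a - c a) * crd g a * A a s + (tau' - tau) * B1 s.
have hV (rho : {ffun I -> O}) : ren V rho = ren (genergy c' tau' g) rho - ren (genergy c tau g) rho.
  rewrite /ren -sumrB; apply: eq_bigr => k _; rewrite /V /genergy opprD addrACA -sumrB.
  by congr (_ + _); [apply: eq_bigr => a _; ring|ring].
have Vb (rho : {ffun I -> O}) : `|ren V rho| <= D * (w * expR (sz g)).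
  rewrite hV; apply: (le_trans (ren_diff _ _ _ _ _ _ _)); rewrite /D mulrA.
  apply: ler_wpM2l; first by rewrite mulr_ge0.
  have hs := expR_ge1Dx (sz g); have s0 := gsize_ge0 (gaugeD R L) g.
  rewrite /w mulrDl; apply: lerD; last by rewrite ler_peMr //; lra.
  rewrite mulr_suml big_seq [leRHS]big_seq; apply: ler_sum => a aL.
  rewrite -mulrBl normrM; apply: ler_wpM2l => //.
  by apply: (le_trans (crd_le_size g aL)); lra.
have := gav_taylor ro (ren (genergy c tau g)) (fnormP f) Vb.
have -> : gav (fun s => ren (genergy c tau g) s + ren V s) f = rav (genergy c' tau' g) f.
  by rewrite (rav_genergyE c c' tau tau' g g); congr gav; apply/funext => rho; rewrite hV.
have -> : taylor_cst R * fnorm f * (D * (w * expR (sz g))) ^+ 2 =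
    taylor_cst R * fnorm f * D ^+ 2 * w ^+ 2 * expR (2 * sz g).
  by rewrite expRM_natl; ring.
have -> : gcov (ren (genergy c tau g)) f (ren V) =
  \sum_(i <- L | i \in L) (c' i - c i) * (crd g i *
      rav (genergy c tau g) (fun rho => f rho * lin1 (A i) rho)) +
  (tau' - tau) * rav (genergy c tau g) (fun rho => f rho * lin1 B1 rho).
  rewrite (rcov o _ _ fJ r1J) -big_seq.
  rewrite (eq_bigr (fun a => rav (genergy c tau g)
    (fun rho => (c' a - c a) * crd g a * (f rho * lin1 (A a) rho)))); last first.
    by move=> a _; rewrite /rav gavZ mulrA.
  rewrite /rav -gavZ -gav_sum -gavD; apply: eq_gav => rho.
  rewrite /lin1 /V.
  transitivity (f rho * (\sum_(a <- L) (c' a - c a) * crd g a * lin1 (A a) rho + (tau' - tau) * lin1 B1 rho)).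
    congr (_ * _); rewrite /lin1 mulr_sumr.
    under [X in _ = X + _]eq_bigr do rewrite mulr_sumr.
    rewrite exchange_big -big_split; apply: eq_bigr => k _ /=.
    rewrite mulrDr mulr_sumr; congr (_ + _); last by ring.
    by apply: eq_bigr => a _; ring.
  rewrite mulrDr mulr_sumr; congr (_ + _); last by rewrite /lin1; ring.
  by apply: eq_bigr => a _; rewrite /lin1; ring.
by rewrite opprD addrA.
Qed.

End Twice.
End Interpolation.

Section Path.
Variables (R : realType) (O I : finType) (o : O).
Variables (L : seq (nat * nat)) (uL : uniq L).
Variables (A : nat * nat -> O -> R) (B0 B1 : O -> R).
Implicit Types (c : nat * nat -> R) (f : {ffun I -> O} -> R).
Local Notation Phi := (@gPhi R O I L A B0 B1).

Lemma eq_gPhi c tau f1 f2 : f1 =1 f2 -> Phi c tau f1 = Phi c tau f2.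
Proof. by move=> H; apply: eq_Eiter => g; exact: eq_gav. Qed.

Lemma gPhiD c tau f1 f2 : Phi c tau (fun rho => f1 rho + f2 rho) = Phi c tau f1 + Phi c tau f2.
Proof.
rewrite /gPhi -(EiterD uL); try exact: lipD_rav.
by apply: eq_Eiter => g; rewrite /rav gavD.
Qed.

Lemma gPhiZ c tau x f : Phi c tau (fun rho => x * f rho) = x * Phi c tau f.
Proof.
rewrite /gPhi -(EiterZ uL); try exact: lipD_rav.
by apply: eq_Eiter => g; rewrite /rav gavZ.
Qed.

Lemma gPhi_cst c tau x : Phi c tau (fun=> x) = x.
Proof.
rewrite /gPhi -[RHS](Eiter_cst L x (fun _ _ => 0)).
by apply: eq_Eiter => g; rewrite /rav (gav_cst [ffun=> o]).
Qed.

Lemma ler_norm_gPhi c tau f1 f2 : (forall rho, `|f1 rho| <= f2 rho) ->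
  `|Phi c tau f1| <= Phi c tau f2.
Proof.
move=> H; apply: (ler_norm_Eiter uL); try exact: lipD_rav.
by move=> g; exact: (ler_norm_gav [ffun=> o]).
Qed.

Lemma gPhi_sum (T : Type) (s : seq T) (P : pred T) c tau (F : T -> {ffun I -> O} -> R) :
  Phi c tau (fun rho => \sum_(x <- s | P x) F x rho) = \sum_(x <- s | P x) Phi c tau (F x).
Proof.
elim: s => [|x s IH].
  by rewrite big_nil -[RHS](gPhi_cst c tau 0); apply: eq_gPhi => rho; rewrite big_nil.
rewrite big_cons; case: ifP => Px; rewrite -IH.
  by rewrite -gPhiD; apply: eq_gPhi => rho; rewrite big_cons Px.
by apply: eq_gPhi => rho; rewrite big_cons Px.
Qed.

Lemma gPhi_bounded f : exists M, forall c tau, `|Phi c tau f| <= M.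
Proof.
exists (\sum_rho `|f rho|) => c tau; rewrite -[leRHS](gPhi_cst c tau).
by apply: ler_norm_gPhi => rho; rewrite (bigD1 rho) //= lerDl sumr_ge0.
Qed.

(* [Some true] couplings are switched on, [Some false] couplings switched off, along the path. *)
Variable kind : nat * nat -> option bool.
Definition pathc (t : R) (a : nat * nat) : R :=
  match kind a with
  | None => 1
  | Some true => Num.sqrt t
  | Some false => Num.sqrt (1 - t)
  end.
(** The derivative of [pathc ^+ 2]. Only the product of [pathc] with its derivative occurs, and it
    equals [pathg / 2] without a singularity at the ends. *)
Definition pathg (a : nat * nat) : R :=
  match kind a with None => 0 | Some true => 1 | Some false => -1 end.

Variables (J : {set I}) (r1 r2 : I) (f : {ffun I -> O} -> R).
Hypotheses (r1J : r1 \notin J) (r2J : r2 \notin r1 |: J) (fJ : dep J f).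

Definition pathd (rho : {ffun I -> O}) : R := f rho *
  (\sum_(a <- L) pathg a / 2 * (lin1 J r1 (A a) rho * lin2 J r1 r2 (A a) rho) + lin1 J r1 B1 rho).

Lemma path_deriv : deriv01 (fun t => Phi (pathc t) t f) (fun t => Phi (pathc t) t pathd).
Proof.
have [K [K0 HK]] := interpolation_step o uL A B0 B1 r1J r2J fJ.
pose fa a rho := f rho * lin1 J r1 (A a) rho * lin2 J r1 r2 (A a) rho.
have [M HM] : exists M, forall a, a \in L -> forall c tau, `|Phi c tau (fa a)| <= M.
  pose Ms a := xget 0 [set M | forall c tau, `|Phi c tau (fa a)| <= M]%classic.
  have HMs a c tau : `|Phi c tau (fa a)| <= Ms a.
    have [M HM] := gPhi_bounded (fa a).
    by apply: (@xgetPex _ 0 [set M | forall c tau, `|Phi c tau (fa a)| <= M]%classic); exists M.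
  exists (\sum_(a <- L) Ms a) => a aL c tau; apply: (le_trans (HMs a c tau)).
  rewrite (big_rem a) //= lerDl sumr_ge0 // => b _.
  exact: le_trans (normr_ge0 _) (HMs b c tau).
pose n := (size L)%:R : R.
have n0 : 0 <= n := ler0n _ _.
have sumn x : n * x = \sum_(a <- L) x.
  by rewrite big_const_seq count_predT iter_addr_0 /n mulr_natl.
exists (K * (3 * (n + 1) ^+ 2) + n * `|M|); split.
  apply: addr_ge0; apply: mulr_ge0 => //; apply: mulr_ge0 => //; exact: sqr_ge0.
move=> s t /andP[s0 s1] /andP[t0 t1].
have h1s : 0 <= 1 - s by rewrite subr_ge0.
have h1t : 0 <= 1 - t by rewrite subr_ge0.
set d1 := `|Num.sqrt s - Num.sqrt t|; set d2 := `|Num.sqrt (1 - s) - Num.sqrt (1 - t)|.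
set d3 := `|s - t|.
have gE : gap2 s t = d1 ^+ 2 + d2 ^+ 2 + d3 ^+ 2.
  by rewrite /gap2 /d1 /d2 /d3 !real_normK ?num_real.
have p1 : 0 <= d1 := normr_ge0 _; have p2 : 0 <= d2 := normr_ge0 _.
have p3 : 0 <= d3 := normr_ge0 _.
have dc a : `|pathc s a - pathc t a| <= d1 + d2.
  rewrite /pathc; case: (kind a) => [[]|]; rewrite -/d1 -/d2 ?lerDl ?lerDr //.
  by rewrite subrr normr0 addr_ge0.
(* From [(x - y) * y = (x ^ 2 - y ^ 2) / 2 - (x - y) ^ 2 / 2]: the first part is linear in [s - t],
   the second is bounded by [gap2]. *)
have dg a : (pathc s a - pathc t a) * pathc t a =
    (s - t) * (pathg a / 2) - (pathc s a - pathc t a) ^+ 2 / 2.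
  have e1 := sqr_sqrtr s0; have e2 := sqr_sqrtr t0.
  have e3 := sqr_sqrtr h1s; have e4 := sqr_sqrtr h1t.
  rewrite /pathc /pathg; case: (kind a) => [[]|]; last by ring.
  - by rewrite -[X in X - t]e1 -[X in _ - X]e2; field.
  - have -> : s - t = - ((1 - s) - (1 - t)) by ring.
    by rewrite -[X in X - (1 - t)]e3 -[X in _ - X]e4; field.
have -> : Phi (pathc t) t pathd = \sum_(a <- L) pathg a / 2 * Phi (pathc t) t (fa a)
    + Phi (pathc t) t (fun rho => f rho * lin1 J r1 B1 rho).
  rewrite (eq_bigr (fun a => Phi (pathc t) t (fun rho => pathg a / 2 * fa a rho))).
    rewrite -gPhi_sum -gPhiD; apply: eq_gPhi => rho.
    rewrite /pathd mulrDr mulr_sumr; congr (_ + _); apply: eq_bigr => a _.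
    by rewrite /fa; ring.
  by move=> a _; rewrite gPhiZ.
have H := HK (pathc t) (pathc s) t s.
set X := Phi (pathc s) s f - Phi (pathc t) t f in H *.
set Y := Phi (pathc t) t (fun rho => f rho * lin1 J r1 B1 rho) in H *.
set Z := \sum_(a <- L) _ in H.
have ZE : Z = (s - t) * (\sum_(a <- L) pathg a / 2 * Phi (pathc t) t (fa a))
   - \sum_(a <- L) (pathc s a - pathc t a) ^+ 2 / 2 * Phi (pathc t) t (fa a).
  rewrite mulr_sumr -sumrB; apply: eq_bigr => a _.
  by rewrite mulrA dg -/(fa a); ring.
set W := \sum_(a <- L) (pathc s a - pathc t a) ^+ 2 / 2 * _ in ZE.
have -> : X - (s - t) * (\sum_(a <- L) pathg a / 2 * Phi (pathc t) t (fa a) + Y)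
  = (X - Z - (s - t) * Y) - W by rewrite ZE; ring.
apply: (le_trans (ler_normB _ _)); rewrite [leRHS]mulrDl; apply: lerD.
  apply: (le_trans H); rewrite -mulrA; apply: ler_wpM2l => //.
  set Q := \sum_(a <- L) _.
  have Q0 : 0 <= Q by rewrite sumr_ge0.
  have QL : Q <= n * (d1 + d2).
    by rewrite sumn; apply: ler_sum => a _; exact: dc.
  apply: (@le_trans _ _ (((n + 1) * (d1 + d2 + d3)) ^+ 2)).
    rewrite ler_sqr ?nnegrE ?addr_ge0 ?mulr_ge0 ?addr_ge0 //.
    have := mulr_ge0 n0 p3; rewrite -/d3; lra.
  have -> : 3 * (n + 1) ^+ 2 * gap2 s t = (n + 1) ^+ 2 * (3 * gap2 s t) by ring.
  rewrite exprMn; apply: ler_wpM2l; first exact: sqr_ge0.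
  rewrite gE; have := sqr_ge0 (d1 - d2); have := sqr_ge0 (d1 - d3); have := sqr_ge0 (d2 - d3).
  by nra.
apply: (le_trans (ler_norm_sum _ _ _)).
rewrite -mulrA sumn big_seq [leRHS]big_seq.
apply: ler_sum => a aL; rewrite normrM mulrC; apply: ler_pM => //.
  by apply: (le_trans (HM a aL _ _)); exact: ler_norm.
rewrite ger0_norm ?divr_ge0 ?sqr_ge0 // gE.
rewrite /pathc; case: (kind a) => [[]|].
- rewrite -(real_normK (num_real (_ - _))) -/d1; have := sqr_ge0 d1; have := sqr_ge0 d2; have := sqr_ge0 d3; lra.
- rewrite -(real_normK (num_real (_ - _))) -/d2; have := sqr_ge0 d1; have := sqr_ge0 d2; have := sqr_ge0 d3; lra.
- rewrite subrr expr0n /= mul0r; have := sqr_ge0 d1; have := sqr_ge0 d2; have := sqr_ge0 d3; lra.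
Qed.

End Path.

Lemma spin_bound (R : realType) (S : nat) (x : 'I_(S.*2.+1)) : `|spin R x| <= S%:R.
Proof.
rewrite /spin; have : (x <= S + S)%N by rewrite addnn -ltnS ltn_ord.
rewrite -(ler_nat R) natrD => h1; have h2 : 0 <= ((x : nat)%:R : R) by [].
by rewrite ler_norml; apply/andP; split; lra.
Qed.

(** * The cavity path at a site *)

Section Cavity.
Variables (R : realType) (N S : nat) (beta D hf p q : R).
Hypothesis q0 : 0 <= q.
Local Notation O := (config N S).
Local Notation X := 'I_(S.*2.+1).
Let o : O := [ffun=> ord0].

Lemma pairs_uniq : uniq (pairs N).
Proof.
rewrite filter_uniq //; apply: allpairs_uniq; rewrite ?iota_uniq //.
by case=> [a b] [c d] _ _ /= [-> ->].
Qed.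

(* The diagonal coordinate [(0, 0)], absent from [pairs N], carries the external Gaussian field
   that acts on the decoupled spin. *)
Definition coords := (0%N, 0%N) :: pairs N.

Lemma coords_uniq : uniq coords.
Proof. by rewrite /coords /= pairs_uniq mem_filter ltnn. Qed.

Lemma sum_pairs (F : nat * nat -> R) :
  \sum_(a <- pairs N) F a = \sum_(x < N) \sum_(y < N | (x < y)%N) F (val x, val y).
Proof.
rewrite /pairs big_filter big_mkcond big_allpairs_dep /=.
rewrite -{1}(subn0 N) -/(index_iota 0 N) big_mkord; apply: eq_bigr => x _.
rewrite -{1}(subn0 N) -/(index_iota 0 N) big_mkord.
by rewrite [RHS]big_mkcond.
Qed.

Lemma mem_pairs a : a \in pairs N -> [/\ (a.1 < N)%N, (a.2 < N)%N & (a.1 < a.2)%N].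
Proof.
rewrite mem_filter => /andP[a12] /allpairsP[[x y] /= [hx hy e]]; subst a.
by move: hx hy; rewrite !mem_iota !add0n => /andP[_ hx] /andP[_ hy].
Qed.

(** Couplings are indexed by naturals and spins by ordinals; the default 0 is never reached on
    [pairs N]. *)
Definition sv (s : O) (x : nat) : R := oapp (fun j : 'I_N => spin R (s j)) 0 (insub x).

Lemma svE (s : O) (j : 'I_N) : sv s j = spin R (s j).
Proof. by rewrite /sv valK. Qed.

Variables (I : finType) (i : 'I_N).
Implicit Types (rho : {ffun I -> O}) (f : {ffun I -> O} -> R).

Definition cavA (a : nat * nat) (s : O) : R :=
  if a == (0%N, 0%N) then beta * Num.sqrt q * spin R (s i)
  else beta / Num.sqrt N%:R * (sv s a.1 * sv s a.2).
(** The last term is the quadratic correction in [w_eta], fully present at [t = 0]. [cavB1] removes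
    it linearly in [t], so that [t = 1] gives back [hamil]. *)
Definition cavB0 (s : O) : R :=
  D * (\sum_(j < N) spin R (s j) ^+ 2) + hf * (\sum_(j < N) spin R (s j))
  + beta ^+ 2 / 2 * (p - q) * spin R (s i) ^+ 2.
Definition cavB1 (s : O) : R := - (beta ^+ 2 / 2 * (p - q) * spin R (s i) ^+ 2).
Definition cavkind (a : nat * nat) : option bool :=
  if a == (0%N, 0%N) then Some false
  else if (a.1 == i) || (a.2 == i) then Some true else None.

Definition nut (t : R) f : R :=
  gPhi coords cavA cavB0 cavB1 (pathc cavkind t) t f.
Definition nuI f : R := Edis N (fun g => rav (hamil beta D hf g) f).

Lemma nut_1 f : nut 1 f = nuI f.
Proof.
rewrite /nut /gPhi /coords /nuI /Edis /=.
set F := (fun g : disorder R => rav (genergy _ _ _ _ _ _ g) f).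
have FE g : F g = rav (hamil beta D hf g) f.
  rewrite /F; congr rav; apply/funext => s.
  rewrite /genergy /hamil big_cons {1}/pathc /cavkind eqxx subrr sqrtr0 !mul0r add0r.
  rewrite mul1r /cavB0 /cavB1 -!addrA; congr (_ + _); last by ring.
  rewrite sum_pairs mulr_sumr; apply: eq_bigr => x _; rewrite mulr_sumr; apply: eq_bigr => y xy.
  rewrite /pathc /cavkind /cavA /crd /= !svE.
  have -> : ((val x, val y) == (0%N, 0%N)) = false.
    apply/negP => /eqP[e1 e2]; move: xy; rewrite e1 e2 ltnn //.
  by case: ifP => _; rewrite ?sqrtr1; ring.
rewrite -[RHS]gexp_cst; congr gexp; apply/funext => x.
rewrite (@eq_Eiter _ _ _ (fun g => rav (hamil beta D hf g) f)) //.
apply: (@Eiter_upd _ _ _ _ (0%N, 0%N)) => g y; congr rav; apply/funext => s.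
rewrite /hamil; congr (_ * _ + _ + _); apply: eq_bigr => a _; apply: eq_bigr => b ab.
congr (_ * _ * _); rewrite /updc /upd /=; case: ifP => // /andP[/eqP e1 /eqP e2].
by rewrite e1 e2 in ab.
Qed.

(** The site is left out but the normalisation stays [N], so that the full overlap differs from this
    one by exactly one site term over [N]. *)
Definition Rm rho (k l : I) : R :=
  N%:R^-1 * \sum_(j < N | j != i) spin R (rho k j) * spin R (rho l j).
Definition Qm (k l : I) : R := if k == l then p else q.
Definition Um rho k l : R := Rm rho k l - Qm k l.
(** The kernel of the [t]-derivative: the two covariances bring the weights, and the covariance of
    the energy along the path brings the spins at the site times a centred overlap. *)
Definition cavker (J : {set I}) (r1 r2 : I) rho : R :=
  beta ^+ 2 / 2 * \sum_k \sum_l wgtJ R J r1 k * wgtJ R (r1 |: J) r2 l *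
    (spin R (rho k i) * spin R (rho l i) * Um rho k l).

Lemma pathg_pair (x y : 'I_N) : (x < y)%N ->
  pathg R cavkind (val x, val y) = (x == i)%:R + (y == i)%:R.
Proof.
move=> xy; rewrite /pathg /cavkind.
have -> : ((val x, val y) == (0%N, 0%N)) = false.
  by apply/negP => /eqP[e1 e2]; move: xy; rewrite e1 e2 ltnn.
rewrite /= !(inj_eq val_inj).
case: (eqVneq x i) => [e|ne]; case: (eqVneq y i) => [e'|ne'] /=; rewrite ?add0r ?addr0 //.
by rewrite e e' ltnn in xy.
Qed.

Lemma sum_row (G : 'I_N -> R) :
  \sum_(x < N) \sum_(y < N | (x < y)%N) ((x == i)%:R + (y == i)%:R) * (G x * G y)
  = G i * \sum_(j < N | j != i) G j.
Proof.
transitivity (\sum_(x < N) \sum_(y < N) (((x < y)%N && (x == i))%:R * (G i * G y)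
    + ((x < y)%N && (y == i))%:R * (G i * G x))).
  apply: eq_bigr => x _; rewrite big_mkcond; apply: eq_bigr => y _.
  case: ifP => xy; last by rewrite /= !mul0r addr0.
  rewrite /= mulrDl; congr (_ + _).
    by case: eqP => [->|_]; rewrite ?mul0r.
  by case: eqP => [->|_]; rewrite ?mul0r // mul1r mul1r mulrC.
under eq_bigr do rewrite big_split.
rewrite big_split /= [X in _ + X]exchange_big /= -big_split /=.
rewrite (bigD1 i) //= [X in _ + X]big1 ?addr0; last first.
  move=> x xi; rewrite !big1 ?addr0 // => y _; by rewrite (negPf xi) andbF mul0r.
rewrite -big_split mulr_sumr [RHS]big_mkcond; apply: eq_bigr => y _ /=.
rewrite eqxx !andbT -mulrDl.
by case: (ltngtP i y) => h; rewrite ?add0r ?addr0 ?mul0r ?mul1r -(inj_eq val_inj) /=;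
  rewrite ?(gtn_eqF h) ?(ltn_eqF h) ?h ?eqxx.
Qed.

(** This is the [t]-derivative of the energy covariance of two configurations: the growing couplings
    of site [i] produce the overlap without the site, and the fading field subtracts [q]. *)
Lemma cav_cov (s s' : O) : \sum_(a <- coords) pathg R cavkind a * (cavA a s * cavA a s') =
  beta ^+ 2 * (spin R (s i) * spin R (s' i)) *
  (N%:R^-1 * (\sum_(j < N | j != i) spin R (s j) * spin R (s' j)) - q).
Proof.
rewrite /coords big_cons [X in X * _]/pathg /cavkind eqxx sum_pairs.
rewrite (eq_bigr (fun x : 'I_N => beta ^+ 2 * N%:R^-1 *
  \sum_(y < N | (x < y)%N) ((x == i)%:R + (y == i)%:R) *
    ((spin R (s x) * spin R (s' x)) * (spin R (s y) * spin R (s' y))))); last first.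
  move=> x _; rewrite mulr_sumr; apply: eq_bigr => y xy.
  rewrite pathg_pair // /cavA.
  have -> : ((val x, val y) == (0%N, 0%N)) = false.
    by apply/negP => /eqP[e1 e2]; move: xy; rewrite e1 e2 ltnn.
  rewrite /= !svE.
  have <- : (Num.sqrt N%:R)^-1 * (Num.sqrt N%:R)^-1 = N%:R^-1 :> R.
    by rewrite -invfM -expr2 sqr_sqrtr.
  ring.
rewrite -mulr_sumr (sum_row (fun x => spin R (s x) * spin R (s' x))) /cavA eqxx.
have e3 := sqr_sqrtr q0.
rewrite -[in RHS]e3; ring.
Qed.

Lemma nut_deriv (J : {set I}) r1 r2 f : r1 \notin J -> r2 \notin r1 |: J -> dep J f ->
  deriv01 (fun t => nut t f) (fun t => nut t (fun rho => f rho * cavker J r1 r2 rho)).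
Proof.
move=> r1J r2J fJ.
have := path_deriv o coords_uniq cavA cavB0 cavB1 cavkind r1J r2J fJ.
congr deriv01; apply/funext => t; apply: eq_gPhi => rho; rewrite /pathd; congr (_ * _).
rewrite /cavker /lin1 /lin2.
pose w k := wgtJ R J r1 k; pose w' k := wgtJ R (r1 |: J) r2 k.
(* [w'] equals 1 wherever [w] is nonzero, so on the diagonal the product of the weights collapses to
   [w]. *)
have ww k : w k * w' k = w k.
  rewrite /w /w' /wgtJ !inE; case: (boolP (k \in J)) => kJ; first by rewrite orbT mulr1.
  by case: eqP => _; rewrite ?mulr1 ?mul0r.
transitivity (\sum_k \sum_l w k * w' l * (\sum_(a <- coords) pathg R cavkind a / 2 *
    (cavA a (rho k) * cavA a (rho l))) + \sum_k w k * cavB1 (rho k)).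
  congr (_ + _).
  under [RHS]eq_bigr do under eq_bigr do rewrite mulr_sumr.
  under [RHS]eq_bigr do rewrite exchange_big.
  rewrite [RHS]exchange_big; apply: eq_bigr => a _ /=.
  rewrite mulr_suml mulr_sumr; apply: eq_bigr => k _.
  rewrite !mulr_sumr; apply: eq_bigr => l _; rewrite /w /w'; ring.
rewrite -big_split mulr_sumr; apply: eq_bigr => k _ /=.
(* The Gaussian part centres every overlap at [q]; on the diagonal the contribution of [cavB1]
   shifts the centre to [p]. *)
rewrite mulr_sumr (bigD1 k) //= [in RHS](bigD1 k) //= addrAC; congr (_ + _).
  rewrite -/(w k) -/(w' k) !ww.
  rewrite (eq_bigr (fun a => 2^-1 * (pathg R cavkind a * (cavA a (rho k) * cavA a (rho k))))); last first.
    by move=> a _; ring.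
  rewrite -mulr_sumr cav_cov /Um /Rm /Qm eqxx /cavB1; ring.
apply: eq_bigr => l lk.
rewrite (eq_bigr (fun a => 2^-1 * (pathg R cavkind a * (cavA a (rho k) * cavA a (rho l))))); last first.
  by move=> a _; ring.
rewrite -mulr_sumr cav_cov /Um /Rm /Qm eq_sym (negPf lk) /w /w'; ring.
Qed.

Definition upds (s : O) (x : X) : O := [ffun j => if j == i then x else s j].
Definition updsr rho (x : {ffun I -> X}) : {ffun I -> O} := [ffun k => upds (rho k) (x k)].
Definition site rho : {ffun I -> X} := [ffun k => rho k i].
Definition siteV (eta : R) (x : X) : R := beta * Num.sqrt q * eta * spin R x + hf * spin R x
  + (D + beta ^+ 2 / 2 * (p - q)) * spin R x ^+ 2.
Definition U0 (g : disorder R) : O -> R :=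
  genergy coords cavA cavB0 cavB1 (pathc cavkind 0) 0 g.

(** At [t = 0] the couplings of site [i] carry the coefficient [sqrt 0], so changing the spin there
    changes only [siteV]. This is the energy balance required by [gav_resample]. *)
Lemma U0_upds g s x : U0 g (upds s x) + siteV (g 0%N 0%N) (s i) = U0 g s + siteV (g 0%N 0%N) x.
Proof.
have ui : upds s x i = x by rewrite ffunE eqxx.
have uj j : j != i -> upds s x j = s j by move=> /negPf h; rewrite ffunE h.
rewrite /U0 /genergy /coords !big_cons.
have -> : \sum_(a <- pairs N) pathc cavkind 0 a * crd g a * cavA a (upds s x) =
    \sum_(a <- pairs N) pathc cavkind 0 a * crd g a * cavA a s.
  rewrite !sum_pairs; apply: eq_bigr => k _; apply: eq_bigr => l kl.
  rewrite /pathc /cavkind /cavA.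
  have -> : ((val k, val l) == (0%N, 0%N)) = false.
    by apply/negP => /eqP[e1 e2]; move: kl; rewrite e1 e2 ltnn.
  rewrite /= !(inj_eq val_inj) !svE.
  case: (boolP ((k == i) || (l == i))) => h; first by rewrite sqrtr0 !mul0r.
  by move: h; rewrite negb_or => /andP[h1 h2]; rewrite !uj.
have sumE (F : R -> R) : \sum_(j < N) F (spin R (upds s x j)) =
    \sum_(j < N) F (spin R (s j)) - F (spin R (s i)) + F (spin R x).
  rewrite (bigD1 i) //= [in RHS](bigD1 i) //= ui.
  rewrite (eq_bigr (fun j => F (spin R (s j)))); last by move=> j /uj ->.
  ring.
rewrite /cavB0 /cavB1 /pathc /cavkind /cavA eqxx /= subr0 sqrtr1 ui.
rewrite (sumE (fun y => y ^+ 2)) (sumE id) /siteV /crd /=; ring.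
Qed.

Lemma updsr_site rho x : site (updsr rho x) = x.
Proof. by apply/ffunP => k; rewrite !ffunE eqxx. Qed.

Lemma rav_U0 g fm (phi : {ffun I -> X} -> R) :
  (forall rho x, fm (updsr rho x) = fm rho) ->
  rav (U0 g) (fun rho => fm rho * phi (site rho)) =
  rav (U0 g) fm * rav (siteV (g 0%N 0%N)) phi.
Proof.
move=> H.
rewrite /rav (@gav_resample _ _ _ [ffun=> o] [ffun=> ord0] _
  (ren (siteV (g 0%N 0%N))) updsr site).
- rewrite mulrC -gavZ; apply: eq_gav => rho.
  rewrite mulrC -gavZ; apply: eq_gav => x; by rewrite H updsr_site.
- by move=> rho x; apply/ffunP => k; apply/ffunP => j; rewrite !ffunE; case: eqP => // ->.
- by move=> rho x; apply/ffunP => k; rewrite !ffunE eqxx.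
- move=> rho x; rewrite /ren -!big_split; apply: eq_bigr => k _.
  by rewrite !ffunE; exact: U0_upds.
Qed.

Lemma U0_eta g x : U0 (updc g (0%N, 0%N) x) =
  fun s => U0 g s + beta * Num.sqrt q * (x - g 0%N 0%N) * spin R (s i).
Proof.
apply/funext => s; rewrite /U0 /genergy /coords !big_cons.
rewrite (eq_big_seq (fun a => pathc cavkind 0 a * crd g a * cavA a s)).
  rewrite crd_upd eqxx /pathc /cavkind /cavA eqxx /= subr0 sqrtr1 /crd /=; ring.
move=> a /mem_pairs[h1 h2 h3]; rewrite crd_upd; case: eqP => // e.
by rewrite e ltnn in h3.
Qed.

(** The field multiplies only the decoupled spin, so the tilt it causes factorises and cancels for
    an observable that does not read the site. *)
Lemma rav_U0_eta g fm x : (forall rho y, fm (updsr rho y) = fm rho) ->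
  rav (U0 (updc g (0%N, 0%N) x)) fm = rav (U0 g) fm.
Proof.
move=> H; rewrite U0_eta /rav.
set c := beta * Num.sqrt q * (x - g 0%N 0%N).
pose phi (y : {ffun I -> X}) : R := expR (\sum_k c * spin R (y k)).
have -> : ren (fun s : O => U0 g s + c * spin R (s i)) =
    (fun rho => ren (U0 g) rho + \sum_k c * spin R (site rho k)).
  apply/funext => rho; rewrite /ren -big_split; apply: eq_bigr => k _; by rewrite ffunE.
rewrite (gav_tilt [ffun=> o]).
have e1 := @rav_U0 g fm phi H.
have e2 := @rav_U0 g (fun=> 1) phi (fun _ _ => erefl _).
rewrite /rav in e1 e2; rewrite e1.
rewrite (gav_cst [ffun=> o]) mul1r in e2.
have -> : gav (ren (U0 g)) (fun rho => expR (\sum_k c * spin R (site rho k))) =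
    gav (ren (siteV (g 0%N 0%N))) phi.
  by rewrite -e2; apply: eq_gav => rho; rewrite mul1r.
rewrite mulfK // gt_eqF //.
apply: lt_le_trans (_ : 0 < expR (- (\sum_(k : I) `|c| * S%:R))) _; first exact: expR_gt0.
rewrite -[leLHS](gav_cst [ffun=> (ord0 : X)] (ren (siteV (g 0%N 0%N)) : {ffun I -> X} -> R)).
apply: (ler_gav [ffun=> (ord0 : X)]) => y; rewrite /phi ler_expR.
rewrite -sumrN; apply: ler_sum => k _.
have : `|c * spin R (y k)| <= `|c| * S%:R.
  by rewrite normrM; apply: ler_wpM2l => //; exact: spin_bound.
by rewrite ler_norml => /andP[].
Qed.

(** All replicas at the site share the field [eta] and are independent only given it, hence the
    expectation over [eta] is outermost. *)
Definition Es (phi : {ffun I -> X} -> R) : R := gexp (fun eta => rav (siteV eta) phi).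

Lemma lipexp_siteV (phi : {ffun I -> X} -> R) :
  lipexp (gaugeR R) (fun eta => rav (siteV eta) phi).
Proof.
pose A' (a : nat * nat) (x : X) := spin R x.
pose B' (x : X) := hf * spin R x + (D + beta ^+ 2 / 2 * (p - q)) * spin R x ^+ 2.
have u1 : uniq [:: (0%N, 0%N)] by [].
have LF := lipD_rav ord0 [:: (0%N, 0%N)] A' B' B' (fun=> beta * Num.sqrt q) 0 phi.
have := @lipD_slice _ _ u1 _ (fun _ _ => 0) (0%N, 0%N) LF.
congr lipexp; apply/funext => eta; congr rav; apply/funext => x.
rewrite /genergy big_cons big_nil crd_upd eqxx /A' /B' /siteV; ring.
Qed.

(** Given the disorder, site and cavity factorise; the cavity average does not see the field, so the
    expectations factorise too. The constant observable 1 identifies [K] as the cavity average. *)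
Lemma nut_0 fm (phi : {ffun I -> X} -> R) :
  (forall rho x, fm (updsr rho x) = fm rho) ->
  nut 0 (fun rho => fm rho * phi (site rho)) = nut 0 fm * Es phi.
Proof.
move=> H.
pose K := Eiter (pairs N) (fun g => rav (U0 g) fm) (fun _ _ => 0).
have key psi : nut 0 (fun rho => fm rho * psi (site rho)) = K * Es psi.
  rewrite /nut /gPhi -/U0 /coords /= /Es -(gexpZ _ (lipexp_siteV psi)).
  congr gexp; apply/funext => x.
  rewrite -/(updc _ (0%N, 0%N) x).
  rewrite (@eq_Eiter _ _ _ (fun g => rav (siteV (g 0%N 0%N)) psi * rav (U0 g) fm)); last first.
    by move=> g; rewrite -/U0 -/(U0 g) rav_U0 // mulrC.
  rewrite (@Eiter_mull _ _ coords_uniq _ (fun g => rav (siteV (g 0%N 0%N)) psi)); first last.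
  - move=> g a y /mem_pairs[h1 h2 h3]; congr (rav (siteV _) _).
    have := crd_upd g a y (0%N, 0%N); rewrite /crd /= => ->; case: eqP => // e.
    by rewrite -e in h3.
  - exact: lipD_rav.
  rewrite mulrC; congr (_ * _).
  by rewrite Eiter_upd // => g y; exact: rav_U0_eta.
rewrite key; congr (_ * _).
have := key (fun=> 1); rewrite /Es.
have -> : (fun eta : R => rav (siteV eta) (fun _ : {ffun I -> X} => 1 : R)) = (fun=> 1 : R).
  by apply/funext => eta; rewrite /rav (gav_cst [ffun=> ord0]).
rewrite gexp_cst mulr1 => <-; apply: eq_gPhi => rho; by rewrite mulr1.
Qed.

End Cavity.

(** * Inequalities between powers *)

Section Powers.
Variable R : realType.
Implicit Types x y a b : R.

Lemma young_pow x y (m : nat) : 0 <= x -> 0 <= y -> x * y ^+ m <= x ^+ m.+1 + y ^+ m.+1.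
Proof.
move=> x0 y0; case/orP: (le_total x y) => xy.
  apply: (@le_trans _ _ (y ^+ m.+1)); last by rewrite lerDr exprn_ge0.
  by rewrite exprS ler_wpM2r // exprn_ge0.
apply: (@le_trans _ _ (x ^+ m.+1)); last by rewrite lerDl exprn_ge0.
by rewrite exprS ler_wpM2l // lerXn2r.
Qed.

(** The coefficient of the main term does not depend on [m]. If [m * |y| <= |x|], then
    [(1 + 1 / m) ^ m] is at most [expR 1]; otherwise [|x| + |y|] is at most [(m + 1) * |y|]. *)
Lemma pow_add_expR x y (m : nat) :
  `|x + y| ^+ m <= expR 1 * `|x| ^+ m + (m.+1%:R * `|y|) ^+ m.
Proof.
have n1 : `|x + y| ^+ m <= (`|x| + `|y|) ^+ m by rewrite lerXn2r ?nnegrE ?addr_ge0 // ler_normD.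
apply: (le_trans n1).
have x0 := normr_ge0 x; have y0 := normr_ge0 y.
move: (`|x|) (`|y|) x0 y0 => {x n1} a {y} b a0 b0.
have e0 : 0 <= expR 1 * a ^+ m by rewrite mulr_ge0 ?expR_ge0 ?exprn_ge0.
have b1 : 0 <= (m.+1%:R * b) ^+ m by rewrite exprn_ge0 // mulr_ge0.
case: m e0 b1 => [|m] e0 b1.
  by rewrite !expr0 mulr1; rewrite lerDr expR_ge0.
case/orP: (le_total (m.+1%:R * b) a) => h.
  apply: (@le_trans _ _ (expR 1 * a ^+ m.+1)); last by rewrite lerDl.
  have hb : a + b <= a * (1 + m.+1%:R^-1).
    by rewrite mulrDr mulr1 lerD2l ler_pdivlMr ?ltr0n // mulrC.
  apply: (@le_trans _ _ ((a * (1 + m.+1%:R^-1)) ^+ m.+1)).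
    by rewrite lerXn2r ?nnegrE ?addr_ge0 // mulr_ge0 // addr_ge0.
  rewrite exprMn mulrC ler_wpM2r ?exprn_ge0 //.
  apply: (@le_trans _ _ (expR (m.+1%:R^-1) ^+ m.+1)).
    by rewrite lerXn2r ?nnegrE ?expR_ge0 ?addr_ge0 // expR_ge1Dx.
  by rewrite -expRM_natl divff // pnatr_eq0.
apply: (@le_trans _ _ ((m.+2%:R * b) ^+ m.+1)); last by rewrite lerDr.
rewrite lerXn2r ?nnegrE ?addr_ge0 ?mulr_ge0 //.
by rewrite -natr1 mulrDl mul1r lerD2r.
Qed.

Lemma pow_diff x y (m : nat) :
  `|x ^+ m.+1 - y ^+ m.+1| <= m.+1%:R * `|x - y| * (`|x| + `|x - y|) ^+ m.
Proof.
rewrite subrXX normrM mulrC mulrAC; apply: ler_wpM2r => //.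
apply: (le_trans (ler_norm_sum _ _ _)).
have hy : `|y| <= `|x| + `|x - y|.
  by rewrite -{1}(subKr x y); apply: ler_normB.
have hx : `|x| <= `|x| + `|x - y| by rewrite lerDl.
have B0 : 0 <= `|x| + `|x - y| by rewrite addr_ge0.
have -> : m.+1%:R * (`|x| + `|x - y|) ^+ m = \sum_(k < m.+1) (`|x| + `|x - y|) ^+ m.
  by rewrite sumr_const card_ord mulr_natl.
apply: ler_sum => k _.
rewrite normrM !normrX.
have -> : (`|x| + `|x - y|) ^+ m = (`|x| + `|x - y|) ^+ (m.+1.-1 - k) * (`|x| + `|x - y|) ^+ k.
  by rewrite -exprD subnK // -ltnS.
by apply: ler_pM; rewrite ?exprn_ge0 // lerXn2r ?nnegrE.
Qed.

Lemma pow_add_le a b (m : nat) : 0 <= a -> 0 <= b -> (a + b) ^+ m <= 2 ^+ m * (a ^+ m + b ^+ m).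
Proof.
move=> a0 b0.
have am : 0 <= a ^+ m by rewrite exprn_ge0.
have bm : 0 <= b ^+ m by rewrite exprn_ge0.
case/orP: (le_total a b) => h.
  apply: (@le_trans _ _ ((2 * b) ^+ m)).
    by rewrite lerXn2r ?nnegrE ?addr_ge0 ?mulr_ge0 //; lra.
  by rewrite exprMn ler_wpM2l ?exprn_ge0 // lerDr.
apply: (@le_trans _ _ ((2 * a) ^+ m)).
  by rewrite lerXn2r ?nnegrE ?addr_ge0 ?mulr_ge0 //; lra.
by rewrite exprMn ler_wpM2l ?exprn_ge0 // lerDl.
Qed.

End Powers.

(** * One-site averages *)

Section FixedPoint.
Variables (R : realType) (S : nat) (beta D hf p q : R).
Hypothesis fp : fixed_point S beta D hf p q.
Local Notation X := 'I_(S.*2.+1).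
Local Notation V := (@siteV R S beta D hf p q).

Lemma avg_etaE eta (phi : R -> R) :
  avg_eta S beta D hf p q eta phi = gav (V eta) (fun x => phi (spin R x)).
Proof. by []. Qed.

Lemma lipexp_gav (f : X -> R) : lipexp (gaugeR R) (fun eta => gav (V eta) f).
Proof.
have := lipexp_siteV beta D hf p q (fun rho : {ffun 'I_1 -> X} => f (rho ord0)).
by congr lipexp; apply/funext => eta; rewrite rav_one //; exact: ord0.
Qed.

Lemma fp_q0 : 0 <= q.
Proof.
case: fp => -> _; rewrite -[leLHS](gexp_cst (0 : R)); apply: ler_gexp.
- exact: lipexp_cst.
- rewrite (_ : (fun eta => _) = fun eta => gav (V eta) (@spin R S) * gav (V eta) (@spin R S)).
    by apply: lipexpM; exact: lipexp_gav.
  by apply/funext => eta.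
- by move=> x; exact: sqr_ge0.
Qed.

Variable I : finType.

(** These are the fixed-point equations, with [q] off the diagonal because replicas are independent
    given the field. They make [spin * spin - Qm] centred at [t = 0]. *)
Lemma Es_prod (a b : I) : Es beta D hf p q (fun x : {ffun I -> X} => spin R (x a) * spin R (x b)) = Qm p q a b.
Proof.
rewrite /Es /Qm; case: fp => fq fpp; case: eqP => [<-|/eqP ab].
  rewrite [RHS]fpp; congr gexp; apply/funext => eta.
  rewrite avg_etaE -(rav_one ord0 (V eta) a (fun x => spin R x ^+ 2)).
  by apply: eq_gav => x; rewrite expr2.
rewrite [RHS]fq; congr gexp; apply/funext => eta.
rewrite (@rav_mulr _ _ _ ord0 _ (fun rho => spin R (rho a)) b); last first.
  by move=> rho x; rewrite updr_other.
by rewrite (rav_one ord0 (V eta) a (@spin R S)) avg_etaE expr2.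
Qed.

Lemma EsD f1 f2 : Es beta D hf p q (fun x : {ffun I -> X} => f1 x + f2 x) =
  Es beta D hf p q f1 + Es beta D hf p q f2.
Proof.
rewrite /Es -gexpD; try exact: lipexp_siteV.
by congr gexp; apply/funext => eta; rewrite /rav gavD.
Qed.

Lemma EsZ c f : Es beta D hf p q (fun x : {ffun I -> X} => c * f x) = c * Es beta D hf p q f.
Proof.
rewrite /Es -gexpZ; try exact: lipexp_siteV.
by congr gexp; apply/funext => eta; rewrite /rav gavZ.
Qed.

Lemma eq_Es f1 f2 : f1 =1 f2 ->
  Es beta D hf p q (f1 : {ffun I -> X} -> R) = Es beta D hf p q f2.
Proof. by move=> H; congr gexp; apply/funext => eta; exact: eq_gav. Qed.

Lemma Es_bound f M : (forall x, `|f x| <= M) ->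
  `|Es beta D hf p q (f : {ffun I -> X} -> R)| <= M.
Proof.
move=> H; rewrite -[leRHS]gexp_cst; apply: ler_norm_gexp.
- exact: lipexp_siteV.
- exact: lipexp_cst.
- by move=> eta; apply: (gav_bound [ffun=> ord0]).
Qed.

Lemma Es_cst c : Es beta D hf p q (fun _ : {ffun I -> X} => c) = c.
Proof.
rewrite /Es -[RHS]gexp_cst; congr gexp; apply/funext => eta.
by rewrite /rav (gav_cst [ffun=> ord0]).
Qed.

Lemma Qm_bound (a b : I) : `|Qm p q a b| <= S%:R ^+ 2.
Proof.
rewrite -Es_prod; apply: Es_bound => x; rewrite normrM expr2.
by apply: ler_pM => //; exact: spin_bound.
Qed.

End FixedPoint.

(** * Averages along the cavity path *)

Section Averages.
Variables (R : realType) (S : nat) (beta D hf p q : R) (N : nat) (I : finType) (i : 'I_N).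
Local Notation O := (config N S).
Local Notation nu t := (@nut R N S beta D hf p q I i t).
Implicit Types f : {ffun I -> O} -> R.
Let o : O := [ffun=> ord0].

Lemma eq_nut t f1 f2 : f1 =1 f2 -> nu t f1 = nu t f2.
Proof. exact: eq_gPhi. Qed.
Lemma nutD t f1 f2 : nu t (fun r => f1 r + f2 r) = nu t f1 + nu t f2.
Proof. exact: (gPhiD o (coords_uniq N)). Qed.
Lemma nutZ t c f : nu t (fun r => c * f r) = c * nu t f.
Proof. exact: (gPhiZ o (coords_uniq N)). Qed.
Lemma nut_cst t c : nu t (fun=> c) = c.
Proof. exact: (gPhi_cst I o). Qed.
Lemma nut_sum t (T : Type) (s : seq T) (P : pred T) (F : T -> {ffun I -> O} -> R) :
  nu t (fun r => \sum_(x <- s | P x) F x r) = \sum_(x <- s | P x) nu t (F x).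
Proof. exact: (gPhi_sum o (coords_uniq N)). Qed.
Lemma ler_norm_nut t f1 f2 : (forall r, `|f1 r| <= f2 r) -> `|nu t f1| <= nu t f2.
Proof. exact: (ler_norm_gPhi o (coords_uniq N)). Qed.
Lemma nutB t f1 f2 : nu t (fun r => f1 r - f2 r) = nu t f1 - nu t f2.
Proof.
by rewrite -[in RHS]mulN1r -nutZ -nutD; apply: eq_nut => r; rewrite mulN1r.
Qed.
Lemma nut_ge0 t f : (forall r, 0 <= f r) -> 0 <= nu t f.
Proof.
move=> H; apply: le_trans (normr_ge0 (nu t (fun=> 0))) _; apply: ler_norm_nut => r.
by rewrite normr0.
Qed.
Lemma ler_nut t f1 f2 : (forall r, f1 r <= f2 r) -> nu t f1 <= nu t f2.
Proof. by move=> H; rewrite -subr_ge0 -nutB; apply: nut_ge0 => r; rewrite subr_ge0. Qed.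
Lemma nut_bounded f : exists M, forall t, `|nu t f| <= M.
Proof. by have [M H] := gPhi_bounded o (coords_uniq N) (cavA beta q i) (cavB0 beta D hf p q i) (cavB1 beta p q i) f; exists M => t; exact: H. Qed.

Hypotheses (q0 : 0 <= q).
Variables (J : {set I}) (r1 r2 : I).
Hypotheses (r1J : r1 \notin J) (r2J : r2 \notin r1 |: J).
Local Notation ker := (@cavker R N S beta p q I i J r1 r2).

Lemma nut_diff_le_at f M t : 0 <= t <= 1 -> dep J f ->
  (forall t, 0 <= t <= 1 -> nu t (fun r => `|f r * ker r|) <= M) ->
  `|nu 1 f - nu t f| <= M.
Proof.
move=> ht fJ H; apply: (deriv01_mvt_at (nut_deriv beta D hf p q0 i r1J r2J fJ)) => // s hs.
by apply: le_trans (H s hs); apply: ler_norm_nut.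
Qed.

Lemma nut_diff_le f M : dep J f ->
  (forall t, 0 <= t <= 1 -> nu t (fun r => `|f r * ker r|) <= M) ->
  `|nu 1 f - nu 0 f| <= M.
Proof. by apply: nut_diff_le_at; rewrite lexx ler01. Qed.

Lemma nut_taylor_le f M : dep J f ->
  (forall t, 0 <= t <= 1 -> `|nu t (fun r => f r * ker r) - nu 0 (fun r => f r * ker r)| <= M) ->
  `|nu 1 f - nu 0 f - nu 0 (fun r => f r * ker r)| <= M.
Proof.
by move=> fJ H; exact: (deriv01_taylor (nut_deriv beta D hf p q0 i r1J r2J fJ)).
Qed.

Lemma nut_gronwall f M t : 0 <= M -> dep J f -> (forall r, 0 <= f r) ->
  (forall r, `|ker r| <= M) -> 0 <= t <= 1 -> nu t f <= expR M * nu 1 f.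
Proof.
move=> M0 fJ f0 kM ht.
apply: (deriv01_gronwall M0 (nut_deriv beta D hf p q0 i r1J r2J fJ)) => //.
- by have [B HB] := nut_bounded (fun r => f r * ker r); exists B => s _.
- move=> s _; rewrite -nutZ; apply: ler_norm_nut => r.
  by rewrite normrM ger0_norm // mulrC ler_wpM2r.
- by move=> s; exact: nut_ge0.
Qed.

End Averages.

Lemma sumr_ord_cst (R : pzRingType) (n : nat) (x : R) : \sum_(a < n) x = n%:R * x.
Proof. by rewrite sumr_const card_ord mulr_natl. Qed.

Lemma sumr_fin_cst (R : pzRingType) (I : finType) (x : R) : \sum_(a : I) x = #|I|%:R * x.
Proof. by rewrite sumr_const mulr_natl. Qed.

(** * Moments of the centred overlaps *)

Section Overlaps.
Variables (R : realType) (N S : nat) (I : finType).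
Local Notation O := (config N S).
Local Notation X := 'I_(S.*2.+1).
Local Notation s2 := (S%:R ^+ 2 : R).
Implicit Types (rho : {ffun I -> O}) (J : {set I}) (a b k : I) (p q : R) (i : 'I_N).

Definition Uf (p q : R) rho a b : R :=
  N%:R^-1 * (\sum_(j < N) spin R (rho a j) * spin R (rho b j)) - Qm p q a b.

Lemma spin2_bound (x y : X) : `|spin R x * spin R y| <= s2.
Proof. by rewrite normrM expr2; apply: ler_pM => //; exact: spin_bound. Qed.

Lemma s2_ge0 : 0 <= s2. Proof. exact: sqr_ge0. Qed.

Lemma Uf_Um p q i rho a b :
  Uf p q rho a b = Um p q i rho a b + N%:R^-1 * (spin R (rho a i) * spin R (rho b i)).
Proof. by rewrite /Uf /Um /Rm (bigD1 i) //=; ring. Qed.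

Lemma Uf_sum p q rho a b : (0 < N)%N -> Uf p q rho a b =
  N%:R^-1 * \sum_(j < N) (spin R (rho a j) * spin R (rho b j) - Qm p q a b).
Proof.
move=> N0; rewrite sumrB mulrBr; congr (_ - _).
by rewrite sumr_ord_cst mulrA mulVf ?mul1r // pnatr_eq0 -lt0n.
Qed.

Lemma Um_dep p q i a b J k rho x : a \in J -> b \in J -> k \notin J ->
  Um p q i (updr rho k x) a b = Um p q i rho a b.
Proof.
move=> aJ bJ kJ; rewrite /Um /Rm !updr_other //.
  by apply: contraNneq kJ => <-.
by apply: contraNneq kJ => <-.
Qed.

Lemma spin_dep i a J k rho x : a \in J -> k \notin J -> spin R (updr rho k x a i) = spin R (rho a i).
Proof. by move=> aJ kJ; rewrite updr_other //; apply: contraNneq kJ => <-. Qed.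

Lemma Um_updsr p q i rho (x : {ffun I -> X}) a b : Um p q i (updsr i rho x) a b = Um p q i rho a b.
Proof.
rewrite /Um /Rm; congr (_ * _ - _); apply: eq_bigr => j /negPf ji.
by rewrite !ffunE ji.
Qed.

Lemma siteE i rho a : site i rho a = rho a i.
Proof. by rewrite ffunE. Qed.

Lemma Rm_bound i rho a b : `|Rm R i rho a b| <= s2.
Proof.
have N0 : (0 < N)%N by apply: leq_ltn_trans (ltn_ord i).
rewrite /Rm normrM ger0_norm ?invr_ge0 // ler_pdivrMl ?ltr0n //.
apply: (le_trans (ler_norm_sum _ _ _)).
rewrite -sumr_ord_cst.
rewrite big_mkcond; apply: ler_sum => j _; case: ifP => _; last exact: s2_ge0.
exact: spin2_bound.
Qed.

Lemma wgtJ_bound J r k : `|wgtJ R J r k| <= #|J|.+1%:R.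
Proof.
rewrite /wgtJ; case: ifP => _; first by rewrite normr1 ler1n.
by case: ifP => _; rewrite ?normrN ?normr0 // ger0_norm // ler_nat.
Qed.

Lemma cavker_bound beta p q i J r1 r2 rho :
  `|cavker beta p q i J r1 r2 rho| <=
  beta ^+ 2 / 2 * (#|J|.+1%:R * #|J|.+2%:R * s2) * \sum_a \sum_b `|Um p q i rho a b|.
Proof.
rewrite /cavker normrM ger0_norm ?divr_ge0 ?sqr_ge0 // -mulrA; apply: ler_wpM2l.
  by rewrite divr_ge0 // sqr_ge0.
apply: (le_trans (ler_norm_sum _ _ _)); rewrite mulr_sumr; apply: ler_sum => a _.
apply: (le_trans (ler_norm_sum _ _ _)); rewrite mulr_sumr; apply: ler_sum => b _.
rewrite !normrM -mulrA -[leRHS]mulrA -[leRHS]mulrA.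
apply: ler_pM; [exact: normr_ge0|by rewrite ?mulr_ge0|exact: wgtJ_bound|].
apply: ler_pM; [exact: normr_ge0|by rewrite ?mulr_ge0| |].
  apply: (le_trans (wgtJ_bound _ _ _)); rewrite ler_nat ltnS.
  by rewrite (leq_trans (leq_card_setU _ _)) // cards1.
by rewrite -normrM; apply: ler_wpM2r => //; exact: spin2_bound.
Qed.

Lemma ex_fresh J : (#|J| < #|I|)%N -> exists r, r \notin J.
Proof.
move=> h; have : (0 < #|~: J|)%N.
  by rewrite -(ltn_add2l #|J|) addn0 cardsC.
by case/card_gt0P => r; rewrite inE => hr; exists r.
Qed.

End Overlaps.

Section Moments.
Variables (R : realType) (S : nat) (D hf : R) (I : finType).
Hypothesis I4 : (4 <= #|I|)%N.
Local Notation s2 := (S%:R ^+ 2 : R).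

(** [Mg] bounds the cavity kernel when [beta <= 1], so [expR Mg] is the Gronwall factor; [Gc] is the
    coefficient of [beta ^+ 2] in the cavity estimate. They depend neither on [N] nor on the order
    of the moment. *)
Let K2 : R := #|I|%:R * #|I|%:R.
Let Mg : R := 12 * K2 * s2 ^+ 2.
Let Gc : R := 12 * (K2 + 1) * s2 ^+ 2 * expR Mg.
Let K20 : 0 <= K2. Proof. exact: mulr_ge0. Qed.

Section Site.
Variables (beta p q : R) (N : nat) (i : 'I_N).
Hypotheses (b0 : 0 < beta) (b1 : beta <= 1) (fp : fixed_point S beta D hf p q).
Local Notation O := (config N S).
Local Notation nu t := (@nut R N S beta D hf p q I i t).
Local Notation UM := (@Um R N S p q I i).
Local Notation UF := (@Uf R N S I p q).
Let q0 := fp_q0 fp.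
Let N0 : (0 < N)%N. Proof. exact: leq_ltn_trans (ltn_ord i). Qed.

Lemma Um_bound rho a b : `|UM rho a b| <= 2 * s2.
Proof.
apply: (le_trans (ler_normB _ _)); have := Rm_bound R i rho a b.
have := Qm_bound fp a b; lra.
Qed.

Lemma pair_fresh (a b : I) : exists J r1 r2, [/\ J = [set a; b],
  (#|J| <= 2)%N, r1 \notin J & r2 \notin r1 |: J].
Proof.
have c2 : (#|[set a; b]| <= 2)%N by rewrite cards2; case: (_ != _).
have [r1 h1] : exists r : I, r \notin [set a; b].
  by apply: ex_fresh; apply: leq_ltn_trans c2 _; apply: leq_trans I4.
have [r2 h2] : exists r : I, r \notin r1 |: [set a; b].
  by apply: ex_fresh; rewrite cardsU1 h1; apply: leq_trans I4; rewrite add1n !ltnS.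
by exists [set a; b], r1, r2.
Qed.

Lemma ker_le (J : {set I}) r1 r2 (rho : {ffun I -> O}) : (#|J| <= 2)%N ->
  `|cavker beta p q i J r1 r2 rho| <= beta ^+ 2 * (6 * s2) * \sum_a \sum_b `|UM rho a b|.
Proof.
move=> c2; apply: (le_trans (cavker_bound _ _ _ _ _ _ _ _)).
have T0 : 0 <= \sum_a \sum_b `|UM rho a b|.
  by rewrite sumr_ge0 // => a _; rewrite sumr_ge0.
apply: ler_wpM2r => //.
have -> : beta ^+ 2 * (6 * s2) = beta ^+ 2 / 2 * (3 * 4 * s2) by field.
apply: ler_wpM2l; first by rewrite divr_ge0 // sqr_ge0.
apply: ler_wpM2r; first exact: sqr_ge0.
by apply: ler_pM; rewrite ?ler0n ?ler_nat ?ltnS.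
Qed.

Lemma ker_le_cst (J : {set I}) r1 r2 (rho : {ffun I -> O}) : (#|J| <= 2)%N ->
  `|cavker beta p q i J r1 r2 rho| <= Mg.
Proof.
move=> c2; apply: (le_trans (ker_le r1 r2 rho c2)).
have T1 : \sum_a \sum_b `|UM rho a b| <= 2 * K2 * s2.
  apply: (@le_trans _ _ (\sum_(a : I) \sum_(b : I) (2 * s2))).
    by apply: ler_sum => a _; apply: ler_sum => b _; exact: Um_bound.
  by rewrite !sumr_fin_cst le_eqVlt; apply/orP; left; apply/eqP; rewrite /K2; ring.
have T0 : 0 <= \sum_a \sum_b `|UM rho a b|.
  by rewrite sumr_ge0 // => a _; rewrite sumr_ge0.
have e : beta ^+ 2 <= 1 by rewrite expr_le1 // ltW.
have s0 : 0 <= s2 := sqr_ge0 _.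
have -> : Mg = (1 * (6 * s2)) * (2 * K2 * s2) by rewrite /Mg; ring.
apply: ler_pM => //; first by rewrite mulr_ge0 ?sqr_ge0 // mulr_ge0.
by apply: ler_wpM2r => //; rewrite mulr_ge0.
Qed.

Lemma Um_pow_gronwall (m : nat) t a b : 0 <= t <= 1 ->
  nu t (fun rho => UM rho a b ^+ m.*2) <= expR Mg * nu 1 (fun rho => UM rho a b ^+ m.*2).
Proof.
move=> ht; have [J [r1 [r2 [JE c2 r1J r2J]]]] := pair_fresh a b.
apply: (@nut_gronwall R S beta D hf p q N I i q0 J r1 r2 r1J r2J) => //.
- by rewrite mulr_ge0 ?sqr_ge0 // mulr_ge0.
- move=> k kJ rho x; congr (_ ^+ _); apply: Um_dep kJ; rewrite JE !inE eqxx ?orbT //.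
- by move=> rho; rewrite exprn_even_ge0 // odd_double.
- by move=> rho; exact: ker_le_cst.
Qed.

Lemma sum_pow_le (m : nat) t : 0 <= t <= 1 ->
  nu t (fun rho => \sum_a \sum_b UM rho a b ^+ m.*2) <=
  expR Mg * nu 1 (fun rho => \sum_a \sum_b UM rho a b ^+ m.*2).
Proof.
move=> ht; rewrite !nut_sum mulr_sumr; apply: ler_sum => a _.
by rewrite !nut_sum mulr_sumr; apply: ler_sum => b _; exact: Um_pow_gronwall.
Qed.

Lemma Um_Uf_pow1 (m : nat) a b :
  nu 1 (fun rho => UM rho a b ^+ m.*2) <=
  expR 1 * nu 1 (fun rho => UF rho a b ^+ m.*2)
  + (m.*2.+1%:R * s2) ^+ m.*2 / N%:R ^+ m.*2.
Proof.
rewrite -nutZ -[X in _ + X](nut_cst S beta D hf p q I i 1) -nutD; apply: ler_nut => rho.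
have ev x : x ^+ m.*2 = `|x| ^+ m.*2 :> R.
  by rewrite -normrX ger0_norm // exprn_even_ge0 // odd_double.
have -> : UM rho a b = UF rho a b + - (N%:R^-1 * (spin R (rho a i) * spin R (rho b i))).
  by rewrite (Uf_Um p q i); ring.
rewrite ev [UF rho a b ^+ _]ev.
apply: (le_trans (pow_add_expR _ _ _)); rewrite lerD2l.
rewrite -exprVn -exprMn lerXn2r ?nnegrE ?mulr_ge0 ?invr_ge0 ?sqr_ge0 //.
rewrite -mulrA; apply: ler_wpM2l => //; rewrite normrN normrM mulrC [`|N%:R^-1|]ger0_norm ?invr_ge0 //.
by rewrite ler_wpM2r ?invr_ge0 // spin2_bound.
Qed.

Lemma Um_Uf_pow (m : nat) :
  nu 1 (fun rho => \sum_a \sum_b UM rho a b ^+ m.*2) <=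
  expR 1 * (\sum_a \sum_b nu 1 (fun rho => UF rho a b ^+ m.*2))
  + K2 * (m.*2.+1%:R * s2) ^+ m.*2 / N%:R ^+ m.*2.
Proof.
rewrite (_ : K2 * _ / _ = \sum_(a : I) \sum_(b : I) (m.*2.+1%:R * s2) ^+ m.*2 / N%:R ^+ m.*2); last first.
  by rewrite !sumr_fin_cst /K2; ring.
rewrite nut_sum mulr_sumr -big_split; apply: ler_sum => a _ /=.
rewrite nut_sum mulr_sumr -big_split; apply: ler_sum => b _ /=.
exact: Um_Uf_pow1.
Qed.

(** At [t = 0] the centred one-site factor averages to zero, so the derivative alone counts. Its
    kernel brings [beta ^+ 2] and one more overlap, and Young's inequality turns this together with
    the odd power into even powers of order [k.+1.*2]. *)
Lemma cavity_moment (k : nat) (a b : I) :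
  `|nu 1 (fun rho => (spin R (rho a i) * spin R (rho b i) - Qm p q a b) * UM rho a b ^+ k.*2.+1)|
  <= beta ^+ 2 * Gc * (expR 1 * (\sum_a \sum_b nu 1 (fun rho => UF rho a b ^+ k.+1.*2))
     + K2 * (k.+1.*2.+1%:R * s2) ^+ k.+1.*2 / N%:R ^+ k.+1.*2).
Proof.
have [J [r1 [r2 [JE c2 r1J r2J]]]] := pair_fresh a b.
set f := fun rho => _.
have aJ : a \in J by rewrite JE !inE eqxx.
have bJ : b \in J by rewrite JE !inE eqxx orbT.
have fJ : dep J f.
  move=> l lJ rho x; rewrite /f (Um_dep _ _ _ _ _ aJ bJ lJ).
  by rewrite (spin_dep R _ _ _ aJ lJ) (spin_dep R _ _ _ bJ lJ).
have z0 : nu 0 f = 0.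
  have := @nut_0 R N S beta D hf p q I i (fun rho => UM rho a b ^+ k.*2.+1)
    (fun x => spin R (x a) * spin R (x b) - Qm p q a b).
  rewrite (@EsD _ _ _ _ _ _ _ _ (fun x => spin R (x a) * spin R (x b)) (fun=> - Qm p q a b)).
  rewrite (Es_prod fp) Es_cst subrr mulr0 => e.
  rewrite -[RHS]e.
    by apply: eq_nut => rho; rewrite /f !siteE [RHS]mulrC.
  by move=> rho x; rewrite Um_updsr.
have -> : nu 1 f = nu 1 f - nu 0 f by rewrite z0 subr0.
apply: (@nut_diff_le R S beta D hf p q N I i q0 J r1 r2 r1J r2J) => // t ht.
have s0 : 0 <= s2 := sqr_ge0 _.
have K3 : 0 <= K2 + 1 by rewrite addr_ge0.
have Gc0 : 0 <= beta ^+ 2 * (12 * (K2 + 1) * s2 ^+ 2).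
  by apply: mulr_ge0; rewrite ?sqr_ge0 //; apply: mulr_ge0 => //; apply: mulr_ge0.
apply: (@le_trans _ _ (beta ^+ 2 * (12 * (K2 + 1) * s2 ^+ 2) *
    nu t (fun rho => \sum_a \sum_b UM rho a b ^+ k.+1.*2))); last first.
  have -> : beta ^+ 2 * Gc = beta ^+ 2 * (12 * (K2 + 1) * s2 ^+ 2) * expR Mg by rewrite /Gc; ring.
  rewrite -[leRHS]mulrA; apply: ler_wpM2l => //.
  apply: (le_trans (sum_pow_le _ ht)); apply: ler_wpM2l; first exact: expR_ge0.
  exact: Um_Uf_pow.
rewrite -nutZ; apply: ler_nut => rho.
rewrite normrM; have hk := ker_le r1 r2 rho c2.
set T := \sum_a \sum_b _ in hk.
set P := \sum_a \sum_b _.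
have ev (x : R) : `|x| ^+ k.+1.*2 = x ^+ k.+1.*2.
  by rewrite -normrX ger0_norm // exprn_even_ge0 // odd_double.
have P0 c d : `|UM rho c d| ^+ k.+1.*2 <= P.
  rewrite ev /P (bigD1 c) //= (bigD1 d) //= -addrA lerDl addr_ge0 // sumr_ge0 //.
    by move=> l _; rewrite exprn_even_ge0 // odd_double.
  by move=> l _; rewrite sumr_ge0 // => l' _; rewrite exprn_even_ge0 // odd_double.
have hf1 : `|f rho| <= 2 * s2 * `|UM rho a b| ^+ k.*2.+1.
  rewrite /f normrM normrX; apply: ler_wpM2r; first by rewrite exprn_ge0.
  apply: (le_trans (ler_normB _ _)).
  by have := spin2_bound R (rho a i) (rho b i); have := Qm_bound fp a b; lra.
have hT : `|UM rho a b| ^+ k.*2.+1 * T <= (K2 + 1) * P.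
  rewrite /T mulr_sumr.
  apply: (@le_trans _ _ (\sum_(c : I) \sum_(d : I) (`|UM rho c d| ^+ k.+1.*2 + P))).
    apply: ler_sum => c _; rewrite mulr_sumr; apply: ler_sum => d _.
    rewrite mulrC; apply: (le_trans (young_pow _ _ _)) => //.
    by rewrite -doubleS lerD2l.
  rewrite (eq_bigr (fun c => \sum_(d : I) UM rho c d ^+ k.+1.*2 + #|I|%:R * P)).
    by rewrite big_split /= -/P sumr_fin_cst le_eqVlt; apply/orP; left; apply/eqP; rewrite /K2; ring.
  move=> c _; rewrite big_split /=; congr (_ + _).
    by apply: eq_bigr => d _; rewrite ev.
  by rewrite sumr_fin_cst.
apply: (le_trans (ler_pM _ _ hf1 hk)) => //.
have -> : 2 * s2 * `|UM rho a b| ^+ k.*2.+1 * (beta ^+ 2 * (6 * s2) * T) =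
  beta ^+ 2 * (12 * s2 ^+ 2) * (`|UM rho a b| ^+ k.*2.+1 * T) by ring.
have -> : beta ^+ 2 * (12 * (K2 + 1) * s2 ^+ 2) * P = beta ^+ 2 * (12 * s2 ^+ 2) * ((K2 + 1) * P) by ring.
by apply: ler_wpM2l => //; rewrite mulr_ge0 ?sqr_ge0 // mulr_ge0 // sqr_ge0.
Qed.

(** Exchanging full and cavity overlaps costs [1 / N] and leaves the even moment of order [k.*2],
    which the induction already controls. *)
Lemma cavity_remainder (k : nat) (a b : I) :
  `|nu 1 (fun rho => (spin R (rho a i) * spin R (rho b i) - Qm p q a b) *
      (UF rho a b ^+ k.*2.+1 - UM rho a b ^+ k.*2.+1))|
  <= 2 * s2 * (k.*2.+1%:R * (s2 / N%:R) * 2 ^+ k.*2) *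
    (nu 1 (fun rho => UF rho a b ^+ k.*2) + (s2 / N%:R) ^+ k.*2).
Proof.
set c := s2 / N%:R; have c0 : 0 <= c by rewrite divr_ge0 // sqr_ge0.
have s0 : 0 <= s2 := sqr_ge0 _.
rewrite -[X in _ + X](nut_cst S beta D hf p q I i 1) -nutD -nutZ; apply: ler_norm_nut => rho.
rewrite normrM -mulrA; apply: ler_pM => //.
  apply: (le_trans (ler_normB _ _)).
  by have := spin2_bound R (rho a i) (rho b i); have := Qm_bound fp a b; lra.
have hd : `|UF rho a b - UM rho a b| <= c.
  rewrite (Uf_Um p q i) addrAC subrr add0r normrM mulrC [`|N%:R^-1|]ger0_norm ?invr_ge0 //.
  by rewrite ler_wpM2r ?invr_ge0 // spin2_bound.
apply: (le_trans (pow_diff _ _ _)); clearbody c.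
rewrite -!mulrA; apply: ler_wpM2l => //; apply: ler_pM; [exact: normr_ge0|by rewrite exprn_ge0 // addr_ge0|exact: hd|].
have -> : UF rho a b ^+ k.*2 = `|UF rho a b| ^+ k.*2.
  by rewrite -normrX ger0_norm // exprn_even_ge0 // odd_double.
apply: le_trans (pow_add_le _ _ c0) => //.
by rewrite lerXn2r ?nnegrE ?addr_ge0 // lerD2l.
Qed.

End Site.

(** By induction on [k]: one factor of the even power is written as an average over sites and
    estimated along the path of each site. The leading part returns the same moments times a
    multiple of [beta ^+ 2]; the rest has the required order. *)
Lemma overlap_moments : exists beta0 : R, [/\ 0 < beta0, beta0 <= 1 &
  forall beta, 0 < beta -> beta < beta0 -> forall p q, fixed_point S beta D hf p q ->
  forall k : nat, exists C, 0 <= C /\ forall N, (0 < N)%N ->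
    \sum_(a : I) \sum_(b : I) nuI beta D hf
      (fun rho : {ffun I -> config N S} => Uf p q rho a b ^+ k.*2) <= C / N%:R ^+ k].
Proof.
(* Chosen so that [beta < T^-1] leaves a feedback coefficient of at most one half; the summand 1
   keeps [T] positive. *)
pose T := 2 * K2 * Gc * expR 1 + 1.
have s0 : 0 <= s2 := sqr_ge0 _.
have G0 : 0 <= Gc.
  by apply: mulr_ge0; rewrite ?expR_ge0 //; apply: mulr_ge0 => //; apply: mulr_ge0 => //; apply: addr_ge0.
have T1 : 0 <= 2 * K2 * Gc * expR 1.
  by apply: mulr_ge0; rewrite ?expR_ge0 //; apply: mulr_ge0 => //; apply: mulr_ge0.
have T0 : 0 < T by rewrite /T; lra.
exists (Num.min 1 T^-1); split; first by rewrite lt_min ltr01 invr_gt0.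
  by rewrite ge_min lexx.
move=> beta b0; rewrite lt_min => /andP[/ltW b1 bT] p q fp.
have bG : K2 * (beta ^+ 2 * Gc * expR 1) <= 2^-1.
  have h1 : beta ^+ 2 <= T^-1.
    by rewrite expr2; apply: (le_trans _ (ltW bT)); rewrite ler_piMr // ltW.
  have h2 : beta ^+ 2 * T <= 1 by rewrite -ler_pdivlMr // div1r.
  have h3 : 0 <= beta ^+ 2 := sqr_ge0 _.
  by move: h2; rewrite /T; lra.
elim=> [|k [C [C0 HC]]].
  exists K2; split => // N N0; rewrite expr0 divr1.
  rewrite (eq_bigr (fun=> #|I|%:R)) => [|a _]; first by rewrite sumr_fin_cst.
  rewrite (eq_bigr (fun=> 1)) => [|b _]; first by rewrite sumr_fin_cst mulr1.
  rewrite -(nut_1 beta D hf p q (Ordinal N0)) (eq_nut _ _ _ _ _ _ _ (f2 := fun=> 1)) ?nut_cst //.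
pose c1 := 2 * s2 * (k.*2.+1%:R * s2 * 2 ^+ k.*2) * (C + s2 ^+ k.*2).
pose c2 := K2 * (k.+1.*2.+1%:R * s2) ^+ k.+1.*2.
have c10 : 0 <= c1 by rewrite !mulr_ge0 ?addr_ge0 ?exprn_ge0.
have c20 : 0 <= c2 by apply: mulr_ge0 => //; apply: exprn_ge0; apply: mulr_ge0.
have e0 : 0 <= beta ^+ 2 * Gc by rewrite mulr_ge0 // sqr_ge0.
exists (2 * K2 * (beta ^+ 2 * Gc * c2 + c1)); split.
  by apply: mulr_ge0; [exact: mulr_ge0|apply: addr_ge0 => //; exact: mulr_ge0].
move=> N N0.
set s := \sum_(a : I) \sum_(b : I) _.
have N1 : 1 <= (N%:R : R) by rewrite ler1n.
have Nk0 m : 0 < (N%:R : R) ^+ m by rewrite exprn_gt0 // ltr0n.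
have key a b : nuI beta D hf (fun rho : {ffun I -> config N S} => Uf p q rho a b ^+ k.+1.*2)
    <= beta ^+ 2 * Gc * expR 1 * s + (beta ^+ 2 * Gc * c2 + c1) / N%:R ^+ k.+1.
  pose i0 := Ordinal N0.
  rewrite -(nut_1 beta D hf p q i0).
  have -> : nut beta D hf p q i0 1 (fun rho : {ffun I -> config N S} => Uf p q rho a b ^+ k.+1.*2)
    = N%:R^-1 * \sum_(i < N) nut beta D hf p q i0 1 (fun rho : {ffun I -> config N S} =>
       (spin R (rho a i) * spin R (rho b i) - Qm p q a b) * Uf p q rho a b ^+ k.*2.+1).
    rewrite -nut_sum -nutZ; apply: eq_nut => rho.
    by rewrite doubleS exprS {1}Uf_sum // -mulrA mulr_suml.
  rewrite ler_pdivrMl ?ltr0n //.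
  rewrite -sumr_ord_cst.
  (* The paths of all sites end at the same measure, so each summand may be estimated along its own
     path. *)
  apply: ler_sum => i _; rewrite !nut_1 -(nut_1 beta D hf p q i).
  have h1 := cavity_moment i b0 b1 fp k a b.
  have h2 := cavity_remainder i fp k a b.
  apply: (le_trans (ler_norm _)).
  rewrite (eq_nut _ _ _ _ _ _ _ (f2 := fun rho : {ffun I -> config N S} =>
     (spin R (rho a i) * spin R (rho b i) - Qm p q a b) * Um p q i rho a b ^+ k.*2.+1 +
     (spin R (rho a i) * spin R (rho b i) - Qm p q a b) *
      (Uf p q rho a b ^+ k.*2.+1 - Um p q i rho a b ^+ k.*2.+1))); last first.
    by move=> rho; ring.
  rewrite nutD; apply: (le_trans (ler_normD _ _)).
  apply: (le_trans (lerD h1 h2)).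
  have sE : \sum_(c : I) \sum_(d : I) nut beta D hf p q i 1
      (fun rho : {ffun I -> config N S} => Uf p q rho c d ^+ k.+1.*2) = s.
    by apply: eq_bigr => c _; apply: eq_bigr => d _; rewrite nut_1.
  rewrite sE -/c2.
  have h3 : c2 / N%:R ^+ k.+1.*2 <= c2 / N%:R ^+ k.+1.
    apply: ler_wpM2l => //; rewrite lef_pV2 ?posrE //.
    by rewrite ler_weXn2l // -addnn leq_addr.
  have h4 : nut beta D hf p q i 1 (fun rho : {ffun I -> config N S} => Uf p q rho a b ^+ k.*2)
      <= C / N%:R ^+ k.
    apply: le_trans (HC N N0); rewrite nut_1.
    have g0 c d : 0 <= nuI beta D hf (fun rho : {ffun I -> config N S} => Uf p q rho c d ^+ k.*2).
      rewrite -(nut_1 beta D hf p q i); apply: nut_ge0 => rho.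
      by rewrite exprn_even_ge0 // odd_double.
    rewrite (bigD1 a) //= (bigD1 b) //= -addrA lerDl addr_ge0 // sumr_ge0 // => c _.
    by rewrite sumr_ge0.
  have h5 : (s2 / N%:R) ^+ k.*2 <= s2 ^+ k.*2 / N%:R ^+ k.
    rewrite exprMn exprVn; apply: ler_wpM2l; first by rewrite exprn_ge0.
    by rewrite lef_pV2 ?posrE // ler_weXn2l // -addnn leq_addr.
  have h6 : 2 * s2 * (k.*2.+1%:R * (s2 / N%:R) * 2 ^+ k.*2) *
      (nut beta D hf p q i 1 (fun rho : {ffun I -> config N S} => Uf p q rho a b ^+ k.*2) + (s2 / N%:R) ^+ k.*2)
      <= c1 / N%:R ^+ k.+1.
    have -> : c1 / N%:R ^+ k.+1 = 2 * s2 * (k.*2.+1%:R * (s2 / N%:R) * 2 ^+ k.*2) *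
       (C / N%:R ^+ k + s2 ^+ k.*2 / N%:R ^+ k).
      by rewrite /c1 [N%:R ^+ k.+1]exprS invfM; ring.
    apply: ler_wpM2l; last exact: lerD.
    by rewrite !mulr_ge0 ?invr_ge0 ?exprn_ge0.
  have h7 := ler_wpM2l e0 h3.
  apply: (le_trans (lerD (lexx _) h6)).
  rewrite [leRHS](_ : _ = beta ^+ 2 * Gc * (expR 1 * s + c2 / N%:R ^+ k.+1) + c1 / N%:R ^+ k.+1); last by ring.
  rewrite lerD2r; apply: ler_wpM2l => //; rewrite lerD2l //.
have : s <= K2 * (beta ^+ 2 * Gc * expR 1 * s + (beta ^+ 2 * Gc * c2 + c1) / N%:R ^+ k.+1).
  set B := _ + _ in key *.
  have -> : K2 * B = \sum_(a : I) \sum_(b : I) B by rewrite !sumr_fin_cst /K2; ring.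
  by apply: ler_sum => a _; apply: ler_sum => b _; exact: key.
have sp : 0 <= s.
  rewrite sumr_ge0 // => a _; rewrite sumr_ge0 // => b _.
  rewrite -(nut_1 beta D hf p q (Ordinal N0)); apply: nut_ge0 => rho.
  by rewrite exprn_even_ge0 // odd_double.
(* At most half of [s] comes back on the right and is absorbed, which is the origin of the factor 2
   in the constant. *)
have := ler_wpM2r sp bG.
rewrite -[2 * K2 * _ / _]mulrA.
set W := _ / N%:R ^+ k.+1; lra.
Qed.

End Moments.

(** * From four replicas to any number *)

Section Transfer.
Variables (R : realType) (O I : finType) (o : O).

Lemma rav_pair (U : O -> R) (F : O -> O -> R) (a b : I) : a != b ->
  rav U (fun rho : {ffun I -> O} => F (rho a) (rho b)) = gav U (fun x => gav U (F x)).
Proof.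
move=> ab; rewrite (rav_resample o _ _ b) -(rav_one o U a (fun x => gav U (F x))).
by apply: eq_gav => rho; apply: eq_gav => y; rewrite updr_same updr_other.
Qed.

End Transfer.

Section OverlapBounds.
Variables (R : realType) (S : nat) (beta D hf p q : R).
Hypotheses (b0 : 0 < beta) (b1 : beta <= 1) (fp : fixed_point S beta D hf p q).
Hypothesis moments4 : forall k : nat, exists C, 0 <= C /\ forall N, (0 < N)%N ->
    \sum_(a : 'I_4) \sum_(b : 'I_4) nuI beta D hf
      (fun rho : {ffun 'I_4 -> config N S} => Uf p q rho a b ^+ k.*2) <= C / N%:R ^+ k.
Variables (I : finType).
Hypothesis I4 : (4 <= #|I|)%N.
Local Notation s2 := (S%:R ^+ 2 : R).

Lemma nuI_ge0 (T : finType) N (f : {ffun T -> config N S} -> R) : (0 < N)%N ->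
  (forall rho, 0 <= f rho) -> 0 <= nuI beta D hf f.
Proof.
by move=> N0 H; rewrite -(nut_1 beta D hf p q (Ordinal N0)); exact: nut_ge0.
Qed.

(** The law of an overlap involves one or two replicas and does not depend on how many others there
    are, so the four-replica bound applies verbatim. *)
Lemma overlap_moment (k : nat) : exists C, 0 <= C /\ forall N, (0 < N)%N -> forall a b : I,
  nuI beta D hf (fun rho : {ffun I -> config N S} => Uf p q rho a b ^+ k.*2) <= C / N%:R ^+ k.
Proof.
have [C [C0 HC]] := moments4 k; exists C; split => // N N0 a b.
pose G (P : R) (x y : config N S) : R :=
  (N%:R^-1 * (\sum_(j < N) spin R (x j) * spin R (y j)) - P) ^+ k.*2.
have o : config N S := [ffun=> ord0].
have [a' [b' ->]] : exists a' b' : 'I_4,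
   nuI beta D hf (fun rho : {ffun I -> config N S} => Uf p q rho a b ^+ k.*2) =
   nuI beta D hf (fun rho : {ffun 'I_4 -> config N S} => Uf p q rho a' b' ^+ k.*2).
  case: (eqVneq a b) => [<-|ab].
    exists ord0, ord0; rewrite /nuI /Edis; apply: eq_Eiter => g; rewrite /Uf /Qm !eqxx.
    rewrite (rav_one o _ a (fun x => G p x x)).
    by rewrite (rav_one o _ ord0 (fun x => G p x x)).
  exists ord0, (Ordinal (isT : (1 < 4)%N)).
  rewrite /nuI /Edis; apply: eq_Eiter => g; rewrite /Uf /Qm (negPf ab).
  by rewrite (rav_pair o _ (G q) ab) (rav_pair o _ (G q)).
apply: le_trans (HC N N0).
have g0 c d : 0 <= nuI beta D hf (fun rho : {ffun 'I_4 -> config N S} => Uf p q rho c d ^+ k.*2).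
  by apply: nuI_ge0 => // rho; rewrite exprn_even_ge0 // odd_double.
rewrite (bigD1 a') //= (bigD1 b') //= -addrA lerDl addr_ge0 // ?sumr_ge0 // => c _.
by rewrite sumr_ge0.
Qed.

(** A common envelope for all cavity overlaps on the scale [N ^ (- 1 / 2)]. The summand 1 makes its
    powers increase with the exponent. *)
Definition Yb N (i : 'I_N) (rho : {ffun I -> config N S}) : R :=
  1 + \sum_a \sum_b Num.sqrt N%:R * `|Um p q i rho a b|.

Lemma Yb_ge1 N (i : 'I_N) rho : 1 <= Yb i rho.
Proof.
by rewrite lerDl sumr_ge0 // => a _; rewrite sumr_ge0 // => b _; rewrite mulr_ge0.
Qed.

Lemma Um_le_Yb N (i : 'I_N) rho a b : `|Um p q i rho a b| <= Yb i rho * (Num.sqrt N%:R)^-1.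
Proof.
have N0 : (0 < N)%N by apply: leq_ltn_trans (ltn_ord i).
have sN : 0 < Num.sqrt N%:R :> R by rewrite sqrtr_gt0 ltr0n.
rewrite ler_pdivlMr // mulrC /Yb (bigD1 a) //= (bigD1 b) //=.
have g0 c d : 0 <= Num.sqrt N%:R * `|Um p q i rho c d| by rewrite mulr_ge0 // ltW.
have h1 : 0 <= \sum_(d | d != b) Num.sqrt N%:R * `|Um p q i rho a d|.
  by apply: sumr_ge0 => d _.
have h2 : 0 <= \sum_(c | c != a) \sum_d Num.sqrt N%:R * `|Um p q i rho c d|.
  by apply: sumr_ge0 => c _; apply: sumr_ge0 => d _.
lra.
Qed.

Lemma sum_pow_le_seq (T : Type) (s : seq T) (y : T -> R) (m : nat) : (forall x, 0 <= y x) ->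
  (\sum_(x <- s) y x) ^+ m.+1 <= (2 ^+ m.+1) ^+ size s * \sum_(x <- s) y x ^+ m.+1.
Proof.
move=> y0; elim: s => [|x s IH]; first by rewrite !big_nil expr0n /= mulr0.
rewrite !big_cons /=.
have S0 : 0 <= \sum_(x <- s) y x by rewrite sumr_ge0.
apply: (le_trans (pow_add_le _ (y0 x) S0)).
rewrite [(2 ^+ m.+1) ^+ (size s).+1]exprS -mulrA; apply: ler_wpM2l; first by rewrite exprn_ge0.
rewrite mulrDr; apply: lerD => //.
by rewrite ler_peMl ?exprn_ge0 // exprn_ege1 // exprn_ege1 // ler1n.
Qed.

Lemma Yb_moment (m : nat) : exists C, 0 <= C /\ forall N (i : 'I_N) t, 0 <= t <= 1 ->
  nut beta D hf p q i t (fun rho : {ffun I -> config N S} => Yb i rho ^+ m) <= C.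
Proof.
have [C [C0 HC]] := overlap_moment m.+1.
have s0 : 0 <= s2 := sqr_ge0 _.
(* Only even moments are bounded, so the exponent is raised to an even one above [m]; this is
   harmless because [Yb] is at least 1. *)
pose M := m.+1.*2.
have M0 : (0 < M)%N by [].
pose Mg : R := 12 * (#|I|%:R * #|I|%:R) * s2 ^+ 2.
pose W := expR Mg * (expR 1 * C + (M.+1%:R * s2) ^+ M).
have W0 : 0 <= W.
  rewrite mulr_ge0 ?expR_ge0 // addr_ge0 // ?exprn_ge0 ?mulr_ge0 ?expR_ge0 //.
pose n := size (index_enum (I * I)%type : seq (I * I)).
exists (2 ^+ M * (1 + (2 ^+ M) ^+ n * (\sum_(ab : I * I) W))); split.
  rewrite mulr_ge0 ?exprn_ge0 // addr_ge0 // mulr_ge0 ?exprn_ge0 // sumr_ge0 //.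
move=> N i t ht.
have N0 : (0 < N)%N by apply: leq_ltn_trans (ltn_ord i).
have N1 : 1 <= (N%:R : R) by rewrite ler1n.
have sN : 0 <= Num.sqrt N%:R :> R := sqrtr_ge0 _.
have ev (x : R) : `|x| ^+ M = x ^+ M.
  by rewrite -normrX ger0_norm // exprn_even_ge0 // odd_double.
have key a b : nut beta D hf p q i t (fun rho : {ffun I -> config N S} =>
    (Num.sqrt N%:R * `|Um p q i rho a b|) ^+ M) <= W.
  have -> : nut beta D hf p q i t (fun rho : {ffun I -> config N S} =>
      (Num.sqrt N%:R * `|Um p q i rho a b|) ^+ M) =
      N%:R ^+ m.+1 * nut beta D hf p q i t (fun rho : {ffun I -> config N S} => Um p q i rho a b ^+ M).
    rewrite -nutZ; apply: eq_nut => rho; rewrite exprMn ev; congr (_ * _).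
    by rewrite /M -mul2n exprM sqr_sqrtr.
  have h1 := Um_pow_gronwall I4 i b0 b1 fp m.+1 a b ht.
  have h2 := Um_Uf_pow1 S D hf beta p q i m.+1 a b.
  rewrite !nut_1 in h1 h2.
  have h3 := HC N N0 a b.
  have Nk : 0 < (N%:R : R) ^+ m.+1 by rewrite exprn_gt0 // ltr0n.
  rewrite mulrC -ler_pdivlMr //; apply: (le_trans h1).
  rewrite /W -[leRHS]mulrA; apply: ler_wpM2l; first exact: expR_ge0.
  apply: (le_trans h2); rewrite [leRHS]mulrDl; apply: lerD.
    by rewrite -mulrA; apply: ler_wpM2l; first exact: expR_ge0.
  apply: ler_wpM2l; first by rewrite exprn_ge0 // mulr_ge0.
  by rewrite lef_pV2 ?posrE ?exprn_gt0 ?ltr0n // ler_weXn2l // -addnn leq_addr.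
apply: (@le_trans _ _ (nut beta D hf p q i t (fun rho : {ffun I -> config N S} =>
   2 ^+ M * (1 + (2 ^+ M) ^+ n * \sum_(ab : I * I) (Num.sqrt N%:R * `|Um p q i rho ab.1 ab.2|) ^+ M)))).
  apply: ler_nut => rho.
  have Y1 := Yb_ge1 i rho.
  apply: (@le_trans _ _ (Yb i rho ^+ M)).
    by apply: ler_weXn2l => //; rewrite /M -addnn; exact: leq_trans (leqnSn m) (leq_addr _ _).
  have Z0 (ab : I * I) : 0 <= Num.sqrt N%:R * `|Um p q i rho ab.1 ab.2| by rewrite mulr_ge0.
  rewrite /Yb pair_bigA /=.
  apply: (le_trans (pow_add_le _ _ _)) => //; first by rewrite sumr_ge0.
  rewrite expr1n; apply: ler_wpM2l; first by rewrite exprn_ge0.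
  by rewrite lerD2l; exact: (sum_pow_le_seq _ _ Z0).
rewrite nutZ; apply: ler_wpM2l; first by rewrite exprn_ge0.
rewrite nutD nut_cst lerD2l nutZ; apply: ler_wpM2l; first by rewrite !exprn_ge0.
rewrite nut_sum; apply: ler_sum => ab _; exact: key.
Qed.

End OverlapBounds.

(** * Expansion of products of overlaps at a site *)

(** Each position of the list together with what remains: the first-order terms in the expansion of
    a product. Equal entries are listed once per occurrence. *)
Fixpoint dels (T : Type) (l : seq T) : seq (T * seq T) :=
  if l is c :: l' then (c, l') :: [seq (p.1, c :: p.2) | p <- dels l'] else [::].

Lemma mem_dels (T : eqType) (l : seq T) pr : pr \in dels l ->
  pr.1 \in l /\ {subset pr.2 <= l}.
Proof.
elim: l pr => [|c l IH] pr; first by rewrite in_nil.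
rewrite [dels _]/= in_cons => /orP[/eqP ->|/mapP[pr' h ->]] /=.
  by split=> [|x xl]; [rewrite eqxx|rewrite in_cons xl orbT].
have [h1 h2] := IH pr' h; split=> [|x]; first by rewrite h1 orbT.
by rewrite !in_cons => /orP[->//|/h2 ->]; rewrite orbT.
Qed.

Section Products.
Variables (R : realType) (T : Type) (kap : T -> R).
Hypothesis kap0 : forall c, 0 <= kap c.
Implicit Types (l : seq T) (x z : T -> R) (Y d : R).

Lemma dels_size l : all (fun p => (size p.2).+1 == size l) (dels l).
Proof.
elim: l => //= c l IH; rewrite eqxx /= all_map.
by apply: sub_all IH => p /=; rewrite eqSS.
Qed.

Lemma prod_size_le l x Y d : 0 <= Y * d -> (forall c, `|x c| <= kap c * (Y * d)) ->
  `|\prod_(c <- l) x c| <= (\prod_(c <- l) kap c) * (Y * d) ^+ size l.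
Proof.
move=> Yd hx; elim: l => [|c l IH]; first by rewrite !big_nil normr1 mulr1.
rewrite !big_cons normrM /= exprS mulrACA; exact: ler_pM.
Qed.

(** [x] stands for the cavity overlaps, of size [Y * d] with [d = N ^ (- 1 / 2)] and a random
    envelope [Y]; [z] stands for the share of one site, of size [d ^+ 2]. *)
Definition small_data x z Y d := [/\ 1 <= Y, 0 <= d <= 1,
  forall c, `|x c| <= kap c * (Y * d) & forall c, `|z c| <= kap c * d ^+ 2].

Lemma prod_perturb1 l : exists C, 0 <= C /\ forall x z Y d, small_data x z Y d ->
  `|\prod_(c <- l) (x c + z c) - \prod_(c <- l) x c| <= C * Y ^+ size l * d ^+ (size l).+1.
Proof.
elim: l => [|c l [C [C0 IH]]].
  exists 0; split => // x z Y d _; by rewrite !big_nil subrr normr0 !mul0r.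
pose P := \prod_(c <- l) kap c.
have P0 : 0 <= P by apply: prodr_ge0 => b _.
exists (2 * kap c * C + kap c * P); split.
  by rewrite addr_ge0 ?mulr_ge0.
move=> x z Y d sd; have h := IH x z Y d sd; case: sd => Y1 /andP[d0 d1] hx hz.
have Y0 : 0 <= Y by lra.
have Yd : 0 <= Y * d by rewrite mulr_ge0.
have hP := prod_size_le l Yd hx; rewrite -/P in hP.
rewrite !big_cons.
set A := \prod_(c <- l) (x c + z c) in h *; set B := \prod_(c <- l) x c in h hP *.
have -> : (x c + z c) * A - x c * B = (x c + z c) * (A - B) + z c * B by ring.
have h1 : `|x c + z c| <= 2 * kap c * (Y * d).
  apply: (le_trans (ler_normD _ _)).
  have : kap c * d ^+ 2 <= kap c * (Y * d).
    by apply: ler_wpM2l => //; rewrite expr2; apply: ler_wpM2r => //; lra.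
  have := hx c; have := hz c; lra.
apply: (le_trans (ler_normD _ _)); rewrite !normrM.
apply: (le_trans (lerD (ler_pM _ _ h1 h) (ler_pM _ _ (hz c) hP))) => //.
have e1 : (Y * d) ^+ size l <= Y ^+ (size l).+1 * d ^+ size l.
  rewrite exprMn; apply: ler_wpM2r; first exact: exprn_ge0.
  by rewrite exprS ler_peMl // exprn_ge0.
have e2 : kap c * d ^+ 2 * (P * (Y * d) ^+ size l) <=
   kap c * d ^+ 2 * (P * (Y ^+ (size l).+1 * d ^+ size l)).
  apply: ler_wpM2l; first by rewrite mulr_ge0 // exprn_ge0.
  exact: ler_wpM2l.
apply: (le_trans (lerD (lexx _) e2)).
rewrite le_eqVlt; apply/orP; left; apply/eqP => /=; rewrite !exprS; ring.
Qed.

(** Each [z] put in the place of an [x] gains one power of [d]; once the terms with a single [z] are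
    subtracted, at least two remain. *)
Lemma prod_perturb2 l : exists C, 0 <= C /\ forall x z Y d, small_data x z Y d ->
  `|\prod_(c <- l) (x c + z c) - \prod_(c <- l) x c
    - \sum_(p <- dels l) z p.1 * \prod_(c <- p.2) x c| <= C * Y ^+ size l * d ^+ (size l).+2.
Proof.
elim: l => [|c l [C [C0 IH]]].
  exists 0; split => // x z Y d _; by rewrite !big_nil subrr subr0 normr0 !mul0r.
have [C1 [C10 H1]] := prod_perturb1 l.
exists (kap c * C + kap c * C1); split; first by rewrite addr_ge0 ?mulr_ge0.
move=> x z Y d sd; have h := IH x z Y d sd; have h1 := H1 x z Y d sd.
case: sd => Y1 /andP[d0 d1] hx hz.
have Y0 : 0 <= Y by lra.
rewrite !big_cons /= ?big_cons big_map /=.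
set A := \prod_(c <- l) (x c + z c) in h h1 *; set B := \prod_(c <- l) x c in h h1 *.
set D := \sum_(p <- dels l) _ in h.
have -> : \sum_(p <- dels l) z p.1 * \prod_(b <- c :: p.2) x b = x c * D.
  by rewrite mulr_sumr; apply: eq_bigr => p _; rewrite big_cons; ring.
have -> : (x c + z c) * A - x c * B - (z c * B + x c * D) = x c * (A - B - D) + z c * (A - B) by ring.
apply: (le_trans (ler_normD _ _)); rewrite !normrM.
apply: (le_trans (lerD (ler_pM _ _ (hx c) h) (ler_pM _ _ (hz c) h1))) => //.
have e2 : kap c * d ^+ 2 * (C1 * Y ^+ size l * d ^+ (size l).+1) <=
   kap c * d ^+ 2 * (C1 * Y ^+ (size l).+1 * d ^+ (size l).+1).
  apply: ler_wpM2l; first by rewrite mulr_ge0 // exprn_ge0.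
  apply: ler_wpM2r; first exact: exprn_ge0.
  by apply: ler_wpM2l => //; rewrite exprS ler_peMl // exprn_ge0.
apply: (le_trans (lerD (lexx _) e2)).
rewrite le_eqVlt; apply/orP; left; apply/eqP => /=; rewrite !exprS; ring.
Qed.

End Products.

(** * Orders of magnitude in [N ^ (- 1 / 2)] *)

Section Order.
Variable R : realType.

Definition dlt (N : nat) : R := (Num.sqrt N%:R)^-1.

Lemma dlt_ge0 N : 0 <= dlt N. Proof. by rewrite invr_ge0 sqrtr_ge0. Qed.
Lemma dlt_le1 N : dlt N <= 1.
Proof.
case: N => [|N]; first by rewrite /dlt sqrtr0 invr0.
by rewrite /dlt invf_le1 ?sqrtr_gt0 ?ltr0n // -[leLHS]sqrtr1 ler_wsqrtr // ler1n.
Qed.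
Lemma dlt_sqr N : dlt N ^+ 2 = N%:R^-1.
Proof. by rewrite /dlt exprVn sqr_sqrtr. Qed.

(* Errors of order [N ^ (- m / 2)], uniform in the site and in the position on the path. *)
Definition bigO (m : nat) (f : forall N, 'I_N -> R -> R) := exists C, 0 <= C /\
  forall N (i : 'I_N) t, 0 <= t <= 1 -> `|f N i t| <= C * dlt N ^+ m.

Lemma eq_bigO m (f1 f2 : forall N, 'I_N -> R -> R) : (forall N i t, f1 N i t = f2 N i t) ->
  bigO m f1 -> bigO m f2.
Proof. by move=> H [C [C0 h]]; exists C; split => // N i t ht; rewrite -H; exact: h. Qed.

Lemma bigOD m (f1 f2 : forall N, 'I_N -> R -> R) : bigO m f1 -> bigO m f2 ->
  bigO m (fun N i t => f1 N i t + f2 N i t).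
Proof.
move=> [C [C0 h]] [C' [C0' h']]; exists (C + C'); split; first exact: addr_ge0.
move=> N i t ht; apply: (le_trans (ler_normD _ _)).
by rewrite mulrDl; apply: lerD; [exact: h|exact: h'].
Qed.

Lemma bigOZ m c (f : forall N, 'I_N -> R -> R) : bigO m f -> bigO m (fun N i t => c * f N i t).
Proof.
move=> [C [C0 h]]; exists (`|c| * C); split; first exact: mulr_ge0.
move=> N i t ht; rewrite normrM -mulrA; apply: ler_wpM2l => //; exact: h.
Qed.

Lemma bigO_invn m (f : forall N, 'I_N -> R -> R) : bigO m f ->
  bigO m.+2 (fun N i t => N%:R^-1 * f N i t).
Proof.
move=> [C [C0 h]]; exists C; split => // N i t ht.
rewrite normrM ger0_norm ?invr_ge0 //.
have -> : C * dlt N ^+ m.+2 = N%:R^-1 * (C * dlt N ^+ m) by rewrite -dlt_sqr !exprS; ring.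
rewrite -dlt_sqr.
by apply: ler_wpM2l; [rewrite exprn_ge0 // dlt_ge0|exact: h].
Qed.

Lemma bigO_sum m (T : eqType) (s : seq T) (f : T -> forall N, 'I_N -> R -> R) :
  (forall x, x \in s -> bigO m (f x)) -> bigO m (fun N i t => \sum_(x <- s) f x N i t).
Proof.
elim: s => [|x s IH] H.
  by exists 0; split => // N i t _; rewrite big_nil normr0 mul0r.
have h1 := H x (mem_head _ _).
have h2 : bigO m (fun N i t => \sum_(x <- s) f x N i t).
  by apply: IH => y ys; apply: H; rewrite inE ys orbT.
by apply: eq_bigO (bigOD h1 h2) => N i t; rewrite big_cons.
Qed.

Lemma bigO_at m (f : forall N, 'I_N -> R -> R) (s : R) : 0 <= s <= 1 -> bigO m f ->
  bigO m (fun N i (_ : R) => f N i s).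
Proof. by move=> hs [C [C0 h]]; exists C; split => // N i _ _; exact: h. Qed.

Lemma bigO0 m : bigO m (fun N (_ : 'I_N) (_ : R) => 0).
Proof. by exists 0; split => // N i t _; rewrite normr0 mul0r. Qed.

Lemma bigO_mean m (f : forall N, 'I_N -> R -> R) : bigO m f ->
  bigO m (fun N (_ : 'I_N) t => N%:R^-1 * \sum_(j < N) f N j t).
Proof.
move=> [C [C0 h]]; exists C; split => // N i t ht.
have N0 : (0 < N)%N by apply: leq_ltn_trans (ltn_ord i).
rewrite normrM ger0_norm ?invr_ge0 // ler_pdivrMl ?ltr0n //.
apply: (le_trans (ler_norm_sum _ _ _)); rewrite -sumr_ord_cst.
by apply: ler_sum => j _; exact: h.
Qed.

End Order.

Section Expansion.
Variables (R : realType) (S : nat) (beta D hf p q : R).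
Hypotheses (fp : fixed_point S beta D hf p q).
Variables (I : finType).
Local Notation s2 := (S%:R ^+ 2 : R).
Local Notation X := 'I_(S.*2.+1).
Local Notation nu i t := (@nut R _ S beta D hf p q I i t).
Local Notation NU := (@nuI R _ S beta D hf I).
Local Notation Y := (@Yb R S p q I _).
Let q0 := fp_q0 fp.
Hypothesis HY : forall m, exists C, 0 <= C /\ forall N (i : 'I_N) t, 0 <= t <= 1 ->
  nut beta D hf p q i t (fun rho : {ffun I -> config N S} => Yb p q i rho ^+ m) <= C.

(* Linear forms in the centred overlaps, as lists of weighted pairs of replicas. *)
Definition lform := seq (R * I * I).
Implicit Types (c : lform) (L : seq lform).

Definition Uq N c (rho : {ffun I -> config N S}) : R := \sum_(t <- c) t.1.1 * Uf p q rho t.1.2 t.2.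
Definition Umq N (i : 'I_N) c (rho : {ffun I -> config N S}) : R :=
  \sum_(t <- c) t.1.1 * Um p q i rho t.1.2 t.2.
(* [psq c] is the share of one site in [N%:R * Uq c], and [phq c] is the same share centred under
   the one-site measure. *)
Definition psq c (x : {ffun I -> X}) : R := \sum_(t <- c) t.1.1 * (spin R (x t.1.2) * spin R (x t.2)).
Definition phq c (x : {ffun I -> X}) : R :=
  \sum_(t <- c) t.1.1 * (spin R (x t.1.2) * spin R (x t.2) - Qm p q t.1.2 t.2).
Definition kq c : R := (\sum_(t <- c) `|t.1.1|) * (1 + s2).
Definition supp (J : {set I}) c := all (fun t => (t.1.2 \in J) && (t.2 \in J)) c.

Lemma kq_ge0 c : 0 <= kq c.
Proof. by rewrite mulr_ge0 ?sumr_ge0 // addr_ge0 // sqr_ge0. Qed.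

Lemma Uq_Umq N (i : 'I_N) c rho : Uq c rho = Umq i c rho + N%:R^-1 * psq c (site i rho).
Proof.
rewrite /Uq /Umq /psq mulr_sumr -big_split; apply: eq_bigr => t _ /=.
by rewrite (Uf_Um p q i) !siteE; ring.
Qed.

Lemma Uq_sum N c (rho : {ffun I -> config N S}) : (0 < N)%N ->
  Uq c rho = N%:R^-1 * \sum_(i < N) phq c (site i rho).
Proof.
move=> N0; rewrite /phq exchange_big mulr_sumr; apply: eq_bigr => t _ /=.
rewrite Uf_sum // mulrCA -mulr_sumr; congr (_ * (_ * _)).
by apply: eq_bigr => j _; rewrite !siteE.
Qed.

Lemma psq_bound c x : `|psq c x| <= kq c.
Proof.
apply: (le_trans (ler_norm_sum _ _ _)); rewrite /kq mulr_suml; apply: ler_sum => t _.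
rewrite normrM; apply: ler_wpM2l => //; apply: (le_trans (spin2_bound R _ _)).
by rewrite lerDr.
Qed.

Lemma Umq_bound N (i : 'I_N) c rho : `|Umq i c rho| <= kq c * (Y i rho * dlt R N).
Proof.
apply: (le_trans (ler_norm_sum _ _ _)).
have Yd : 0 <= Y i rho * dlt R N.
  by rewrite mulr_ge0 ?dlt_ge0 // (le_trans ler01) // Yb_ge1.
apply: (@le_trans _ _ ((\sum_(t <- c) `|t.1.1|) * (Y i rho * dlt R N))).
  rewrite mulr_suml; apply: ler_sum => t _; rewrite normrM; apply: ler_wpM2l => //.
  exact: Um_le_Yb.
apply: ler_wpM2r => //; rewrite /kq ler_peMr ?sumr_ge0 //.
by rewrite lerDl sqr_ge0.
Qed.

Lemma small_cav N (i : 'I_N) rho : small_data kq (fun c => Umq i c rho)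
  (fun c => N%:R^-1 * psq c (site i rho)) (Y i rho) (dlt R N).
Proof.
split; first exact: Yb_ge1.
- by rewrite dlt_ge0 dlt_le1.
- by move=> c; exact: Umq_bound.
- move=> c; rewrite normrM ger0_norm ?invr_ge0 // -dlt_sqr mulrC.
  by apply: ler_wpM2r; [rewrite exprn_ge0 // dlt_ge0|exact: psq_bound].
Qed.

Lemma Umq_dep N (i : 'I_N) (J : {set I}) c : supp J c -> dep J (Umq i c).
Proof.
move=> sJ k kJ rho x; rewrite /Umq; apply: eq_big_seq => t tc.
by have /allP/(_ t tc)/andP[h1 h2] := sJ; rewrite (Um_dep _ _ _ _ _ h1 h2 kJ).
Qed.

Lemma prod_dep N (i : 'I_N) (J : {set I}) L : all (supp J) L ->
  dep J (fun rho => \prod_(c <- L) Umq i c rho).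
Proof.
move=> sJ k kJ rho x; apply: eq_big_seq => c cL.
by apply: Umq_dep kJ rho x; exact: (allP sJ).
Qed.

Lemma Umq_updsr N (i : 'I_N) c rho (x : {ffun I -> X}) : Umq i c (updsr i rho x) = Umq i c rho.
Proof. by rewrite /Umq; apply: eq_bigr => t _; rewrite Um_updsr. Qed.

Definition depX (J : {set I}) (phi : {ffun I -> X} -> R) :=
  forall k, k \notin J -> forall x y, phi (updr x k y) = phi x.

Lemma depX_site N (i : 'I_N) (J : {set I}) phi : depX J phi -> dep J (fun rho : {ffun I -> config N S} => phi (site i rho)).
Proof.
move=> H k kJ rho x; rewrite -[RHS](H k kJ _ (x i)); congr phi; apply/ffunP => l.
by rewrite !ffunE; case: ifP.
Qed.

Lemma nut_order m (f : forall N, 'I_N -> {ffun I -> config N S} -> R) C n :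
  (forall N (i : 'I_N) rho, `|f N i rho| <= C * Y i rho ^+ n * dlt R N ^+ m) -> 0 <= C ->
  exists C', 0 <= C' /\ forall N (i : 'I_N) t, 0 <= t <= 1 ->
    nu i t (fun rho => `|f N i rho|) <= C' * dlt R N ^+ m.
Proof.
move=> H C0; have [K [K0 HK]] := HY n.
exists (C * K); split; first exact: mulr_ge0.
move=> N i t ht.
apply: (@le_trans _ _ (nu i t (fun rho => (C * dlt R N ^+ m) * Y i rho ^+ n))).
  by apply: ler_nut => rho; apply: (le_trans (H N i rho)); rewrite mulrAC.
rewrite nutZ mulrAC; apply: ler_wpM2r; first by rewrite exprn_ge0 // dlt_ge0.
by apply: ler_wpM2l => //; exact: HK.
Qed.

Lemma cavker_Yb (J : {set I}) r1 r2 : exists K, 0 <= K /\ forall N (i : 'I_N) rho,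
  `|cavker beta p q i J r1 r2 rho| <= K * (Y i rho * dlt R N).
Proof.
pose K0 := beta ^+ 2 / 2 * (#|J|.+1%:R * #|J|.+2%:R * s2).
have K00 : 0 <= K0.
  apply: mulr_ge0; first by rewrite divr_ge0 // sqr_ge0.
  by apply: mulr_ge0; [exact: mulr_ge0|exact: sqr_ge0].
exists (K0 * (#|I|%:R * #|I|%:R)); split; first by apply: mulr_ge0 => //; exact: mulr_ge0.
move=> N i rho; apply: (le_trans (cavker_bound _ _ _ _ _ _ _ _)).
rewrite -/K0 -[leRHS]mulrA; apply: ler_wpM2l => //; rewrite -[leRHS]mulrA -!sumr_fin_cst.
by apply: ler_sum => a _; apply: ler_sum => b _; exact: Um_le_Yb.
Qed.

(** The kernel is bounded by [Y * d], so any displacement along the path costs one order. *)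
Lemma nut_move (J : {set I}) r1 r2 L phi M : r1 \notin J -> r2 \notin r1 |: J ->
  all (supp J) L -> depX J phi -> (forall x, `|phi x| <= M) ->
  bigO (size L).+1 (fun N i t =>
    nu i t (fun rho : {ffun I -> config N S} => phi (site i rho) * \prod_(c <- L) Umq i c rho) -
    nu i 0 (fun rho => phi (site i rho) * \prod_(c <- L) Umq i c rho)).
Proof.
move=> r1J r2J sJ dphi Mphi.
have M0 : 0 <= M := le_trans (normr_ge0 _) (Mphi [ffun=> ord0]).
have [K [K0 HK]] := cavker_Yb J r1 r2.
pose P := \prod_(c <- L) kq c.
have P0 : 0 <= P by apply: prodr_ge0 => c _; exact: kq_ge0.
pose f N (i : 'I_N) rho := phi (site i rho) * \prod_(c <- L) Umq i c rho.
have MPK : 0 <= M * P * K by apply: mulr_ge0 => //; exact: mulr_ge0.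
have Hf N (i : 'I_N) rho : `|f N i rho * cavker beta p q i J r1 r2 rho| <=
    M * P * K * Y i rho ^+ (size L).+1 * dlt R N ^+ (size L).+1.
  rewrite (normrM (f N i rho)) {1}/f normrM.
  have Yd : 0 <= Y i rho * dlt R N.
    by rewrite mulr_ge0 ?dlt_ge0 // (le_trans ler01) // Yb_ge1.
  have hP := prod_size_le L Yd (fun c => Umq_bound i c rho).
  rewrite -/P in hP.
  have h0 := ler_pM (normr_ge0 _) (normr_ge0 _) (Mphi (site i rho)) hP.
  have h := ler_pM (mulr_ge0 (normr_ge0 _) (normr_ge0 _)) (normr_ge0 _) h0 (HK N i rho).
  apply: (le_trans h).
  rewrite le_eqVlt; apply/orP; left; apply/eqP; rewrite exprMn !exprS; ring.
have [C [C0 HC]] := nut_order Hf MPK.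
have fJ N (i : 'I_N) : dep J (f N i).
  by move=> k kJ rho x; rewrite /f (depX_site i dphi kJ) (prod_dep i sJ kJ).
exists (C + C); split; first exact: addr_ge0.
move=> N i t ht.
have h1 := @nut_diff_le R S beta D hf p q N I i q0 J r1 r2 r1J r2J (f N i) _ (fJ N i) (HC N i).
have h2 := @nut_diff_le_at R S beta D hf p q N I i q0 J r1 r2 r1J r2J (f N i) _ t ht (fJ N i) (HC N i).
rewrite -/(f N i).
move: h1 h2; move: (nu i 1 (f N i)) (nu i 0 (f N i)) (nu i t (f N i)) => x y z h1 h2.
have -> : z - y = (x - y) - (x - z) by ring.
by apply: (le_trans (ler_normB _ _)); rewrite [leRHS]mulrDl lerD.
Qed.

Lemma nut_base (J : {set I}) r1 r2 L : r1 \notin J -> r2 \notin r1 |: J -> all (supp J) L ->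
  bigO (size L).+1 (fun N i (_ : R) =>
    nu i 0 (fun rho : {ffun I -> config N S} => \prod_(c <- L) Umq i c rho) -
    NU (fun rho : {ffun I -> config N S} => \prod_(c <- L) Uq c rho)).
Proof.
move=> r1J r2J sJ.
have d1 : depX J (fun=> 1) by [].
have M1 x : `|(fun _ : {ffun I -> X} => 1 : R) x| <= 1 by rewrite normr1.
have [C [C0 HC]] := nut_move r1J r2J sJ d1 M1.
have [C1 [C10 HC1]] := prod_perturb1 kq_ge0 L.
have H1 N (i : 'I_N) (rho : {ffun I -> config N S}) :
    `|\prod_(c <- L) Uq c rho - \prod_(c <- L) Umq i c rho| <=
    C1 * Y i rho ^+ size L * dlt R N ^+ (size L).+1.
  have -> : \prod_(c <- L) Uq c rho =
      \prod_(c <- L) (Umq i c rho + N%:R^-1 * psq c (site i rho)).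
    by apply: eq_bigr => c _; exact: Uq_Umq.
  exact: HC1 (small_cav i rho).
have [C2 [C20 HC2]] := nut_order H1 C10.
exists (C + C2); split; first exact: addr_ge0.
move=> N i _ _.
have h01 : (0 : R) <= (1 : R) <= (1 : R) by apply/andP; split.
have h1 := HC N i 1 h01.
have h2 : `|nu i 1 (fun rho : {ffun I -> config N S} => \prod_(c <- L) Uq c rho) -
   nu i 1 (fun rho => \prod_(c <- L) Umq i c rho)| <= C2 * dlt R N ^+ (size L).+1.
  by rewrite -nutB; apply: le_trans (HC2 N i 1 h01); apply: ler_norm_nut.
have e t : nu i t (fun rho : {ffun I -> config N S} => 1 * \prod_(c <- L) Umq i c rho) =
    nu i t (fun rho => \prod_(c <- L) Umq i c rho).
  by apply: eq_nut => rho; rewrite mul1r.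
rewrite !e in h1; rewrite nut_1 in h2.
move: h1 h2.
move: (nu i 1 _) (nu i 0 _) (NU _) => x y z h1 h2.
have -> : y - z = - (x - y) - (z - x) by ring.
by apply: (le_trans (ler_normB _ _)); rewrite normrN [leRHS]mulrDl lerD.
Qed.

Lemma nut_decouple N (i : 'I_N) L phi :
  nu i 0 (fun rho : {ffun I -> config N S} => phi (site i rho) * \prod_(c <- L) Umq i c rho) =
  Es beta D hf p q phi * nu i 0 (fun rho => \prod_(c <- L) Umq i c rho).
Proof.
rewrite mulrC -nut_0; first by apply: eq_nut => rho; rewrite mulrC.
by move=> rho x; apply: eq_bigr => c _; exact: Umq_updsr.
Qed.

(** At [t = 0] the site is independent of the cavity overlaps; going there, and returning to full
    overlaps at [t = 1], loses one order each. The error is uniform in [t], as the Taylor estimate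
    will require. *)
Lemma decouple (J : {set I}) r1 r2 L phi M : r1 \notin J -> r2 \notin r1 |: J ->
  all (supp J) L -> depX J phi -> (forall x, `|phi x| <= M) ->
  bigO (size L).+1 (fun N i t =>
    nu i t (fun rho : {ffun I -> config N S} => phi (site i rho) * \prod_(c <- L) Umq i c rho) -
    Es beta D hf p q phi * NU (fun rho : {ffun I -> config N S} => \prod_(c <- L) Uq c rho)).
Proof.
move=> r1J r2J sJ dphi Mphi.
have h1 := nut_move r1J r2J sJ dphi Mphi.
have h2 := bigOZ (Es beta D hf p q phi) (nut_base r1J r2J sJ).
apply: eq_bigO (bigOD h1 h2) => N i t; rewrite nut_decouple.
move: (nu i t _) (nu i 0 _) (NU _) (Es _ _ _ _ _ _) => x y z w; ring.
Qed.

Lemma Es_phq c : Es beta D hf p q (phq c) = 0.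
Proof.
rewrite /phq; elim: c => [|t c IH].
  by rewrite -[RHS](Es_cst S beta D hf p q I 0); apply: eq_Es => x; rewrite big_nil.
rewrite (@eq_Es _ _ _ _ _ _ _ _ _ (fun x => t.1.1 * (spin R (x t.1.2) * spin R (x t.2) - Qm p q t.1.2 t.2) +
  \sum_(j <- c) j.1.1 * (spin R (x j.1.2) * spin R (x j.2) - Qm p q j.1.2 j.2))); last first.
  by move=> x; rewrite big_cons.
rewrite EsD IH addr0 EsZ EsD Es_cst (Es_prod fp) subrr mulr0 //.
Qed.

Lemma phq_bound c x : `|phq c x| <= 2 * kq c.
Proof.
apply: (le_trans (ler_norm_sum _ _ _)); rewrite /kq mulrCA mulr_suml; apply: ler_sum => t _.
rewrite normrM; apply: ler_wpM2l => //; apply: (le_trans (ler_normB _ _)).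
have := spin2_bound R (x t.1.2) (x t.2); have := Qm_bound fp t.1.2 t.2; lra.
Qed.

Lemma depX_spin (J : {set I}) a k x (y : X) : a \in J -> k \notin J ->
  spin R (updr x k y a) = spin R (x a).
Proof. by move=> aJ kJ; rewrite updr_other //; apply: contraNneq kJ => <-. Qed.

Lemma depX_phq (J : {set I}) c : supp J c -> depX J (phq c).
Proof.
move=> sJ k kJ x y; apply: eq_big_seq => t tc.
by have /allP/(_ t tc)/andP[h1 h2] := sJ; rewrite (depX_spin _ _ h1 kJ) (depX_spin _ _ h2 kJ).
Qed.

Lemma depX_psq (J : {set I}) c : supp J c -> depX J (psq c).
Proof.
move=> sJ k kJ x y; apply: eq_big_seq => t tc.
by have /allP/(_ t tc)/andP[h1 h2] := sJ; rewrite (depX_spin _ _ h1 kJ) (depX_spin _ _ h2 kJ).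
Qed.

Section Main.
Variables (J : {set I}) (r1 r2 r3 r4 : I).
Local Notation J2 := (r2 |: (r1 |: J)).
Hypotheses (r1J : r1 \notin J) (r2J : r2 \notin r1 |: J) (r3J : r3 \notin J2) (r4J : r4 \notin r3 |: J2).
Variables (c1 : lform) (L : seq lform).
Hypotheses (sc1 : supp J c1) (sL : all (supp J) L).
Let phi := phq c1.
Let spp (k l : I) (x : {ffun I -> X}) : R := spin R (x k) * spin R (x l).
Let cf (k l : I) : R := beta ^+ 2 / 2 * (wgtJ R J r1 k * wgtJ R (r1 |: J) r2 l).
Let e_ (k l : I) : lform := [:: (1, k, l)].

Lemma supp_sub (A B : {set I}) c : A \subset B -> supp A c -> supp B c.
Proof.
move=> /fintype.subsetP AB; apply: sub_all => t /andP[h1 h2]; by rewrite !AB.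
Qed.

(** The one-site factor [phi] is bounded and stays outside; only the remaining factors are expanded
    around the cavity overlaps. *)
Lemma site_error : bigO (size L).+2 (fun N i (_ : R) =>
  nu i 1 (fun rho : {ffun I -> config N S} => phi (site i rho) * \prod_(c <- L) Uq c rho)
  - nu i 1 (fun rho => phi (site i rho) * \prod_(c <- L) Umq i c rho)
  - \sum_(pr <- dels L) N%:R^-1 * nu i 1 (fun rho => phi (site i rho) * psq pr.1 (site i rho) *
       \prod_(c <- pr.2) Umq i c rho)).
Proof.
have [C1 [C10 HC1]] := prod_perturb2 kq_ge0 L.
have k0 : 0 <= 2 * kq c1 by rewrite mulr_ge0 // kq_ge0.
have kC : 0 <= 2 * kq c1 * C1 by rewrite mulr_ge0.
have H1 N (i : 'I_N) (rho : {ffun I -> config N S}) :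
    `|phi (site i rho) * (\prod_(c <- L) Uq c rho - \prod_(c <- L) Umq i c rho -
      \sum_(pr <- dels L) N%:R^-1 * psq pr.1 (site i rho) * \prod_(c <- pr.2) Umq i c rho)| <=
    2 * kq c1 * C1 * Y i rho ^+ size L * dlt R N ^+ (size L).+2.
  have -> : \prod_(c <- L) Uq c rho =
      \prod_(c <- L) (Umq i c rho + N%:R^-1 * psq c (site i rho)).
    by apply: eq_bigr => c _; exact: Uq_Umq.
  rewrite normrM -2!(mulrA (2 * kq c1)); apply: ler_pM => //; first exact: phq_bound.
  exact: HC1 (small_cav i rho).
have [C2 [C20 HC2]] := nut_order H1 kC.
have h01 : (0 : R) <= (1 : R) <= (1 : R) by apply/andP; split.
exists C2; split => // N i _ _; apply: le_trans (HC2 N i 1 h01).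
under eq_bigr do rewrite -nutZ.
rewrite -nut_sum -!nutB; apply: ler_norm_nut => rho.
rewrite le_eqVlt; apply/orP; left; apply/eqP; congr `|_|.
rewrite !mulrBr; congr (_ - _); rewrite mulr_sumr; apply: eq_bigr => pr _.
move: (phi _) (psq _ _) (\prod_(c <- _) _) => a b d; ring.
Qed.

Lemma dels_error : bigO (size L).+2 (fun N i (_ : R) =>
  \sum_(pr <- dels L) N%:R^-1 * (nu i 1 (fun rho : {ffun I -> config N S} =>
      phi (site i rho) * psq pr.1 (site i rho) * \prod_(c <- pr.2) Umq i c rho)
    - Es beta D hf p q (fun x => phi x * psq pr.1 x) * NU (fun rho : {ffun I -> config N S} =>
        \prod_(c <- pr.2) Uq c rho))).
Proof.
have h01 : (0 : R) <= (1 : R) <= (1 : R) by apply/andP; split.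
apply: bigO_sum => pr prL.
have /allP/(_ pr prL)/eqP <- := dels_size L.
have [m1 m2] := mem_dels prL.
have D1 : all (supp J) pr.2 by apply/allP => c /m2; exact: (allP sL).
have D2 : depX J (fun x => phi x * psq pr.1 x).
  by move=> k kJ x y; rewrite /phi (depX_phq sc1 kJ) (depX_psq (allP sL _ m1) kJ).
have D3 x : `|phi x * psq pr.1 x| <= 2 * kq c1 * kq pr.1.
  by rewrite normrM; apply: ler_pM => //; [exact: phq_bound|exact: psq_bound].
exact: bigO_invn (bigO_at h01 (decouple r1J r2J D1 D2 D3)).
Qed.

(** The kernel is supported on [J2], which contains [r1] and [r2], so decoupling its terms takes the
    second pair [r3], [r4]. Terms with a replica outside [J2] have weight zero. *)
Lemma ker_error : bigO (size L).+2 (fun N i t =>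
  \sum_(kl : I * I) cf kl.1 kl.2 * (nu i t (fun rho : {ffun I -> config N S} =>
      (phi (site i rho) * spp kl.1 kl.2 (site i rho)) * \prod_(c <- e_ kl.1 kl.2 :: L) Umq i c rho)
    - Es beta D hf p q (fun x => phi x * spp kl.1 kl.2 x) * NU (fun rho : {ffun I -> config N S} =>
        \prod_(c <- e_ kl.1 kl.2 :: L) Uq c rho))).
Proof.
apply: bigO_sum => -[k l] _ /=.
have JJ2 : J \subset J2 by apply/fintype.subsetP => x xJ; rewrite !inE xJ !orbT.
have [kJ|kJ] := boolP (k \in J2); last first.
  have -> : cf k l = 0.
    rewrite /cf /wgtJ; move: kJ; rewrite !inE !negb_or => /and3P[_ /negPf -> /negPf ->].
    by rewrite mul0r mulr0.
  by apply: eq_bigO (bigO0 R _) => N i t; rewrite mul0r.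
have [lJ|lJ] := boolP (l \in J2); last first.
  have -> : cf k l = 0.
    rewrite /cf /wgtJ; move: lJ; rewrite !inE !negb_or => /and3P[/negPf -> /negPf -> /negPf ->] /=.
    by rewrite !mulr0.
  by apply: eq_bigO (bigO0 R _) => N i t; rewrite mul0r.
apply: bigOZ.
apply: (@decouple J2 r3 r4 (e_ k l :: L) (fun x => phi x * spp k l x) (2 * kq c1 * s2)) => //.
- rewrite /= kJ lJ /=; apply: sub_all sL => c; exact: supp_sub.
- move=> m mJ x y; rewrite /phi (depX_phq (supp_sub JJ2 sc1) mJ) /spp.
  by rewrite (depX_spin _ _ kJ mJ) (depX_spin _ _ lJ mJ).
- move=> x; rewrite normrM; apply: ler_pM => //; [exact: phq_bound|exact: spin2_bound].
Qed.

Lemma ker_expand N (i : 'I_N) t :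
  nu i t (fun rho : {ffun I -> config N S} => (phi (site i rho) * \prod_(c <- L) Umq i c rho) *
     cavker beta p q i J r1 r2 rho) =
  \sum_(kl : I * I) cf kl.1 kl.2 * nu i t (fun rho : {ffun I -> config N S} =>
      (phi (site i rho) * spp kl.1 kl.2 (site i rho)) * \prod_(c <- e_ kl.1 kl.2 :: L) Umq i c rho).
Proof.
under [RHS]eq_bigr do rewrite -nutZ.
rewrite -nut_sum; apply: eq_nut => rho.
rewrite /cavker pair_bigA /= !mulr_sumr; apply: eq_bigr => -[k l] _ /=.
rewrite big_cons /Umq big_seq1 /= mul1r /cf /spp !siteE.
move: (phi _) (\prod_(c <- L) _) (wgtJ _ _ _ _) (wgtJ _ _ _ _) (Um _ _ _ _ _ _) => a b d e f; ring.
Qed.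

(** The value at [t = 0] vanishes because [phq] is centred, so the derivative there is the leading
    term. Since the kernel error is uniform in [t], it also bounds the variation of the derivative
    along the path. *)
Lemma taylor_error : bigO (size L).+2 (fun N i (_ : R) =>
  nu i 1 (fun rho : {ffun I -> config N S} => phi (site i rho) * \prod_(c <- L) Umq i c rho) -
  \sum_(kl : I * I) cf kl.1 kl.2 * (
    Es beta D hf p q (fun x => phi x * spp kl.1 kl.2 x) * NU (fun rho : {ffun I -> config N S} =>
        \prod_(c <- e_ kl.1 kl.2 :: L) Uq c rho))).
Proof.
have [C [C0 HC]] := ker_error.
have h00 : (0 : R) <= (0 : R) <= (1 : R) by apply/andP; split.
exists (C + C + C); split; first by rewrite !addr_ge0.
move=> N i _ _.
pose f (rho : {ffun I -> config N S}) := phi (site i rho) * \prod_(c <- L) Umq i c rho.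
have fJ : dep J f.
  by move=> k kJ rho x; rewrite /f /phi (depX_site i (depX_phq sc1) kJ) (prod_dep i sL kJ).
pose W := \sum_(kl : I * I) cf kl.1 kl.2 * (
    Es beta D hf p q (fun x => phi x * spp kl.1 kl.2 x) * NU (fun rho : {ffun I -> config N S} =>
        \prod_(c <- e_ kl.1 kl.2 :: L) Uq c rho)).
have HW t : 0 <= t <= 1 -> `|nu i t (fun rho => f rho * cavker beta p q i J r1 r2 rho) - W| <=
    C * dlt R N ^+ (size L).+2.
  move=> ht; rewrite ker_expand /W -sumrB.
  have := HC N i t ht; congr (_ <= _); congr `|_|; apply: eq_bigr => kl _.
  by rewrite mulrBr.
have z0 : nu i 0 f = 0 by rewrite nut_decouple Es_phq mul0r.
have HT t : 0 <= t <= 1 -> `|nu i t (fun rho => f rho * cavker beta p q i J r1 r2 rho) -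
    nu i 0 (fun rho => f rho * cavker beta p q i J r1 r2 rho)| <= (C + C) * dlt R N ^+ (size L).+2.
  move=> ht; have := HW t ht; have := HW 0 h00.
  move: (nu i t _) (nu i 0 _) => x y h1 h2.
  have -> : x - y = (x - W) - (y - W) by ring.
  by apply: (le_trans (ler_normB _ _)); rewrite [leRHS]mulrDl lerD.
have := @nut_taylor_le R S beta D hf p q N I i q0 J r1 r2 r1J r2J f _ fJ HT.
rewrite z0 -/(f _) -/W subr0.
have := HW 0 h00; rewrite -/f.
move: (nu i 1 f) (nu i 0 _) => x y h1 h2.
have -> : x - W = (x - y) + (y - W) by ring.
by apply: (le_trans (ler_normD _ _)); rewrite [leRHS]mulrDl lerD.
Qed.

(** The first factor is the site average of [phq c1], and each site runs its own path. The second
    sum is the share of the site inside the other factors; the third is the derivative of the path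
    at [t = 0]. *)
Lemma expansion : bigO (size L).+2 (fun N (_ : 'I_N) (_ : R) =>
  NU (fun rho : {ffun I -> config N S} => \prod_(c <- c1 :: L) Uq c rho)
  - \sum_(pr <- dels L) N%:R^-1 * (Es beta D hf p q (fun x => phq c1 x * psq pr.1 x) *
      NU (fun rho : {ffun I -> config N S} => \prod_(c <- pr.2) Uq c rho))
  - \sum_(kl : I * I) beta ^+ 2 / 2 * (wgtJ R J r1 kl.1 * wgtJ R (r1 |: J) r2 kl.2) * (
      Es beta D hf p q (fun x => phq c1 x * (spin R (x kl.1) * spin R (x kl.2))) *
      NU (fun rho : {ffun I -> config N S} => \prod_(c <- [:: (1, kl.1, kl.2)] :: L) Uq c rho))).
Proof.
have E := bigO_mean (bigOD (bigOD site_error dels_error) taylor_error).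
case: E => [C [C0 HC]]; exists C; split => // N i t ht.
have N0 : (0 < N)%N by apply: leq_ltn_trans (ltn_ord i).
have Nn : N%:R != 0 :> R by rewrite pnatr_eq0 -lt0n.
set A2 := \sum_(pr <- dels L) _; set A3 := \sum_(kl : I * I) _.
have := HC N i t ht; congr (_ <= _); congr `|_|.
have -> : NU (fun rho : {ffun I -> config N S} => \prod_(c <- c1 :: L) Uq c rho) =
   N%:R^-1 * \sum_(j < N) nu j 1 (fun rho : {ffun I -> config N S} => phi (site j rho) * \prod_(c <- L) Uq c rho).
  under [in RHS]eq_bigr do rewrite nut_1.
  rewrite -(nut_1 beta D hf p q i).
  under [in RHS]eq_bigr do rewrite -(nut_1 beta D hf p q i).
  rewrite -nut_sum -nutZ; apply: eq_nut => rho.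
  by rewrite big_cons Uq_sum // -mulrA mulr_suml.
have -> : A2 = N%:R^-1 * \sum_(j < N) A2 by rewrite sumr_ord_cst mulKf.
have -> : A3 = N%:R^-1 * \sum_(j < N) A3 by rewrite sumr_ord_cst mulKf.
rewrite -!mulrBr -!sumrB; congr (_ * _); apply: eq_bigr => j _.
have -> : \sum_(pr <- dels L) N%:R^-1 * (nu j 1 (fun rho : {ffun I -> config N S} =>
      phi (site j rho) * psq pr.1 (site j rho) * \prod_(c <- pr.2) Umq j c rho)
    - Es beta D hf p q (fun x => phi x * psq pr.1 x) * NU (fun rho : {ffun I -> config N S} =>
        \prod_(c <- pr.2) Uq c rho)) =
   \sum_(pr <- dels L) N%:R^-1 * nu j 1 (fun rho : {ffun I -> config N S} =>
      phi (site j rho) * psq pr.1 (site j rho) * \prod_(c <- pr.2) Umq j c rho) - A2.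
  by rewrite /A2 -sumrB; apply: eq_bigr => pr _; rewrite mulrBr.
rewrite -/A3.
move: A2 A3 (nu j 1 _) (nu j 1 _) (\sum_(pr <- dels L) _) => a2 a3 x y z; ring.
Qed.

End Main.
End Expansion.

(** * The pair factor at a single site *)

Section Quadratic.
Variables (R : realType) (S : nat) (beta D hf p q : R) (I : finType).
Local Notation X := 'I_(S.*2.+1).
Local Notation ES := (@Es R S beta D hf p q I).
Implicit Types (f : {ffun I -> X} -> R) (x : {ffun I -> X}).

Lemma Es_swap f (u v : I) : ES (fun x => f [ffun a => x (tperm u v a)]) = ES f.
Proof.
rewrite /Es; congr gexp; apply/funext => eta; apply: rav_perm => a; exact: tpermK.
Qed.

Lemma Es_antisym f (u v : I) : (forall x, f [ffun a => x (tperm u v a)] = - f x) -> ES f = 0.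
Proof.
move=> H; have := Es_swap f u v.
rewrite (@eq_Es _ _ _ _ _ _ _ _ _ (fun x => -1 * f x)); last by move=> x; rewrite H mulN1r.
by rewrite EsZ; lra.
Qed.

Variables (k r l r' : I).
Hypotheses (kr : k != r) (kl : k != l) (kr' : k != r') (rl : r != l) (rr' : r != r') (lr' : l != r').
Let lk : l != k. Proof. by rewrite eq_sym. Qed.
Let r'k : r' != k. Proof. by rewrite eq_sym. Qed.
Let lr : l != r. Proof. by rewrite eq_sym. Qed.
Let r'r : r' != r. Proof. by rewrite eq_sym. Qed.
Let phi (x : {ffun I -> X}) : R :=
  (spin R (x k) - spin R (x r)) * (spin R (x l) - spin R (x r')).
Let T (a b : I) : R := ES (fun x => phi x * (spin R (x a) * spin R (x b))).

Definition chi (u v a : I) : R := (a == u)%:R - (a == v)%:R.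

Let TC a b : T a b = T b a.
Proof. by apply: eq_Es => x; rewrite (mulrC (spin R (x a))). Qed.

Let swap_kr x : phi [ffun a => x (tperm k r a)] = - phi x.
Proof.
rewrite /phi !ffunE tpermL tpermR !tpermD //; ring.
Qed.
Let swap_lr' x : phi [ffun a => x (tperm l r' a)] = - phi x.
Proof.
rewrite /phi !ffunE tpermL tpermR !tpermD //; ring.
Qed.

Let tpD (u v c : I) : c != u -> c != v -> tperm u v c = c.
Proof. by move=> h1 h2; apply: tpermD; rewrite eq_sym. Qed.

Let T0_kr a b : a != k -> a != r -> b != k -> b != r -> T a b = 0.
Proof.
move=> h1 h2 h3 h4; apply: (@Es_antisym _ k r) => x.
by rewrite swap_kr !ffunE (tpD h1 h2) (tpD h3 h4) mulNr.
Qed.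

Let T0_lr a b : a != l -> a != r' -> b != l -> b != r' -> T a b = 0.
Proof.
move=> h1 h2 h3 h4; apply: (@Es_antisym _ l r') => x.
by rewrite swap_lr' !ffunE (tpD h1 h2) (tpD h3 h4) mulNr.
Qed.

Let T_r b : b != k -> b != r -> T r b = - T k b.
Proof.
move=> h1 h2; rewrite -[T k b](Es_swap _ k r) -mulN1r -EsZ; apply: eq_Es => x.
by rewrite swap_kr !ffunE tpermL (tpD h1 h2) mulN1r mulNr opprK.
Qed.

Let T_r' a : a != l -> a != r' -> T a r' = - T a l.
Proof.
move=> h1 h2; rewrite -[T a l](Es_swap _ l r') -mulN1r -EsZ; apply: eq_Es => x.
by rewrite swap_lr' !ffunE tpermL (tpD h1 h2) mulN1r mulNr opprK.
Qed.

(** Given the field the replicas are independent, and each of the two differences contributes the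
    one-site variance [m2 - m1 ^+ 2]. *)
Let T_kl : T k l = Aconst S beta D hf p q.
Proof.
rewrite /T /Es /Aconst; congr gexp; apply/funext => eta.
rewrite !avg_etaE; set V := siteV _ _ _ _ _ _.
pose sp (y : X) : R := spin R y.
rewrite -[gav V (fun y => spin R y)]/(gav V sp) -[gav V _]/(gav V (fun y => sp y ^+ 2)).
set m1 := gav V sp; set m2 := gav V (fun y => sp y ^+ 2).
have e1 : rav V (fun x : {ffun I -> X} => (sp (x k) - sp (x r)) * sp (x k)) = m2 - m1 ^+ 2.
  rewrite (_ : (fun x : {ffun I -> X} => _) = fun x => sp (x k) ^+ 2 - sp (x k) * sp (x r)); last first.
    by apply/funext => x; ring.
  rewrite /rav gavB -/(rav V _) -/(rav V _) (rav_one ord0 V k (fun y => sp y ^+ 2)) -/m2.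
  rewrite (@rav_mulr _ _ _ ord0 V (fun x : {ffun I -> X} => sp (x k)) r sp); last first.
    by move=> x y; rewrite updr_other.
  by rewrite (rav_one ord0 V k sp) -/m1 expr2.
have e2 : rav V (fun x : {ffun I -> X} => (sp (x k) - sp (x r)) * sp (x k) * sp (x l)) = (m2 - m1 ^+ 2) * m1.
  rewrite (@rav_mulr _ _ _ ord0 V (fun x : {ffun I -> X} => (sp (x k) - sp (x r)) * sp (x k)) l sp) ?e1 //.
  by move=> x y; rewrite !updr_other.
have e3 : rav V (fun x : {ffun I -> X} => (sp (x k) - sp (x r)) * sp (x k) * sp (x l) ^+ 2) = (m2 - m1 ^+ 2) * m2.
  rewrite (@rav_mulr _ _ _ ord0 V (fun x : {ffun I -> X} => (sp (x k) - sp (x r)) * sp (x k)) l (fun y => sp y ^+ 2)) ?e1 //.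
  by move=> x y; rewrite !updr_other.
have e4 : rav V (fun x : {ffun I -> X} => (sp (x k) - sp (x r)) * sp (x k) * sp (x l) * sp (x r')) = (m2 - m1 ^+ 2) * m1 * m1.
  rewrite (@rav_mulr _ _ _ ord0 V (fun x : {ffun I -> X} => (sp (x k) - sp (x r)) * sp (x k) * sp (x l)) r' sp) ?e2 //.
  by move=> x y; rewrite !updr_other.
rewrite (_ : (fun x : {ffun I -> X} => _) = fun x => (sp (x k) - sp (x r)) * sp (x k) * sp (x l) ^+ 2 -
   (sp (x k) - sp (x r)) * sp (x k) * sp (x l) * sp (x r')); last first.
  by apply/funext => x; rewrite /phi /sp; ring.
rewrite /rav gavB -/(rav V _) -/(rav V _) e3 e4; ring.
Qed.

Let T_cross a b : (a == k) || (a == r) -> (b == l) || (b == r') ->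
  T a b = Aconst S beta D hf p q * (chi k r a * chi l r' b).
Proof.
have kl' := kl; have rl' := rl.
have [E1 E2] : T k r' = - T k l /\ T r l = - T k l.
  by split; [apply: T_r' => //|apply: T_r => //; rewrite eq_sym].
have E3 : T r r' = T k l by rewrite T_r ?E1 ?opprK // eq_sym.
rewrite /chi => /orP[/eqP ->|/eqP ->] /orP[/eqP ->|/eqP ->].
- by rewrite T_kl !eqxx (negPf kr) (negPf lr') !subr0 !mulr1.
- by rewrite E1 T_kl !eqxx (negPf kr) [r' == l]eq_sym (negPf lr') subr0 sub0r mulrN mul1r mulrN1.
- by rewrite E2 T_kl !eqxx [r == k]eq_sym (negPf kr) (negPf lr') subr0 sub0r mulr1 mulrN1.
- by rewrite E3 T_kl !eqxx [r == k]eq_sym (negPf kr) [r' == l]eq_sym (negPf lr') !sub0r mulrNN !mulr1.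
Qed.

(** [phi] changes sign when [k] and [r] are exchanged, and also when [l] and [r'] are, while [ES] is
    invariant. A product fixed by one of these swaps averages to zero, so one index lies in [{k, r}]
    and the other in [{l, r'}]; [chi] records the signs. *)
Lemma Es_quad a b : ES (fun x => phi x * (spin R (x a) * spin R (x b))) =
  Aconst S beta D hf p q * (chi k r a * chi l r' b + chi k r b * chi l r' a).
Proof.
rewrite -/(T a b).
have chi0 u v c : c != u -> c != v -> chi u v c = 0.
  by move=> /negPf h1 /negPf h2; rewrite /chi h1 h2 subrr.
have disj c : (c == k) || (c == r) -> chi l r' c = 0.
  by case/orP => /eqP ->; apply: chi0.
have disj' c : (c == l) || (c == r') -> chi k r c = 0.
  by case/orP => /eqP ->; apply: chi0; rewrite eq_sym.
have [aK|aK] := boolP ((a == k) || (a == r)).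
  have [bL|bL] := boolP ((b == l) || (b == r')).
    by rewrite T_cross // (disj' b bL) mul0r addr0.
  move: bL; rewrite negb_or => /andP[b1 b2].
  rewrite (chi0 l r' b) // mulr0 (disj a aK) mulr0 addr0 mulr0.
  by case/orP: aK => /eqP ->; apply: T0_lr.
have [bK|bK] := boolP ((b == k) || (b == r)).
  have [aL|aL] := boolP ((a == l) || (a == r')).
    by rewrite TC T_cross // (disj' a aL) mul0r add0r.
  move: aL; rewrite negb_or => /andP[a1 a2].
  rewrite (chi0 l r' a) // mulr0 (disj b bK) mulr0 addr0 mulr0.
  by case/orP: bK => /eqP ->; apply: T0_lr.
move: aK bK; rewrite !negb_or => /andP[a1 a2] /andP[b1 b2].
by rewrite T0_kr // (chi0 k r a) // (chi0 k r b) // !mul0r addr0 mulr0.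
Qed.

End Quadratic.

(** * Factors as linear forms in overlaps of fresh replicas *)

Section Fresh.
Variables (R : realType) (S n m : nat).

(* Factor types: [inl (k, l)] is [T_{k,l}]; [inr (Some k, false)] is [T_k], [inr (None, false)] is [T];
   [inr (Some k, true)] is [S_k], [inr (None, true)] is [S]. *)
Definition factor_type := (('I_n * 'I_n) + (option 'I_n * bool))%type.
(* Besides the given replicas: two per factor for the centrings, and four that the site expansion
   consumes. *)
Definition Rep := ('I_n + ('I_m * bool + 'I_4))%type.

Definition old (k : 'I_n) : Rep := inl k.
Definition fresh (v : 'I_m) (b : bool) : Rep := inr (inl (v, b)).
Definition spare (j : 'I_4) : Rep := inr (inr j).

(* Each centring [- b_i] is replaced by a fresh replica. *)
Definition factor_form (x : factor_type * 'I_m) : lform R Rep :=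
  let r := fresh x.2 false in let r' := fresh x.2 true in
  match x.1 with
  | inl (k, l) => [:: (1, old k, old l); (-1, old k, r'); (-1, r, old l); (1, r, r')]
  | inr (Some k, false) => [:: (1, old k, r'); (-1, r, r')]
  | inr (None, false) => [:: (1, r, r')]
  | inr (Some k, true) => [:: (1, old k, old k); (-1, r, r)]
  | inr (None, true) => [:: (1, r, r)]
  end.

Definition good (ty : factor_type) : bool := if ty is inl (k, l) then k != l else true.

Definition factor_value N (b bt : 'I_N -> R) (q p : R) (rho : {ffun 'I_n -> config N S}) (ty : factor_type) : R :=
  match ty with
  | inl (k, l) => Tkl b rho k l
  | inr (Some k, false) => Tk b rho k
  | inr (None, false) => Tq b q
  | inr (Some k, true) => Sk bt rho k
  | inr (None, true) => Sp bt p
  end.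

Section Given.
Variables (N : nat) (p q : R) (U : config N S -> R).
Local Notation O := (config N S).
Let o : O := [ffun=> ord0].
Implicit Types (rho : {ffun Rep -> O}).
Let b (i : 'I_N) : R := gav U (fun s : O => spin R (s i)).
Let bt (i : 'I_N) : R := gav U (fun s : O => spin R (s i) ^+ 2).
Definition res rho : {ffun 'I_n -> O} := [ffun k => rho (inl k)].
Local Notation UQ := (@Uq R S p q Rep N).

Lemma Uf_upd rho r x (c d : Rep) : c != r -> d != r ->
  Uf p q (updr rho r x) c d = Uf p q rho c d.
Proof. by move=> h1 h2; rewrite /Uf !updr_other. Qed.

Lemma Uq_upd rho (x : factor_type * 'I_m) v e y : x.2 != v ->
  UQ (factor_form x) (updr rho (fresh v e) y) = UQ (factor_form x) rho.
Proof.
move=> xv; rewrite /Uq; apply: eq_big_seq => t.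
have h k : old k != fresh v e by [].
have h' e' : fresh x.2 e' != fresh v e by apply: contraNneq xv => -[->].
case: x xv h' => -[[k l]|[[k|] []]] w xv h' /=; rewrite !inE;
  do ?[case/orP]; by move/eqP => -> /=; rewrite Uf_upd.
Qed.

Lemma gav_subl a (f : O -> R) : gav U (fun s => a - f s) = a - gav U f.
Proof. by rewrite gavB (gav_cst o). Qed.

Lemma gav_mulr (f : O -> R) a : gav U (fun s => f s * a) = gav U f * a.
Proof. by rewrite mulrC -gavZ; apply: eq_gav => s; rewrite mulrC. Qed.

Lemma rav_resample2 (F : {ffun Rep -> O} -> R) (r r' : Rep) :
  rav U F = rav U (fun rho => gav U (fun y => gav U (fun x => F (updr (updr rho r' y) r x)))).
Proof. by rewrite (rav_resample o U F r) (rav_resample o U _ r'). Qed.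

(** Averaging a fresh replica puts its Gibbs mean in the place of its spin, or the mean square in
    the place of the square. Both fresh replicas are redrawn for every type, so that one statement
    serves all; where a form reads only one, the other average is trivial. *)
Lemma fresh_mean rho (x : factor_type * 'I_m) : good x.1 ->
  gav U (fun z : O => gav U (fun y : O => UQ (factor_form x)
     (updr (updr rho (fresh x.2 true) z) (fresh x.2 false) y))) =
  factor_value b bt q p (res rho) x.1.
Proof.
case: x => -[[k l]|[[k|] []]] w /= gx; set r := fresh w false; set r' := fresh w true.
all: have rr' : r' != r by apply/negP => /eqP [].
all: have frr : (fresh w false == fresh w true) = false by rewrite eq_sym (negPf rr').
all: have e1 (y z : O) : updr (updr rho r' z) r y r = y by rewrite updr_same.
all: have e2 (y z : O) : updr (updr rho r' z) r y r' = z by rewrite updr_other // updr_same.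
all: have e3 (y z : O) h : updr (updr rho r' z) r y (old h) = rho (old h) by rewrite !updr_other.
- rewrite (eq_gav _ (f2 := fun z : O => gav U (fun y : O => N%:R^-1 * \sum_(j < N)
     (spin R (rho (old k) j) - spin R (y j)) * (spin R (rho (old l) j) - spin R (z j))))); last first.
    move=> z; apply: eq_gav => y; rewrite /Uq !big_cons big_nil /= /Uf /Qm.
    rewrite (_ : (old k == old l) = false); last by apply/negP => /eqP[e]; rewrite e eqxx in gx.
    rewrite /= !mul1r !mulN1r addr0 !e1 !e2 !e3.
    transitivity (N%:R^-1 * (\sum_(j < N) spin R (rho (old k) j) * spin R (rho (old l) j)
      - \sum_(j < N) spin R (rho (old k) j) * spin R (z j)
      - \sum_(j < N) spin R (y j) * spin R (rho (old l) j) + \sum_(j < N) spin R (y j) * spin R (z j))).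
      rewrite frr; ring.
    rewrite -!sumrB -big_split; congr (_ * _); apply: eq_bigr => j _ /=; ring.
  rewrite /Tkl (eq_gav _ (f2 := fun z : O => N%:R^-1 * \sum_(j < N)
     (spin R (rho (old k) j) - b j) * (spin R (rho (old l) j) - spin R (z j)))); last first.
    move=> z; rewrite gavZ gav_sum; congr (_ * _); apply: eq_bigr => j _.
    by rewrite gav_mulr gav_subl.
  rewrite gavZ gav_sum; congr (_ * _); apply: eq_bigr => j _.
  by rewrite gavZ gav_subl !ffunE.
- rewrite (eq_gav _ (f2 := fun z : O => gav U (fun y : O => N%:R^-1 * \sum_(j < N)
     (spin R (rho (old k) j) ^+ 2 - spin R (y j) ^+ 2)))); last first.
    move=> z; apply: eq_gav => y; rewrite /Uq !big_cons big_nil /= /Uf /Qm !eqxx.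
    rewrite /= !mul1r !mulN1r addr0 !e1 !e3.
    transitivity (N%:R^-1 * (\sum_(j < N) spin R (rho (old k) j) * spin R (rho (old k) j)
      - \sum_(j < N) spin R (y j) * spin R (y j))); first by ring.
    by rewrite -!sumrB.
  rewrite (gav_cst o) gavZ gav_sum; congr (_ * _); apply: eq_bigr => j _.
  by rewrite gav_subl ffunE.
- rewrite (eq_gav _ (f2 := fun z : O => gav U (fun y : O => N%:R^-1 * \sum_(j < N)
     (spin R (rho (old k) j) - spin R (y j)) * spin R (z j)))); last first.
    move=> z; apply: eq_gav => y; rewrite /Uq !big_cons big_nil /= /Uf /Qm.
    rewrite frr /= !mul1r !mulN1r addr0 !e1 !e2 !e3.
    transitivity (N%:R^-1 * (\sum_(j < N) spin R (rho (old k) j) * spin R (z j)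
      - \sum_(j < N) spin R (y j) * spin R (z j))); first by ring.
    by rewrite -!sumrB; congr (_ * _); apply: eq_bigr => j _ /=; ring.
  rewrite (eq_gav _ (f2 := fun z : O => N%:R^-1 * \sum_(j < N)
     (spin R (rho (old k) j) - b j) * spin R (z j))); last first.
    move=> z; rewrite gavZ gav_sum; congr (_ * _); apply: eq_bigr => j _.
    by rewrite gav_mulr gav_subl.
  rewrite gavZ gav_sum; congr (_ * _); apply: eq_bigr => j _.
  by rewrite gavZ ffunE.
- rewrite (eq_gav _ (f2 := fun z : O => gav U (fun y : O => N%:R^-1 * (\sum_(j < N) spin R (y j) ^+ 2) - p))); last first.
    by move=> z; apply: eq_gav => y; rewrite /Uq !big_cons big_nil /= /Uf /Qm !eqxx mul1r addr0 !e1.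
  rewrite (gav_cst o) gavB (gav_cst o) gavZ gav_sum //.
- rewrite (eq_gav _ (f2 := fun z : O => gav U (fun y : O => N%:R^-1 * (\sum_(j < N) spin R (y j) * spin R (z j)) - q))); last first.
    move=> z; apply: eq_gav => y; rewrite /Uq !big_cons big_nil /= /Uf /Qm.
    by rewrite frr mul1r addr0 !e1 !e2.
  rewrite (eq_gav _ (f2 := fun z : O => N%:R^-1 * (\sum_(j < N) b j * spin R (z j)) - q)); last first.
    move=> z; rewrite gavB (gav_cst o) gavZ gav_sum; congr (_ * _ - _); apply: eq_bigr => j _.
    by rewrite gav_mulr.
  rewrite gavB (gav_cst o) gavZ gav_sum /Tq; congr (_ * _ - _); apply: eq_bigr => j _.
  by rewrite gavZ expr2.
Qed.

Lemma res_upd rho v e y : res (updr rho (fresh v e) y) = res rho.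
Proof. by apply/ffunP => k; rewrite !ffunE. Qed.

(** Distinct labels give disjoint fresh replicas. The form of the head is absorbed into [H] while
    the tail is averaged, and is averaged last. *)
Lemma rav_fresh (L : seq (factor_type * 'I_m)) (H : {ffun Rep -> O} -> R) :
  uniq (map snd L) -> all (fun x => good x.1) L ->
  (forall v e rho y, v \in map snd L -> H (updr rho (fresh v e) y) = H rho) ->
  rav U (fun rho => H rho * \prod_(x <- L) UQ (factor_form x) rho) =
  rav U (fun rho => H rho * \prod_(x <- L) factor_value b bt q p (res rho) x.1).
Proof.
elim: L H => [|x L IH] H /=; first by move=> _ _ _; apply: eq_gav => rho; rewrite !big_nil.
move=> /andP[xL uL] /andP[gx gL] HH.
transitivity (rav U (fun rho => (H rho * UQ (factor_form x) rho) * \prod_(x <- L) UQ (factor_form x) rho)).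
  by apply: eq_gav => rho; rewrite big_cons mulrA.
rewrite IH //; last first.
  move=> v e rho y vL; rewrite HH ?inE ?vL ?orbT // Uq_upd //.
  by apply: contraNneq xL => ->.
rewrite (rav_resample2 _ (fresh x.2 false) (fresh x.2 true)).
apply: eq_gav => rho.
rewrite (eq_gav _ (f2 := fun z => (H rho * \prod_(x <- L) factor_value b bt q p (res rho) x.1) *
   gav U (fun y => UQ (factor_form x) (updr (updr rho (fresh x.2 true) z) (fresh x.2 false) y)))); last first.
  move=> z; rewrite -gavZ; apply: eq_gav => y.
  by rewrite !res_upd !HH ?mem_head // mulrAC.
by rewrite gavZ fresh_mean // big_cons mulrAC mulrA.
Qed.

End Given.

Lemma bmagE N beta D hf (g : disorder R) (i : 'I_N) :
  bmag S beta D hf g i = gav (hamil beta D hf g) (fun s : config N S => spin R (s i)).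
Proof.
by rewrite /bmag gibbs_avgE (rav_one [ffun=> ord0] _ ord0 (fun s : config N S => spin R (s i))).
Qed.

Lemma bmag2E N beta D hf (g : disorder R) (i : 'I_N) :
  bmag2 S beta D hf g i = gav (hamil beta D hf g) (fun s : config N S => spin R (s i) ^+ 2).
Proof.
by rewrite /bmag2 gibbs_avgE (rav_one [ffun=> ord0] _ ord0 (fun s : config N S => spin R (s i) ^+ 2)).
Qed.

Definition factor_avg N beta D hf p q (T : seq factor_type) : R :=
  nu beta D hf (fun g (rho : {ffun 'I_n -> config N S}) => \prod_(ty <- T)
    factor_value (fun i : 'I_N => bmag S beta D hf g i) (fun i => bmag2 S beta D hf g i) q p rho ty).

(** The centrings depend on the disorder through Gibbs averages; on the right they are gone, and
    what remains is a product of overlaps to which the site expansion applies. The left side retains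
    only the types, not the labels. *)
Lemma factor_avg_forms N beta D hf p q (L : seq (factor_type * 'I_m)) :
  uniq (map snd L) -> all (fun x => good x.1) L ->
  factor_avg N beta D hf p q (map fst L) =
  nuI beta D hf (fun rho : {ffun Rep -> config N S} => \prod_(c <- map factor_form L) Uq p q c rho).
Proof.
move=> uL gL; rewrite /factor_avg /nu /nuI /Edis; apply: eq_Eiter => g.
rewrite gibbs_avgE; set U := hamil beta D hf g.
transitivity (rav U (fun rho : {ffun Rep -> config N S} => 1 * \prod_(x <- L) Uq p q (factor_form x) rho)); last first.
  by apply: eq_gav => rho; rewrite big_map mul1r.
rewrite (@rav_fresh N p q U L (fun=> 1) uL gL (fun _ _ _ _ _ => erefl)).
rewrite -[LHS](@rav_restrict R _ _ ('I_m * bool + 'I_4)%type [ffun=> ord0] U).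
apply: eq_gav => rho; rewrite mul1r big_map; apply: eq_bigr => x _.
congr factor_value; apply/funext => j; [exact: bmagE|exact: bmag2E].
Qed.

End Fresh.

(** * Moments of the standard Gaussian *)

Section Moments.
Variable R : realType.

Lemma lipexp_exprn n : lipexp (gaugeR R) (fun x : R => x ^+ n).
Proof.
elim: n => [|n IH]; first exact: lipexp_cst.
have Lx : lipexp (gaugeR R) id by apply: (@lipexp_lip _ _ _ _ 1) => // x y; rewrite mul1r.
by have := lipexpM Lx IH; congr lipexp; apply/funext => x; rewrite exprS.
Qed.

Lemma norm_exprn_le (x : R) n : `|x| ^+ n <= expR (n%:R * `|x|).
Proof.
rewrite expRM_natl; apply: lerXn2r; rewrite ?nnegrE ?expR_ge0 //.
by apply: le_trans (expR_ge1Dx _); rewrite lerDr.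
Qed.

(** Supplies, for monomials, the quantitative Taylor hypothesis of [gexp_ibp], by induction through
    multiplication by [x + h]. *)
Lemma exprn_taylor n : exists C : R, 0 <= C /\ forall x h : R, `|h| <= 1 ->
  `|(x + h) ^+ n.+1 - x ^+ n.+1 - h * (n.+1%:R * x ^+ n)| <= C * h ^+ 2 * expR (n.+1%:R * `|x|).
Proof.
elim: n => [|n [C [C0 IH]]].
  exists 0; split => // x h _; rewrite !expr1 expr0 !mulr1 (_ : x + h - x - h = 0) ?normr0 ?mul0r //; ring.
exists (C + n.+1%:R); split=> [|x h h1]; first by rewrite addr_ge0.
have -> : (x + h) ^+ n.+2 - x ^+ n.+2 - h * (n.+2%:R * x ^+ n.+1) =
  (x + h) * ((x + h) ^+ n.+1 - x ^+ n.+1 - h * (n.+1%:R * x ^+ n)) + h ^+ 2 * (n.+1%:R * x ^+ n).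
  rewrite !(exprS _ n.+1) -[n.+2%:R]natr1 [x ^+ n.+1]exprS; move: (n.+1%:R) ((x + h) ^+ n.+1) (x ^+ n) => a b c; ring.
have xe : `|x + h| <= expR `|x|.
  apply: le_trans (expR_ge1Dx _); apply: le_trans (ler_normD _ _) _; by rewrite addrC lerD.
apply: le_trans (ler_normD _ _) _.
have -> : (C + n.+1%:R) * h ^+ 2 * expR (n.+2%:R * `|x|) =
    C * h ^+ 2 * expR (n.+2%:R * `|x|) + h ^+ 2 * (n.+1%:R * expR (n.+2%:R * `|x|)).
  by move: (n.+1%:R) (expR _) => a b; ring.
apply: lerD.
  rewrite normrM; apply: le_trans (ler_pM _ _ xe (IH x h h1)) _ => //.
  by rewrite -[n.+2%:R]natr1 mulrDl mul1r expRD mulrCA [expR `|x| * _]mulrC.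
rewrite normrM (ger0_norm (sqr_ge0 h)) normrM normrX ger0_norm //.
apply: ler_wpM2l; first exact: sqr_ge0.
apply: ler_wpM2l => //.
apply: le_trans (norm_exprn_le x n) _.
by rewrite ler_expR; apply: ler_wpM2r => //; rewrite ler_nat ltnW.
Qed.

Lemma gmoment0 : gmoment R 0 = 1.
Proof. exact: gexp_cst. Qed.

Lemma gmoment1 : gmoment R 1 = 0.
Proof.
have L0 c : lipexp (gaugeR R) (fun=> c) by exact: lipexp_cst.
transitivity (gexp (fun x : R => x * 1)).
  by congr gexp; apply/funext => x; rewrite mulr1.
rewrite (@gexp_ibp _ (fun=> 1) (fun=> 0) 0 0) ?gexp_cst //.
by move=> x h _; rewrite subrr mulr0 subr0 normr0 !mul0r.
Qed.

Lemma gmomentSS n : gmoment R n.+2 = n.+1%:R * gmoment R n.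
Proof.
have [C [C0 H]] := exprn_taylor n.
transitivity (gexp (fun x : R => x * x ^+ n.+1)).
  by congr gexp; apply/funext => x; rewrite exprS.
rewrite (@gexp_ibp _ (fun x => x ^+ n.+1) (fun x => n.+1%:R * x ^+ n) C n.+1%:R) //.
- by rewrite gexpZ //; exact: lipexp_exprn.
- exact: lipexp_exprn.
- by apply: lipexpZ; exact: lipexp_exprn.
Qed.

End Moments.

(** * Deletions from a list *)

Section DelsCombinatorics.

Lemma dels_map (T T' : Type) (f : T -> T') l :
  dels (map f l) = [seq (f pr.1, map f pr.2) | pr <- dels l].
Proof.
elim: l => //= c l ->; congr (_ :: _); rewrite -!map_comp; exact: eq_map.
Qed.

Lemma dels_subseq (T : eqType) (l : seq T) pr : pr \in dels l -> subseq pr.2 l.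
Proof.
elim: l pr => [|c l IH] pr; first by rewrite in_nil.
rewrite [dels _]/= in_cons => /orP[/eqP ->|/mapP[pr' h ->]] /=.
  exact: subseq_cons.
by rewrite eqxx IH.
Qed.

(** Deleting any occurrence of [c] leaves the same multiset, so all the terms coincide. *)
Lemma sum_dels (R : realType) (T : eqType) (c : T) (l : seq T) (F : seq T -> R) :
  (forall l1 l2, perm_eq l1 l2 -> F l1 = F l2) ->
  \sum_(pr <- dels l | pr.1 == c) F pr.2 = (count_mem c l)%:R * F (rem c l).
Proof.
elim: l F => [|x l IH] F HF; first by rewrite big_nil mul0r.
rewrite [dels _]/= big_cons big_map /= (IH (fun l' => F (x :: l'))); last first.
  by move=> l1 l2 h; apply: HF; rewrite perm_cons.
have [->|xc] := eqVneq x c; last by rewrite /= add0n.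
have [cl|cl] := boolP (c \in l).
  by rewrite /= -(HF _ _ (perm_to_rem cl)) natrD mulrDl mul1r.
by rewrite (count_memPn cl) mul0r addr0 mul1r.
Qed.

End DelsCombinatorics.

(** * Recursion on the number of pair factors *)

Section Recursion.
Variables (R : realType) (S n m : nat) (beta D hf p q : R).
Hypothesis fp : fixed_point S beta D hf p q.
Local Notation rep := (Rep n m).
Local Notation A := (Aconst S beta D hf p q).
Local Notation ES := (@Es R S beta D hf p q rep).
Local Notation NU := (@nuI R _ S beta D hf rep).
Local Notation VNN N := (@factor_avg R S n N beta D hf p q).
Local Notation LF := (@factor_form R n m).
Hypothesis HY : forall j, exists C, 0 <= C /\ forall N (i : 'I_N) t, 0 <= t <= 1 ->
  nut beta D hf p q i t (fun rho : {ffun rep -> config N S} => Yb p q i rho ^+ j) <= C.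
Local Notation X := 'I_(S.*2.+1).
Implicit Types (x : {ffun rep -> X}).

(* Only unordered pairs of replicas occur, listed with [k < l]. *)
Definition ordered (ty : factor_type n) : bool := if ty is inl (k, l) then (k < l)%N else true.

Lemma ordered_good ty : ordered ty -> good ty.
Proof. by case: ty => // -[k l] /= kl; apply: contraTneq kl => ->; rewrite ltnn. Qed.

Lemma Es_lin (c : lform R rep) (g : R * rep * rep -> {ffun rep -> X} -> R) :
  ES (fun x => \sum_(t <- c) t.1.1 * g t x) = \sum_(t <- c) t.1.1 * ES (g t).
Proof.
elim: c => [|t c IH].
  rewrite big_nil -[RHS](Es_cst S beta D hf p q rep 0).
  by apply: eq_Es => x; rewrite big_nil.
rewrite big_cons -IH -EsZ -EsD; apply: eq_Es => x; exact: big_cons.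
Qed.

Section Pair.
Variables (k l : 'I_n) (v : 'I_m).
Hypothesis kl : (k < l)%N.
Let K : rep := old m k.
Let L_ : rep := old m l.
Let r : rep := fresh n v false.
Let r' : rep := fresh n v true.
Let c1 := LF (inl (k, l), v).
Let knl : k != l. Proof. by apply: contraTneq kl => ->; rewrite ltnn. Qed.
Let KL : K != L_. Proof. by apply: contra knl => /eqP[->]. Qed.
Let rr' : r != r'. Proof. by apply/negP => /eqP[]. Qed.

Definition quad (a b : rep) : R := chi R K r a * chi R L_ r' b + chi R K r b * chi R L_ r' a.

Lemma phq_pair x : phq p q c1 x = (spin R (x K) - spin R (x r)) * (spin R (x L_) - spin R (x r')).
Proof.
rewrite /phq !big_cons big_nil /= /Qm (negPf KL) (negPf rr') /=; ring.
Qed.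

Lemma Es_pair a b : ES (fun x => phq p q c1 x * (spin R (x a) * spin R (x b))) = A * quad a b.
Proof.
rewrite (@eq_Es _ _ _ _ _ _ _ _ _ (fun x => (spin R (x K) - spin R (x r)) *
  (spin R (x L_) - spin R (x r')) * (spin R (x a) * spin R (x b)))) ?Es_quad //.
by move=> x; rewrite phq_pair.
Qed.

(** With another label the fresh replicas of [u] differ from those of the pair, and [chi] vanishes
    on them. Only a product of two old replicas can contribute, and they must be [k] and [l]. *)
Lemma Es_pair_psq (u : factor_type n * 'I_m) : ordered u.1 -> u.2 != v ->
  ES (fun x => phq p q c1 x * psq (LF u) x) = A * (u.1 == inl (k, l))%:R.
Proof.
move=> ou uv.
have -> : ES (fun x => phq p q c1 x * psq (LF u) x) = \sum_(t <- LF u) t.1.1 * (A * quad t.1.2 t.2).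
  under [RHS]eq_bigr do rewrite -Es_pair.
  rewrite -(Es_lin _ (fun t x => phq p q c1 x * (spin R (x t.1.2) * spin R (x t.2)))).
  by apply: eq_Es => x; rewrite /psq mulr_sumr; apply: eq_bigr => t _; ring.
have cf e : chi R K r (fresh n u.2 e) = 0.
  have h : (fresh n u.2 e == r) = false by apply/negP => /eqP[e1 _]; rewrite e1 eqxx in uv.
  by rewrite /chi h subrr.
have cf' e : chi R L_ r' (fresh n u.2 e) = 0.
  have h : (fresh n u.2 e == r') = false by apply/negP => /eqP[e1 _]; rewrite e1 eqxx in uv.
  by rewrite /chi h subrr.
have ck j : chi R K r (old m j) = (j == k)%:R by rewrite /chi subr0.
have cl j : chi R L_ r' (old m j) = (j == l)%:R by rewrite /chi subr0.
case: u ou uv cf cf' => -[[k' l']|[[k'|] []]] w /= ou uv cf cf'; rewrite !big_cons big_nil /= /quad ?ck ?cl ?cf ?cf'.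
- rewrite (_ : (inl (k', l') == inl (k, l) :> factor_type n) = (k' == k) && (l' == l)) //.
  (* The reversed pair is excluded by the ordering of both pairs. *)
  have z : ((l' == k)%:R * (k' == l)%:R : R) = 0.
    case: eqP => [e1|_]; last by rewrite mul0r.
    case: eqP => [e2|_]; last by rewrite mulr0.
    by move: ou; rewrite e1 e2 ltnNge ltnW.
  rewrite z !mulr0 !mul0r !addr0 !mulr0 mul1r !addr0 -natrM mulnb //.
(* The square in [S_{k'}] would need [k'] to be [k] and [l] at once. *)
- have z : ((k' == k)%:R * (k' == l)%:R : R) = 0.
    by case: eqP => [->|_]; rewrite ?mul0r // (negPf knl) mulr0.
  by rewrite z !mulr0 !addr0 !mulr0 addr0.
- by rewrite !mulr0 !mul0r !addr0 !mulr0 !addr0.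
- by rewrite !mulr0 !addr0 !mulr0.
- by rewrite !mulr0 !addr0 !mulr0.
Qed.

Lemma sum_chi (u w : rep) (g : rep -> R) : \sum_a chi R u w a * g a = g u - g w.
Proof.
have h z : \sum_a (a == z)%:R * g a = g z.
  rewrite (bigD1 z) //= eqxx mul1r big1 ?addr0 // => a /negPf ->; exact: mul0r.
by rewrite -(h u) -(h w) -sumrB; apply: eq_bigr => a _; rewrite mulrBl.
Qed.

(* The cavity term of the expansion reproduces the factor [T_{k,l}] itself. *)
Lemma kernel_pair (w w' : rep -> R) (F : rep -> rep -> R) :
  (forall a, a \in [:: K; L_; r; r'] -> w a = 1 /\ w' a = 1) ->
  (forall a b, F a b = F b a) ->
  \sum_(ab : rep * rep) beta ^+ 2 / 2 * (w ab.1 * w' ab.2) * (A * quad ab.1 ab.2 * F ab.1 ab.2) =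
  beta ^+ 2 * A * \sum_(t <- c1) t.1.1 * F t.1.2 t.2.
Proof.
move=> w1 FC.
have chi_w u u' a : u \in [:: K; L_; r; r'] -> u' \in [:: K; L_; r; r'] ->
    w a * chi R u u' a = chi R u u' a /\ w' a * chi R u u' a = chi R u u' a.
  move=> hu hu'; rewrite /chi; case: eqP => [->|_].
    by have [-> ->] := w1 u hu; rewrite !mul1r.
  case: eqP => [->|_]; first by have [-> ->] := w1 u' hu'; rewrite !mul1r.
  by rewrite subrr !mulr0.
have [mK mL mr mr'] : [/\ K \in [:: K; L_; r; r'], L_ \in [:: K; L_; r; r'],
   r \in [:: K; L_; r; r'] & r' \in [:: K; L_; r; r']] by rewrite !inE !eqxx !orbT.
(* The two halves of [quad] are exchanged by swapping the indices and, [F] being symmetric, have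
   equal sums; together they absorb the factor 1/2. *)
have E a b : beta ^+ 2 / 2 * (w a * w' b) * (A * quad a b * F a b) =
   beta ^+ 2 / 2 * A * (chi R K r a * (chi R L_ r' b * F a b)) +
   beta ^+ 2 / 2 * A * (chi R K r b * (chi R L_ r' a * F b a)).
  have [e1 e1'] := chi_w K r a mK mr; have [e2 e2'] := chi_w L_ r' b mL mr'.
  have [e3 e3'] := chi_w K r b mK mr; have [e4 e4'] := chi_w L_ r' a mL mr'.
  rewrite [F b a]FC /quad.
  rewrite -[in RHS]e1 -[in RHS]e2' -[in RHS]e3' -[in RHS]e4.
  by move: (chi R K r a) (chi R L_ r' b) (chi R K r b) (chi R L_ r' a) (F a b) => x1 x2 x3 x4 x5; ring.
have E1 : \sum_a chi R K r a * (\sum_b chi R L_ r' b * F a b) = F K L_ - F K r' - (F r L_ - F r r').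
  rewrite -(sum_chi L_ r' (F K)) -(sum_chi L_ r' (F r)) -(sum_chi K r (fun a => \sum_b chi R L_ r' b * F a b)) //.
rewrite -(pair_bigA _ (fun a b => beta ^+ 2 / 2 * (w a * w' b) * (A * quad a b * F a b))) /=.
under eq_bigr do under eq_bigr do rewrite E.
under eq_bigr do rewrite big_split -!mulr_sumr.
rewrite big_split /= -!mulr_sumr.
rewrite (_ : \sum_a \sum_b chi R K r b * (chi R L_ r' a * F b a) = F K L_ - F K r' - (F r L_ - F r r')); last first.
  by rewrite exchange_big -E1 /=; apply: eq_bigr => a _; rewrite mulr_sumr.
rewrite E1 !big_cons big_nil /=.
move: (F _ _) (F _ _) (F _ _) (F _ _) => x1 x2 x3 x4; by field.
Qed.

(** Selects the support [J] of all the forms; the four spare replicas outside it are the fresh ones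
    that the expansion asks for. *)
Definition nonspare (x : rep) : bool := if x is inr (inr _) then false else true.
Let J : {set rep} := [set x | nonspare x]%SET.
Let sp (j : nat) : rep := spare n m (inord j).

Lemma supp_factor_form u : supp J (LF u).
Proof. by case: u => -[[k' l']|[[k'|] []]] w; rewrite /supp /= !finset.inE. Qed.

Let sp_neq i j : (i < 4)%N -> (j < 4)%N -> i != j -> sp i != sp j.
Proof.
by move=> hi hj; apply: contra => /eqP[/(congr1 val)]; rewrite /= !inordK // => ->.
Qed.

Lemma NU_Uq N (i : 'I_N) (c : lform R rep) (G : {ffun rep -> config N S} -> R) :
  NU (fun rho : {ffun rep -> config N S} => Uq p q c rho * G rho) =
  \sum_(t <- c) t.1.1 * NU (fun rho : {ffun rep -> config N S} => Uf p q rho t.1.2 t.2 * G rho).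
Proof.
rewrite -(nut_1 beta D hf p q i).
under eq_bigr do rewrite -(nut_1 beta D hf p q i) -nutZ.
rewrite -nut_sum; apply: eq_nut => rho.
by rewrite /Uq mulr_suml; apply: eq_bigr => t _; rewrite mulrA.
Qed.

Lemma pair_recursion (L : seq (factor_type n * 'I_m)) :
  uniq (v :: map snd L) -> all ordered (map fst L) ->
  bigO (size L).+2 (fun N (_ : 'I_N) (_ : R) =>
    (1 - beta ^+ 2 * A) * VNN N (inl (k, l) :: map fst L)
    - A * \sum_(pr <- dels (map fst L) | pr.1 == inl (k, l)) N%:R^-1 * VNN N pr.2).
Proof.
move=> uL oL.
have j1 : sp 0 \notin J by rewrite finset.inE.
have j2 : sp 1 \notin (sp 0 |: J)%SET by rewrite !finset.inE negb_or sp_neq.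
have j3 : sp 2 \notin (sp 1 |: (sp 0 |: J))%SET by rewrite !finset.inE !negb_or !sp_neq.
have j4 : sp 3 \notin (sp 2 |: (sp 1 |: (sp 0 |: J)))%SET by rewrite !finset.inE !negb_or !sp_neq.
have sL : all (supp J) (map LF L) by rewrite all_map; apply/allP => u _; exact: supp_factor_form.
have := expansion fp HY j1 j2 j3 j4 (supp_factor_form (inl (k, l), v)) sL.
rewrite size_map; apply: eq_bigO => N i t.
rewrite -/c1.
have VE (L' : seq (factor_type n * 'I_m)) : uniq (map snd L') -> all ordered (map fst L') ->
    NU (fun rho : {ffun rep -> config N S} => \prod_(c <- map LF L') Uq p q c rho) = VNN N (map fst L').
  move=> u o; rewrite factor_avg_forms //; move: o; rewrite all_map; apply: sub_all => x; exact: ordered_good.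
have E1 : NU (fun rho : {ffun rep -> config N S} => \prod_(c <- c1 :: map LF L) Uq p q c rho) =
    VNN N (inl (k, l) :: map fst L).
  by rewrite -[c1 :: _]/(map LF ((inl (k, l), v) :: L)) VE //= kl.
move: uL => /= /andP[vL uL].
have E2 : \sum_(pr <- dels (map LF L)) N%:R^-1 * (ES (fun x => phq p q c1 x * psq pr.1 x) *
      NU (fun rho : {ffun rep -> config N S} => \prod_(c <- pr.2) Uq p q c rho)) =
   A * \sum_(pr <- dels (map fst L) | pr.1 == inl (k, l)) N%:R^-1 * VNN N pr.2.
  rewrite !dels_map !big_map /= [in RHS]big_mkcond mulr_sumr; apply: eq_big_seq => pr hpr.
  have [m1 m2] := mem_dels hpr; have ss := dels_subseq hpr.
  have o2 : all ordered (map fst pr.2) by apply/allP => z /(mem_subseq (map_subseq _ ss)); exact: (allP oL).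
  have u2 : uniq (map snd pr.2) by apply: subseq_uniq uL; exact: map_subseq.
  rewrite VE // Es_pair_psq; first last.
  - by apply: contraNneq vL => <-; exact: map_f.
  - by apply: (allP oL); exact: map_f.
  by case: eqP => _; rewrite ?mulr1 ?mulr0 ?mul0r ?mulr0 // mulrCA.
pose F a b := NU (fun rho : {ffun rep -> config N S} => Uf p q rho a b * \prod_(c <- map LF L) Uq p q c rho).
have E3 : \sum_(ab : rep * rep) beta ^+ 2 / 2 * (wgtJ R J (sp 0) ab.1 * wgtJ R (sp 0 |: J)%SET (sp 1) ab.2) *
    (ES (fun x => phq p q c1 x * (spin R (x ab.1) * spin R (x ab.2))) *
     NU (fun rho : {ffun rep -> config N S} => \prod_(c <- [:: (1, ab.1, ab.2)] :: map LF L) Uq p q c rho)) =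
   beta ^+ 2 * A * VNN N (inl (k, l) :: map fst L).
  rewrite -E1.
  have -> : NU (fun rho : {ffun rep -> config N S} => \prod_(c <- c1 :: map LF L) Uq p q c rho) =
      \sum_(t <- c1) t.1.1 * F t.1.2 t.2.
    rewrite -(NU_Uq i c1); congr (nuI _ _ _ _); apply/funext => rho; exact: big_cons.
  rewrite -(@kernel_pair (wgtJ R J (sp 0)) (wgtJ R (sp 0 |: J)%SET (sp 1)) F); first last.
  - move=> a b; rewrite /F; congr nuI; apply/funext => rho; congr (_ * _).
    by rewrite /Uf /Qm eq_sym; congr (_ * _ - _); apply: eq_bigr => z _; exact: mulrC.
  - move=> a ha; rewrite /wgtJ; suff aJ : a \in J by rewrite aJ finset.in_setU1 aJ orbT.
    by rewrite finset.inE; move: ha; rewrite !inE => /or4P[] /eqP ->.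
  apply: eq_bigr => ab _; rewrite Es_pair; congr (_ * (_ * _)).
  congr nuI; apply/funext => rho; rewrite big_cons {1}/Uq big_cons big_nil /= mul1r addr0 //.
rewrite E1 E2 E3; move: (VNN N _) (\sum_(pr <- _ | _) _) => x y; ring.
Qed.

End Pair.
End Recursion.

(** * Bounds on the constant [A] *)

Section AconstBounds.
Variables (R : realType) (S : nat) (beta D hf p q : R).
Local Notation A := (Aconst S beta D hf p q).

Lemma Aconst_ge0 : 0 <= A.
Proof. by apply: Rintegral_ge0 => x _; exact: sqr_ge0. Qed.

(** By [Es_quad], [A] is itself a one-site expectation: that of two differences, each at most
    [2 * S], times two spins, each at most [S]. *)
Lemma Aconst_le : A <= 4 * S%:R ^+ 4.
Proof.
pose j (a : nat) : 'I_4 := inord a.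
have jn a b : (a < 4)%N -> (b < 4)%N -> a != b -> j a != j b.
  by move=> ha hb; apply: contra => /eqP/(congr1 val); rewrite /= !inordK // => ->.
have := @Es_quad R S beta D hf p q _ (j 0) (j 1) (j 2) (j 3)
  (jn 0%N 1%N isT isT isT) (jn 0%N 2%N isT isT isT) (jn 0%N 3%N isT isT isT) (jn 1%N 2%N isT isT isT)
  (jn 1%N 3%N isT isT isT) (jn 2%N 3%N isT isT isT) (j 0) (j 2).
rewrite /chi !eqxx (negPf (jn 0%N 1%N isT isT isT)) (negPf (jn 2%N 3%N isT isT isT))
  (negPf (jn 2%N 0%N isT isT isT)) (negPf (jn 2%N 1%N isT isT isT)) !subr0 mul0r addr0 !mulr1 => <-.
apply: le_trans (ler_norm _) _; apply: Es_bound => x.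
have B a : `|spin R (x a)| <= S%:R by exact: spin_bound.
have B2 a b : `|spin R (x a) - spin R (x b)| <= 2 * S%:R.
  by apply: le_trans (ler_normB _ _) _; rewrite mulr_natl mulr2n lerD.
have -> : 4 * S%:R ^+ 4 = (2 * S%:R * (2 * S%:R)) * (S%:R * S%:R) :> R by ring.
by rewrite !(normrM (_ * _)) !normrM; do ?apply: ler_pM.
Qed.

End AconstBounds.

Lemma bigOM (R : realType) m1 m2 (f1 f2 : forall N, 'I_N -> R -> R) : bigO m1 f1 -> bigO m2 f2 ->
  bigO (m1 + m2) (fun N i t => f1 N i t * f2 N i t).
Proof.
move=> [C [C0 h]] [C' [C0' h']]; exists (C * C'); split; first exact: mulr_ge0.
move=> N i t ht; rewrite normrM exprD mulrACA.
by apply: ler_pM => //; [exact: h|exact: h'].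
Qed.

(** * Eliminating the pair factors *)

Section Types.
Variables (R : realType) (S n : nat) (beta D hf p q : R).
Hypotheses (b0 : 0 < beta) (b1 : beta <= 1) (fp : fixed_point S beta D hf p q).
Hypothesis moments4 : forall k : nat, exists C, 0 <= C /\ forall N, (0 < N)%N ->
    \sum_(a : 'I_4) \sum_(b : 'I_4) nuI beta D hf
      (fun rho : {ffun 'I_4 -> config N S} => Uf p q rho a b ^+ k.*2) <= C / N%:R ^+ k.
Local Notation A := (Aconst S beta D hf p q).
Let g : R := 1 - beta ^+ 2 * A.
Hypothesis g0 : 0 < g.
Local Notation VNN N := (@factor_avg R S n N beta D hf p q).
Implicit Types T : seq (factor_type n).

Lemma factor_avg_perm N T1 T2 : perm_eq T1 T2 -> VNN N T1 = VNN N T2.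
Proof.
move=> h; rewrite /factor_avg; congr nu; apply/funext => ?; apply/funext => rho; exact: perm_big.
Qed.

Lemma type_recursion (k l : 'I_n) T : (k < l)%N -> all (@ordered n) T ->
  bigO (size T).+2 (fun N (_ : 'I_N) (_ : R) => g * VNN N (inl (k, l) :: T)
    - A * ((count_mem (inl (k, l)) T)%:R * (N%:R^-1 * VNN N (rem (inl (k, l)) T)))).
Proof.
move=> kl oT; pose m := (size T).+1.
have I4 : (4 <= #|{: Rep n m}|)%N by rewrite !card_sum !card_ord addnA leq_addl.
(* The replica set grows with [T], but its moments are inherited from four replicas, so [beta] is
   not restricted further. *)
have HY := Yb_moment b0 b1 fp moments4 I4.
(* The label [ord0] is reserved for the pair factor in front; the factors of [T] take the lifted
   labels. *)
pose L := zip T (map (lift (ord0 : 'I_m)) (enum 'I_(size T))).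
have sE : size (map (lift (ord0 : 'I_m)) (enum 'I_(size T))) = size T by rewrite size_map size_enum_ord.
have L1 : map fst L = T by apply: unzip1_zip; rewrite sE.
have L2 : ord0 :: map snd L = enum 'I_m.
  by rewrite enum_ordSl; congr (_ :: _); apply: unzip2_zip; rewrite sE.
have uL : uniq ((ord0 : 'I_m) :: map snd L) by rewrite L2 enum_uniq.
have oL : all (@ordered n) (map fst L) by rewrite L1.
have := pair_recursion fp HY kl uL oL.
rewrite L1 -(size_map fst L) L1; apply: eq_bigO => N i t.
by rewrite (@sum_dels R _ _ _ (fun T' => N%:R^-1 * VNN N T')) // => l1 l2 h; rewrite (factor_avg_perm N h).
Qed.

Definition pair_weight N h : R := gmoment R h * powR (A2sq N S beta D hf p q) (h%:R / 2).

Let theta : R := A / g.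
Let theta0 : 0 <= theta. Proof. by rewrite divr_ge0 ?Aconst_ge0 // ltW. Qed.

Lemma A2sqE N : A2sq N S beta D hf p q = theta * N%:R^-1.
Proof. by rewrite /A2sq invfM mulrCA mulrC. Qed.

Lemma A2sq_ge0 N : 0 <= A2sq N S beta D hf p q.
Proof. by rewrite A2sqE mulr_ge0 ?invr_ge0. Qed.

Lemma pair_weight0 N : pair_weight N 0 = 1.
Proof. by rewrite /pair_weight gmoment0 mul0r powRr0 mulr1. Qed.

Lemma pair_weight1 N : pair_weight N 1 = 0.
Proof. by rewrite /pair_weight gmoment1 mul0r. Qed.

Lemma pair_weightSS N h : pair_weight N h.+2 = h.+1%:R * (theta * N%:R^-1) * pair_weight N h.
Proof.
rewrite /pair_weight gmomentSS -A2sqE.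
have -> : h.+2%:R / 2 = h%:R / 2 + 1 :> R by rewrite -addn2 natrD; field.
rewrite powRD; last first.
  by apply/implyP => /eqP e; have : 0 <= h%:R :> R by []; lra.
rewrite powRr1 ?A2sq_ge0 //.
ring.
Qed.

Lemma pair_weight_bound h : bigO h (fun N (_ : 'I_N) (_ : R) => pair_weight N h).
Proof.
exists (`|gmoment R h| * powR theta (h%:R / 2)); split; first by rewrite mulr_ge0 ?powR_ge0.
move=> N i t _; rewrite /pair_weight A2sqE normrM -[leRHS]mulrA; apply: ler_wpM2l => //.
rewrite ger0_norm ?powR_ge0 // powRM ?invr_ge0 //; apply: ler_wpM2l; first exact: powR_ge0.
by rewrite -dlt_sqr -powR_mulrn ?dlt_ge0 // -powRrM mulrCA divff // mulr1 powR_mulrn ?dlt_ge0.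
Qed.

Lemma pair_moments (k l : 'I_n) T h : (k < l)%N -> all (@ordered n) T -> inl (k, l) \notin T ->
  bigO (h + size T).+1 (fun N (_ : 'I_N) (_ : R) =>
    VNN N (nseq h (inl (k, l)) ++ T) - pair_weight N h * VNN N T).
Proof.
move=> kl oT cT; have gn : g != 0 by rewrite gt_eqF.
have cT0 : count_mem (inl (k, l)) T = 0%N by apply/count_memPn.
(* The recursion lowers the exponent by two, so two consecutive exponents are carried along. *)
suff : forall h, bigO (h + size T).+1 (fun N (_ : 'I_N) (_ : R) =>
    VNN N (nseq h (inl (k, l)) ++ T) - pair_weight N h * VNN N T) /\
   bigO (h.+1 + size T).+1 (fun N (_ : 'I_N) (_ : R) =>
    VNN N (nseq h.+1 (inl (k, l)) ++ T) - pair_weight N h.+1 * VNN N T) by move=> /(_ h) [].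
elim=> [|h' [IH1 IH2]]; split=> //.
- by apply: eq_bigO (bigO0 _ _) => N i t; rewrite pair_weight0 mul1r subrr.
- apply: eq_bigO (bigOZ g^-1 (type_recursion kl oT)) => N i t.
  by rewrite cT0 mul0r mulr0 subr0 mulKf // pair_weight1 mul0r subr0.
have oT' : all (@ordered n) (nseq h'.+1 (inl (k, l)) ++ T) by rewrite all_cat all_nseq /= kl.
have := type_recursion kl oT'; rewrite size_cat size_nseq => E.
(* The factor [1 / N] in front of the shorter product raises the order of [IH1] by two, which makes
   up for the two missing factors. *)
have := bigOD (bigOZ g^-1 E) (bigOZ (theta * h'.+1%:R) (bigO_invn IH1)).
apply: eq_bigO => N i t.
rewrite count_cat cT0 addn0 count_nseq /= !eqxx mul1n pair_weightSS.
move: (VNN N _) (VNN N _) (VNN N _) (pair_weight N h') => x y z w.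
by rewrite /theta; move: (N%:R^-1) (h'.+1%:R) => a b; field.
Qed.

Definition pair_types (f : 'I_n * 'I_n -> nat) (P : seq ('I_n * 'I_n)) : seq (factor_type n) :=
  flatten [seq nseq (f c) (inl c) | c <- P].

(** The pairs are eliminated one at a time. Since [P] has no repetition, the pair being eliminated
    is absent from what follows, as [pair_moments] requires. *)
Lemma pairs_moments (f : 'I_n * 'I_n -> nat) (P : seq ('I_n * 'I_n)) T0 :
  uniq P -> all (fun c : 'I_n * 'I_n => c.1 < c.2)%N P ->
  all (@ordered n) T0 -> (forall c, inl c \notin T0) ->
  bigO (size (pair_types f P ++ T0)).+1 (fun N (_ : 'I_N) (_ : R) =>
    VNN N (pair_types f P ++ T0) - (\prod_(c <- P) pair_weight N (f c)) * VNN N T0).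
Proof.
move=> uP kP oT0 nT0; elim: P uP kP => [|[k l] P IH] /=.
  by move=> _ _; apply: eq_bigO (bigO0 _ _) => N i t; rewrite big_nil mul1r subrr.
move=> /andP[cP uP] /andP[kl kP].
set T := pair_types f P ++ T0.
have mT c : inl c \in T -> c \in P.
  rewrite mem_cat (negPf (nT0 _)) orbF => /flattenP[s /mapP[c' c'P ->]].
  by rewrite mem_nseq => /andP[_ /eqP[->]].
have oT : all (@ordered n) T.
  rewrite all_cat oT0 andbT; apply/allP => -[c|//] cT.
  have := allP kP c (mT c _); rewrite mem_cat cT /=; case: c {cT} => a b; exact.
have cT : inl (k, l) \notin T by apply: contra cP; exact: mT.
have E : pair_types f ((k, l) :: P) ++ T0 = nseq (f (k, l)) (inl (k, l)) ++ T by rewrite /T catA.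
rewrite E size_cat size_nseq.
have H1 := pair_moments (f (k, l)) kl oT cT.
(* A weight with exponent [h] has order [h], so multiplying the error of the remaining pairs by it
   restores the order of the whole product. *)
have H2 := bigOM (pair_weight_bound (f (k, l))) (IH uP kP).
rewrite -/T addnS in H2.
apply: eq_bigO (bigOD H1 H2) => N i t; rewrite big_cons.
by move: (VNN N _) (VNN N _) (VNN N _) (pair_weight _ _) (\prod_(c <- P) _) => x y z u w; ring.
Qed.

End Types.

Lemma big_lt_pairs (T : Type) (idx : T) (op : Monoid.com_law idx) n (F : 'I_n * 'I_n -> T) :
  \big[op/idx]_(kl <- [seq kl : 'I_n * 'I_n <- index_enum ('I_n * 'I_n)%type | (kl.1 < kl.2)%N]) F kl =
  \big[op/idx]_(k < n) \big[op/idx]_(l < n | (k < l)%N) F (k, l).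
Proof.
rewrite big_filter (pair_big_dep _ _ (fun k l => F (k, l))) /=.
by apply: eq_bigr => -[].
Qed.

Section FlattenNseq.
Variables (T U : Type) (f : T -> nat) (F : T -> U) (s : seq T).

Lemma prod_flatten_nseq (R : comNzRingType) (V : U -> R) :
  \prod_(x <- flatten [seq nseq (f c) (F c) | c <- s]) V x = \prod_(c <- s) V (F c) ^+ f c.
Proof.
rewrite big_flatten big_map; apply: eq_bigr => c _.
by rewrite big_nseq iter_mulr_1.
Qed.

Lemma size_flatten_nseq : size (flatten [seq nseq (f c) (F c) | c <- s]) = (\sum_(c <- s) f c)%N.
Proof.
elim: s => [|c s' IH]; first by rewrite big_nil.
by rewrite /= size_cat size_nseq IH big_cons.
Qed.

End FlattenNseq.

Theorem theorem4p2 (R : realType) (S : nat) (hf D : R) :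
  (1 <= S)%N -> 0 <= hf ->
  exists beta' : R, 0 < beta' /\
  forall beta : R, 0 < beta -> beta < beta' ->
  forall p q : R, fixed_point S beta D hf p q ->
  forall (n : nat) (hkl : 'I_n -> 'I_n -> nat) (hk hpk : 'I_n -> nat) (h0 hp : nat),
  let H := ((\sum_(k < n) \sum_(l < n | (k < l)%N) hkl k l)
            + (\sum_(k < n) hk k) + h0 + (\sum_(k < n) hpk k) + hp)%N in
  exists C : R, forall N : nat, (2 <= N)%N ->
  let b := fun (g : disorder R) (i : 'I_N) => bmag S beta D hf g i in
  let bt := fun (g : disorder R) (i : 'I_N) => bmag2 S beta D hf g i in
  let rest := fun (g : disorder R) (rho : {ffun 'I_n -> config N S}) =>
     (\prod_(k < n) Tk (b g) rho k ^+ hk k) * Tq (b g) q ^+ h0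
     * (\prod_(k < n) Sk (bt g) rho k ^+ hpk k) * Sp (bt g) p ^+ hp in
  `| nu beta D hf (fun g rho =>
          (\prod_(k < n) \prod_(l < n | (k < l)%N) Tkl (b g) rho k l ^+ hkl k l)
          * rest g rho)
     - (\prod_(k < n) \prod_(l < n | (k < l)%N)
          (gmoment R (hkl k l) * powR (A2sq N S beta D hf p q) ((hkl k l)%:R / 2)))
       * nu beta D hf rest |
  <= C / Num.sqrt (N%:R) ^+ H.+1.
Proof.
move=> _ _.
have I4 : (4 <= #|{: 'I_4}|)%N by rewrite card_ord.
have [beta0 [b00 b01 HM]] := overlap_moments S D hf I4.
(* [A] is below [B], so [beta < B^-1] together with [beta <= 1] gives [beta ^+ 2 * A < 1]; the
   summand 1 keeps [B] positive. *)
pose B : R := 4 * S%:R ^+ 4 + 1.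
have S4 : 0 <= 4 * S%:R ^+ 4 :> R by rewrite mulr_ge0 ?exprn_ge0.
have B0 : 0 < B by rewrite ltr_wpDl.
exists (Num.min beta0 B^-1); split; first by rewrite lt_min b00 invr_gt0.
move=> beta b0; rewrite lt_min => /andP[bb0 bB] p q fp n hkl hk hpk h0 hp H.
have b1 : beta <= 1 by rewrite (le_trans (ltW bb0)).
have g0 : 0 < 1 - beta ^+ 2 * Aconst S beta D hf p q.
  have A0 := Aconst_ge0 S beta D hf p q; have AB := Aconst_le S beta D hf p q.
  have bB1 : beta * B < 1 by rewrite -ltr_pdivlMr // mul1r.
  rewrite subr_gt0; apply: le_lt_trans bB1.
  apply: (@le_trans _ _ (beta * Aconst S beta D hf p q)).
    by apply: ler_wpM2r => //; rewrite expr2 ler_piMl // ltW.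
  by apply: ler_wpM2l; [exact: ltW|rewrite (le_trans AB) // lerDl].
pose P := [seq kl : 'I_n * 'I_n <- index_enum ('I_n * 'I_n)%type | (kl.1 < kl.2)%N].
pose f (c : 'I_n * 'I_n) := hkl c.1 c.2.
pose fl (e : bool) (h : 'I_n -> nat) : seq (factor_type n) :=
  flatten [seq nseq (h k) (inr (Some k, e)) | k <- index_enum 'I_n].
(* The blocks follow the order of the factors in [rest], so that the product over [T0] unfolds to it
   directly. *)
pose T0 : seq (factor_type n) := ((fl false hk ++ nseq h0 (inr (None, false))) ++ fl true hpk) ++
  nseq hp (inr (None, true)).
have T0inr x : x \in T0 -> if x is inr _ then true else false.
  have flinr e h : x \in fl e h -> if x is inr _ then true else false.
    by move=> /flattenP[s /mapP[k _ ->]]; rewrite mem_nseq => /andP[_ /eqP ->].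
  rewrite !mem_cat !mem_nseq => /orP[/orP[/orP[/flinr//|]|/flinr//]|]; by move=> /andP[_ /eqP ->].
have uP : uniq P by rewrite filter_uniq // index_enum_uniq.
have kP : all (fun c : 'I_n * 'I_n => c.1 < c.2)%N P by apply/allP => c; rewrite mem_filter => /andP[].
have oT0 : all (@ordered n) T0 by apply/allP => x /T0inr; case: x.
have nT0 c : inl c \notin T0 by apply/negP => /T0inr.
have [C [C0 HC]] := pairs_moments b0 b1 fp (HM beta b0 bb0 p q fp) g0 f uP kP oT0 nT0.
exists C => N N2; cbv zeta.
(* The estimated quantity depends on neither the site nor the time over which [bigO] quantifies;
   site 0 and time 0 instantiate them. *)
have := HC N (Ordinal (ltnW N2)) 0; rewrite lexx ler01 => /(_ isT).
have -> : size (pair_types f P ++ T0) = H.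
  by rewrite !size_cat !size_nseq !size_flatten_nseq big_lt_pairs !addnA.
rewrite /dlt exprVn; congr (`| _ - _ * _ | <= _).
- congr nu; apply/funext => g; apply/funext => rho.
  by rewrite !big_cat !big_nseq !iter_mulr_1 /= !prod_flatten_nseq big_lt_pairs.
- by rewrite big_lt_pairs.
- congr nu; apply/funext => g; apply/funext => rho.
  by rewrite !big_cat !big_nseq !iter_mulr_1 /= !prod_flatten_nseq.
Qed.
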